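(* Let $\Gamma\curvearrowright(X,\mu)$ be a probability measure-preserving action, and let $\pi:(X,\mu)\to(Y,\nu)$ be a ($\Gamma$-equivariant, measure-preserving) factor map onto a probability measure-preserving action $\Gamma\curvearrowright(Y,\nu)$ with $(Y,\nu)$ diffuse. If $\Gamma\curvearrowright(X,\mu)$ is properly proximal, then so is $\Gamma\curvearrowright(Y,\nu)$.
   Context: A p.m.p. action on $(X,\mu)$ is properly proximal if the induced trace-preserving action on $M=L^\infty(X,\mu)$ (with trace $\tau=\int\cdot\,d\mu$) is properly proximal in the following sense. Let $(M,\tau)$ be a von Neumann algebra with faithful normal tracial state, $M\subset L^2M\subset L^1M$ the natural inclusions, $J\hat x=\widehat{x^*}$ the conjugation on $L^2M$. For $T\in\mathbb B(L^2M)$ put $\|T\|_{\infty,1}=\sup\{\|T\hat x\|_1:x\in M,\|x\|\le1\}$; $\mathbb K^{\infty,1}(M)$ is the $\|\cdot\|_{\infty,1}$-closure of $\mathbb K(L^2M)$ in $\mathbb B(L^2M)$; $\mathbb S(M)=\{T\in\mathbb B(L^2M)\mid[T,JxJ]\in\mathbb K^{\infty,1}(M)\ \forall x\in M\}$, an operator system containing $M$ and $\mathbb K^{\infty,1}(M)$. A trace-preserving action $\Gamma\curvearrowright^\alpha(M,\tau)$ gives Koopman unitaries $\alpha_t^0\hat x=\widehat{\alpha_t(x)}$, and $\Gamma$ acts on $\mathbb B(L^2M)$ by conjugation by $\alpha_t^0$, preserving $\mathbb S(M)$. The action is weakly compact if there is a state $\varphi$ on $\mathbb B(L^2M)$ with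 $\varphi_{|M}=\tau$ that is $M$-central ($\varphi(xT)=\varphi(Tx)$, $x\in M$) and $\Gamma$-invariant. The action is properly proximal if (i) there is no non-zero $\Gamma$-invariant projection $p\in\mathcal Z(M)$ such that $\Gamma\curvearrowright Mp$ (with normalized trace) is weakly compact, and (ii) there is no $\Gamma$-invariant $M$-central state on $\mathbb S(M)$ that vanishes on $\mathbb K^{\infty,1}(M)$ and is normal when restricted to $M$. *)

(* Defs.v *)
From HB Require Import structures.
From mathcomp Require Import all_boot all_order all_algebra.
From mathcomp Require Import complex generic_quotient ring_quotient.
From mathcomp Require Import all_classical all_reals all_analysis.
From mathcomp Require Import measurable_realfun ess_sup_inf.
Import Order.TTheory GRing.Theory Num.Theory.
Import numFieldNormedType.Exports.
Import ComplexField.Normc.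

Set Implicit Arguments.
Unset Strict Implicit.
Unset Printing Implicit Defensive.

Local Open Scope classical_set_scope.
Local Open Scope ring_scope.

(** The L^p spaces of the library are spaces of real functions; von Neumann
    algebras are complex, hence the following R[i]-valued version. *)

Section ComplexLp.
Context d (X : measurableType d) (R : realType).
Implicit Types f g : X -> R[i].
Local Notation cRe := (@complex.Re R).
Local Notation cIm := (@complex.Im R).

Definition cmeasurable f :=
  measurable_fun [set: X] (cRe \o f) /\
  measurable_fun [set: X] (cIm \o f).

Definition cintegral (mu : {measure set X -> \bar R}) f : R[i] :=
  (\int[mu]_x cRe (f x) +i* \int[mu]_x cIm (f x))%C.

Definition cLnorm (mu : {measure set X -> \bar R}) (p : \bar R) f : \bar R :=
  'N[mu]_p[EFin \o (@normc R \o f)].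

Lemma measurable_normc f : cmeasurable f ->
  measurable_fun [set: X] (@normc R \o f).
Proof.
move=> [mr mi].
rewrite (_ : _ \o _ =
    Num.sqrt \o (fun x => cRe (f x) ^+ 2 + cIm (f x) ^+ 2)); last first.
  by apply/funext => x /=; case: (f x).
apply: measurableT_comp; last first.
  by apply: measurable_funD;
    [exact: (measurable_funX 2 mr)|exact: (measurable_funX 2 mi)].
by apply: continuous_measurable_fun; exact: sqrt_continuous.
Qed.

Lemma cmeasurable0 : cmeasurable 0.
Proof. by split; exact: measurable_cst. Qed.

Lemma cmeasurableP a f g : cmeasurable f -> cmeasurable g ->
  cmeasurable (a *: f + g).
Proof.
move=> [fr fi] [gr gi]; split.
- rewrite (_ : _ \o _ = (fun x => (cRe a * cRe (f x) -
    cIm a * cIm (f x)) + cRe (g x))); last first.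
    by apply/funext => x /=; rewrite -[(a *: f + g) x]/(a * f x + g x);
       case: a (f x) (g x) => ? ? [? ?] [].
  apply: measurable_funD => //; apply: measurable_funB;
    exact: measurable_funM.
- rewrite (_ : _ \o _ = (fun x => (cRe a * cIm (f x) +
    cIm a * cRe (f x)) + cIm (g x))); last first.
    by apply/funext => x /=; rewrite -[(a *: f + g) x]/(a * f x + g x);
       case: a (f x) (g x) => ? ? [? ?] [].
  apply: measurable_funD => //; apply: measurable_funD;
    exact: measurable_funM.
Qed.

Variables (mu : {measure set X -> \bar R}) (p : \bar R) (p1 : (1 <= p)%E).

Lemma normc_ge0 (z : R[i]) : 0 <= normc z.
Proof. by case: z => a b; exact: sqrtr_ge0. Qed.

Lemma le_cLnormD f g : cmeasurable f -> cmeasurable g ->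
  (cLnorm mu p (f + g)%R <= cLnorm mu p f + cLnorm mu p g)%E.
Proof.
move=> mf mg.
have mfn := measurable_normc mf; have mgn := measurable_normc mg.
apply: le_trans (eminkowski mu mfn mgn p1); rewrite /cLnorm unlock /Lnorm.
have fg x : normc ((f + g) x) <= `|normc (f x) + normc (g x)|.
  by rewrite ger0_norm ?addr_ge0 ?normc_ge0//; exact: le_normcD.
case: p p1 => [r r1|_|//].
- have r0 : 0 <= r by rewrite -lee_fin (le_trans _ r1).
  have mfg : cmeasurable (f + g) by rewrite -[f]scale1r; exact: cmeasurableP.
  have mpow (h : X -> R) : measurable_fun [set: X] h ->
      measurable_fun [set: X] (fun x => (`|h x| `^ r)%:E).
    move=> mh; apply/measurable_EFinP.
    by apply: (measurableT_comp (measurable_powR r)); exact: measurableT_comp.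
  rewrite gt0_ler_poweR ?invr_ge0 ?in_itv/= ?leey ?andbT ?integral_ge0//.
  apply: ge0_le_integral => //.
  + exact: mpow (measurable_normc mfg).
  + by apply: mpow; exact: measurable_funD.
  + move=> x _; rewrite lee_fin ge0_ler_powR ?nnegrE//.
    by rewrite ger0_norm ?normc_ge0// fg.
- case: ifPn => // _; apply: le_ess_sup; apply/nearW => x /=.
  by rewrite lee_fin ger0_norm ?normc_ge0// fg.
Qed.

Lemma cLnormZ a f : cmeasurable f -> (cLnorm mu p f < +oo)%E ->
  cLnorm mu p (a *: f) = ((normc a)%:E * cLnorm mu p f)%E.
Proof.
move=> mf foo.
have nfP : (@normc R \o f) \in Lfun mu p.
  apply/andP; split; rewrite inE //=; exact: measurable_normc.
have := LnormZ (Lfun_Sub p1 nfP) (normc a).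
rewrite /= ger0_norm ?normc_ge0// => <-.
apply: eq_Lnorm => x /=; congr (_%:E).
exact: normcM.
Qed.

(* The proof that 1 <= p is a parameter of the predicate and of the types below
   so that it can be found by unification when instances are resolved. *)
Definition cLfun (q1 : (1 <= p)%E) : {pred X -> R[i]} :=
  [pred f | `[< cmeasurable f /\ (cLnorm mu p f < +oo)%E >]].

Lemma cLfun_submod_closed : submod_closed (cLfun p1).
Proof.
split => [|a f g].
  apply/asboolP; split; first exact: cmeasurable0.
  rewrite /cLnorm (_ : _ \o _ = cst 0%E); last first.
    by apply/funext => x /=; congr (_%:E); exact: normc0.
  by rewrite Lnorm0// gt_eqF// (lt_le_trans _ p1).
move=> /asboolP[mf lf] /asboolP[mg lg]; apply/asboolP.
have maf : cmeasurable (a *: f).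
  by rewrite -[a *: f]addr0; exact: cmeasurableP cmeasurable0.
split; first exact: cmeasurableP.
apply: le_lt_trans (le_cLnormD maf mg) _.
by rewrite lte_add_pinfty// cLnormZ// lte_mul_pinfty// lee_fin normc_ge0.
Qed.

HB.instance Definition _ :=
  GRing.isSubmodClosed.Build _ _ (cLfun p1) cLfun_submod_closed.

Record cLfunType (q1 : (1 <= p)%E) :=
  CLfun { cLfun_val :> X -> R[i] ; cLfunP : cLfun_val \in cLfun q1 }.

HB.instance Definition _ := [isSub for (@cLfun_val p1)].
HB.instance Definition _ := [Choice of cLfunType p1 by <:].
HB.instance Definition _ := [SubChoice_isSubLmodule of cLfunType p1 by <:].

Definition cLnull (q1 : (1 <= p)%E) : {pred cLfunType q1} :=
  [pred f : cLfunType q1 | `[< {ae mu, forall x, f x = 0} >]].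

Arguments cLnull q1 : clear implicits.

Lemma cLnull_zmod_closed : zmod_closed (cLnull p1).
Proof.
split => [|f g /asboolP f0 /asboolP g0]; apply/asboolP; first exact: nearW.
apply: filterS2 f0 g0 => x /= fx gx.
by rewrite -[LHS]/(f x - g x) fx gx subrr.
Qed.

HB.instance Definition _ :=
  GRing.isZmodClosed.Build _ (cLnull p1) cLnull_zmod_closed.

End ComplexLp.

Section ComplexLpSpace.
Context d (X : measurableType d) (R : realType).
Variables (mu : {measure set X -> \bar R}) (p : \bar R) (p1 : (1 <= p)%E).
Local Open Scope quotient_scope.

Definition cLp : Type := Quotient.quot (@cLnull _ X R mu p p1).

HB.instance Definition _ := GRing.Zmodule.on cLp.

Definition cLp_fun (f : cLp) : X -> R[i] := cLfun_val (repr f).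
Coercion cLp_fun : cLp >-> Funclass.

(* The class of [f], provided that [f] is p-integrable (0 otherwise). *)
Definition toLp (f : X -> R[i]) : cLp :=
  \pi_cLp (insubd (0 : cLfunType mu p1) f).

Lemma toLpP (f : X -> R[i]) : f \in cLfun mu p1 ->
  {ae mu, forall x, toLp f x = f x}.
Proof.
move=> fP; rewrite /toLp /cLp_fun; set g := insubd _ _.
have gE : cLfun_val g = f by exact: (insubdK (0 : cLfunType mu p1) fP).
have : repr (\pi_cLp g) == g %[mod cLp] by rewrite reprK.
rewrite -Quotient.idealrBE => /asboolP; apply: filterS => x /= /eqP.
by rewrite -[_ x]/(cLfun_val (repr (\pi_cLp g)) x - g x) gE subr_eq0 => /eqP.
Qed.

Lemma cLp_eqP (f g : cLp) : (f = g) <-> {ae mu, forall x, f x = g x}.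
Proof.
split=> [->|fg]; first exact: nearW.
rewrite -[f]reprK -[g]reprK; apply/eqP; rewrite -Quotient.idealrBE.
apply/asboolP; apply: filterS fg => x /= fgx.
by apply/eqP; rewrite -[_ x]/(f x - g x) subr_eq0; apply/eqP.
Qed.

Lemma cLp_funP (f : cLp) : (f : X -> R[i]) \in cLfun mu p1.
Proof. exact: cLfunP. Qed.

Lemma cLpD (f g : cLp) : {ae mu, forall x, cLp_fun (f + g) x = f x + g x}.
Proof.
have : repr (f + g) == repr f + repr g %[mod cLp].
  apply/eqP; rewrite reprK (Quotient.pi_add _ (repr f) (repr g)) !reprK.
  by [].
rewrite -Quotient.idealrBE => /asboolP; apply: filterS => x /= /eqP.
by rewrite -[_ x]/(cLp_fun (f + g) x - (f x + g x)) subr_eq0 => /eqP.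
Qed.

Lemma cLp0 : {ae mu, forall x, cLp_fun (0 : cLp) x = 0}.
Proof.
have : repr (0 : cLp) == 0 %[mod cLp].
  apply/eqP; rewrite reprK; exact: (esym (lock (\pi_cLp 0))).

by rewrite -Quotient.idealrBE subr0 => /asboolP.
Qed.

Definition cLp_scale (a : R[i]) (f : cLp) : cLp := \pi_cLp (a *: repr f).

Lemma cLp_scaleE a (f : cLp) : {ae mu, forall x, cLp_scale a f x = a * f x}.
Proof.
have : repr (cLp_scale a f) == a *: repr f %[mod cLp] by rewrite reprK.
rewrite -Quotient.idealrBE => /asboolP; apply: filterS => x /= /eqP.
by rewrite -[_ x]/(cLp_scale a f x - a * f x) subr_eq0 => /eqP.
Qed.

Lemma cLp_scaleA a b f : cLp_scale a (cLp_scale b f) = cLp_scale (a * b) f.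
Proof.
apply/cLp_eqP; have h := cLp_scaleE.
apply: filterS3 (h a (cLp_scale b f)) (h b f) (h (a * b) f) => x -> -> ->.
by rewrite mulrA.
Qed.

Lemma cLp_scale1 f : cLp_scale 1 f = f.
Proof.
by apply/cLp_eqP; apply: filterS (cLp_scaleE 1 f) => x ->; rewrite mul1r.
Qed.

Lemma cLp_scaleDr : right_distributive cLp_scale +%R.
Proof.
move=> a f g; apply/cLp_eqP; have h := cLp_scaleE a.
apply: filterS2 (filterI (h (f + g)) (cLpD f g)) (filterI (filterI (h f) (h g))
  (cLpD (cLp_scale a f) (cLp_scale a g))) => x [-> ->] [[+ +] ->].
by move=> -> ->; rewrite mulrDr.
Qed.

Lemma cLp_scaleDl f : {morph cLp_scale^~ f : a b / a + b}.
Proof.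
move=> a b; apply/cLp_eqP; have h c := cLp_scaleE c f.
apply: filterS2 (h (a + b)) (filterI (filterI (h a) (h b))
  (cLpD (cLp_scale a f) (cLp_scale b f))) => x -> [[+ +] ->].
by move=> -> ->; rewrite mulrDl.
Qed.

HB.instance Definition _ := GRing.Zmodule_isLmodule.Build R[i] cLp
  cLp_scaleA cLp_scale1 cLp_scaleDr cLp_scaleDl.

Definition cLp_norm (f : cLp) : R[i] := (fine (cLnorm mu p f))%:C%C.

Lemma eq_cLnorm (f g : X -> R[i]) : cmeasurable f -> cmeasurable g ->
  {ae mu, forall x, f x = g x} -> cLnorm mu p f = cLnorm mu p g.
Proof.
move=> mf mg fg; have nfg : {ae mu, forall x, normc (f x) = normc (g x)}.
  by apply: filterS fg => x ->.
rewrite /cLnorm unlock; case: p p1 => [r _|_|//].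
- have mpow h : cmeasurable h ->
    measurable_fun [set: X] (fun x => (`|(EFin \o (@normc R \o h)) x| `^ r)%E).
    move=> mh; apply: (measurableT_comp (measurable_poweR r)).
    by apply: measurableT_comp => //; apply/measurable_EFinP; exact: measurable_normc.
  congr (_ `^ _)%E; apply: ae_eq_integral; [exact: measurableT|exact: mpow..|].
  by apply: filterS nfg => x /= -> _.
- by case: ifPn => // _; apply: eq_ess_sup; apply: filterS nfg => x /= ->.
Qed.

Lemma cLnorm_fin (f : cLp) : cLnorm mu p f \is a fin_num.
Proof.
have /asboolP[_ foo] := cLp_funP f.
by rewrite ge0_fin_numE// /cLnorm Lnorm_ge0.
Qed.

Lemma cLp_meas (f : cLp) : cmeasurable f.
Proof. by have /asboolP[] := cLp_funP f. Qed.

Lemma cLp_normD (f g : cLp) : cLp_norm (f + g) <= cLp_norm f + cLp_norm g.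
Proof.
rewrite /cLp_norm -raddfD lecR -lee_fin EFinD !fineK ?cLnorm_fin//.
have mf := cLp_meas f; have mg := cLp_meas g.
have mfg : cmeasurable ((f : X -> R[i]) + g).
  by rewrite -[f : X -> _]scale1r; exact: cmeasurableP.
by rewrite (eq_cLnorm (cLp_meas _) mfg (cLpD f g)) le_cLnormD.
Qed.

Lemma cLp_normZ a (f : cLp) : cLp_norm (a *: f) = `|a| * cLp_norm f.
Proof.
have /asboolP[mf foo] := cLp_funP f.
have maf : cmeasurable (a *: (f : X -> R[i])).
  by rewrite -[_ *: _]addr0; exact: cmeasurableP (@cmeasurable0 _ _ _).
rewrite /cLp_norm (eq_cLnorm (cLp_meas _) maf (cLp_scaleE a f)).
by rewrite cLnormZ// fineM ?cLnorm_fin// rmorphM /= normc_def; case: (a).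
Qed.

Lemma cLp_norm_eq0 (f : cLp) : cLp_norm f = 0 -> f = 0.
Proof.
move=> /(congr1 (@complex.Re R)) /= /eqP; rewrite fine_eq0 ?cLnorm_fin// => /eqP.
have mn : measurable_fun [set: X] (EFin \o (@normc R \o f)).
  by apply/measurable_EFinP/measurable_normc/cLp_meas.
move=> /(Lnorm_eq0_eq0 mn (lt_le_trans lte01 p1)) f0; apply/cLp_eqP.
apply: filterS2 f0 cLp0 => x /(_ Logic.I) /= [/eq0_normc ->].
by move=> ->.
Qed.

HB.instance Definition _ := Lmodule_isNormed.Build R[i] cLp
  cLp_normD cLp_normZ cLp_norm_eq0.

End ComplexLpSpace.

Lemma le1_2 (R : realType) : (1 <= 2%:E :> \bar R)%E.
Proof. by rewrite lee_fin ler1n. Qed.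

Lemma le1_oo (R : realType) : (1 <= +oo :> \bar R)%E.
Proof. exact: leey. Qed.

Notation L2 mu := (cLp mu (@le1_2 _)).
Notation Loo mu := (cLp mu (@le1_oo _)).

Section Operators.
Context (R : realType) (V : normedModType R[i]).

Definition bounded_operators : set (V -> V) :=
  [set T | linear T /\
           exists C : R, forall v, `|T v| <= C%:C%C * `|v| ].

Definition compact_operators : set (V -> V) :=
  [set T | bounded_operators T /\
           compact (closure (T @` [set v | `|v| <= 1]))].

End Operators.

Definition is_lub (T : Type) (le : T -> T -> Prop) (D : set T) (b : T) :=
  (forall a, D a -> le a b) /\
  (forall c, (forall a, D a -> le a c) -> le b c).

(** For M = L^oo(X, mu) with the trace given by integration, the GNS space L^2 M is L^2(X, mu), the
    norm of L^1 M is the L^1-norm of functions, and M acts by multiplication. *)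

Section TracialAlgebra.
Context d (X : measurableType d) (R : realType) (mu : probability X R).
Local Notation M := (Loo mu).
Local Notation H := (L2 mu).
Implicit Types (a b : M) (f g : H) (T : H -> H).

Definition inner f g : R[i] := cintegral mu (fun x => f x * (g x)^*%C).

Definition tau a : R[i] := cintegral mu a.

Definition star a : M := toLp mu (@le1_oo R) (fun x => (a x)^*%C).

Definition hat a : H := toLp mu (@le1_2 R) a.

Definition lmul a : H -> H := fun f => toLp mu (@le1_2 R) (fun x => a x * f x).

Definition J f : H := toLp mu (@le1_2 R) (fun x => (f x)^*%C).

Definition norm_oo1 T : \bar R :=
  ereal_sup [set cLnorm mu 1%E (T (hat a)) | a in [set a | `|a| <= 1]].

Definition Koo1 : set (H -> H) :=
  [set T | bounded_operators T /\
           forall e : R, 0 < e ->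
             exists2 K, compact_operators K & (norm_oo1 (T - K)%R < e%:E)%E].

Definition SM : set (H -> H) :=
  [set T | bounded_operators T /\
           forall a, let JaJ := J \o lmul a \o J in
             Koo1 ((T \o JaJ) - (JaJ \o T))].

Implicit Types (E : set (H -> H)) (phi : (H -> H) -> R[i]).

(* States on an operator system E; the values of phi outside E are
   irrelevant. *)
Definition state_on E phi :=
  [/\ forall z T1 T2, E T1 -> E T2 -> phi (z *: T1 + T2) = z * phi T1 + phi T2,
      forall T, E T -> (forall f, 0 <= inner (T f) f) -> 0 <= phi T &
      phi id = 1].

Definition central_on E phi :=
  forall a T, E T -> phi (lmul a \o T) = phi (T \o lmul a).

Definition le_Loo a b := {ae mu, forall x, a x <= b x}.

(* Normality: preservation of suprema of upward directed families of
   self-adjoint elements. *)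
(* [le_Loo] and the order of R[i] relate complex numbers only when they have the
   same imaginary part, so upper bounds of self-adjoint elements (resp. of real
   numbers) are self-adjoint (resp. real). *)
Definition normal (psi : M -> R[i]) :=
  forall (D : set M) b,
    D !=set0 ->
    (forall a, D a -> star a = a) ->
    (forall a1 a2, D a1 -> D a2 ->
       exists a3, [/\ D a3, le_Loo a1 a3 & le_Loo a2 a3]) ->
    is_lub le_Loo D b ->
    is_lub (fun z w => z <= w) (psi @` D) (psi b).

End TracialAlgebra.

Section Actions.
Context (Gamma : groupType) d (X : measurableType d) (R : realType).
Implicit Types (mu : probability X R) (act : Gamma -> X -> X).

Definition pmp_action mu act :=
  [/\ forall t, measurable_fun [set: X] (act t),
      forall t (A : set X), measurable A -> mu (act t @^-1` A) = mu A,
      forall x, act 1%g x = x &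
      forall s t x, act (s * t)%g x = act s (act t x)].

(* alpha_t(a) = a o t^-1 on M; [koopman] is its extension alpha_t^0 to L^2 M,
   whose inverse (and adjoint) is the Koopman operator of t^-1. *)
Definition alpha mu act (t : Gamma) (a : Loo mu) : Loo mu :=
  toLp mu (@le1_oo R) (fun x => a (act t^-1%g x)).

Definition koopman mu act (t : Gamma) (f : L2 mu) : L2 mu :=
  toLp mu (@le1_2 R) (fun x => f (act t^-1%g x)).

Definition invariant_on mu act (E : set (L2 mu -> L2 mu))
    (phi : (L2 mu -> L2 mu) -> R[i]) :=
  forall t T, E T ->
    phi (koopman act t \o T \o koopman act t^-1%g) = phi T.

Definition weakly_compact mu act :=
  exists phi : (L2 mu -> L2 mu) -> R[i],
    [/\ state_on (@bounded_operators R (L2 mu)) phi,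
        forall a : Loo mu, phi (lmul a) = tau a,
        central_on (@bounded_operators R (L2 mu)) phi &
        invariant_on act (@bounded_operators R (L2 mu)) phi].

Definition indicator mu (A : set X) : Loo mu :=
  toLp mu (@le1_oo R) (fun x => (\1_A x)%:C%C).

(* For the projection p = 1_A, the algebra M p with its normalized trace is
   L^oo of the conditional probability mu(. `&` A) / mu(A). *)
Definition conditional mu (A : set X) (mA : measurable A) : probability X R :=
  mnormalize (mrestr mu mA) mu.

(* M is abelian: its center is M itself, and the projections of M are the
   classes of the indicators of measurable sets. *)
Definition properly_proximal mu act :=
  ~ (exists (A : set X) (mA : measurable A),
       [/\ indicator mu A <> 0,
           forall t, alpha act t (indicator mu A) = indicator mu A &
           weakly_compact (conditional mu mA) act]) /\
  ~ (exists phi : (L2 mu -> L2 mu) -> R[i],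
       [/\ state_on (SM (mu:=mu)) phi,
           central_on (SM (mu:=mu)) phi,
           invariant_on act (SM (mu:=mu)) phi,
           forall T, Koo1 T -> phi T = 0 &
           normal (fun a : Loo mu => phi (lmul a))]).

End Actions.

Definition factor_map (Gamma : groupType) d (X : measurableType d)
    d' (Y : measurableType d') (R : realType)
    (mu : probability X R) (actX : Gamma -> X -> X)
    (nu : probability Y R) (actY : Gamma -> Y -> Y) (pi : X -> Y) :=
  [/\ measurable_fun [set: X] pi,
      forall B : set Y, measurable B -> mu (pi @^-1` B) = nu B &
      forall t, {ae mu, forall x, pi (actX t x) = actY t (pi x)}].

Definition diffuse d (Y : measurableType d) (R : realType)
    (nu : probability Y R) :=
  forall A : set Y, measurable A -> (0 < nu A)%E ->
    exists B : set Y,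
      [/\ measurable B, B `<=` A, (0 < nu B)%E & (nu B < nu A)%E].

(* Main.v *)
Require Import Defs.
From mathcomp Require Import all_boot all_order all_algebra.
From mathcomp Require Import complex ring lra.
From mathcomp Require Import all_classical all_reals all_analysis.
From mathcomp Require Import measurable_realfun ess_sup_inf.
Import Order.TTheory GRing.Theory Num.Theory.
Import numFieldNormedType.Exports.
Import ComplexField.Normc.

(** The proof is by contraposition, against the second half of proper proximality of X:
    if the action on Y is not properly proximal, a boundary state for X is constructed,
    that is, an invariant central state on S(L^oo X) which vanishes on
    the closure K^{oo,1} of the compact operators and is normal on L^oo X.

    Suppose first that phi is a boundary state for Y, and let V be the isometric
    inclusion of L2 Y into L2 X. Compression by V maps L^oo X to L^oo Y, where it is the
    conditional expectation, K^{oo,1} to K^{oo,1}, because V is contractive for the sup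
    norm and its adjoint for the L1 norm, and hence S(L^oo X) to S(L^oo Y). Therefore
    T |-> phi (V^* T V) is an invariant state on S(L^oo X) that vanishes on K^{oo,1}.
    It is normal since the conditional expectation is ([expect_normal]). A priori it is
    central for L^oo Y only; but L^oo X is abelian, so that the commutators of T with
    L^oo X lie in K^{oo,1} by the definition of S(L^oo X), and centrality is automatic
    ([boundary_state_pull]). The adjoint of V comes from the Riesz representation
    theorem, and thus from the completeness of L2 ([L2_complete], [riesz]).

    Suppose next that the action on some invariant subset B of Y is weakly compact, with
    state phi on all bounded operators of L2 B. The same compression works, applied to
    the restriction of phi to S(L^oo B), provided that phi vanishes on K^{oo,1}.

    On compact operators K this holds as B is diffuse: B can be cut, up to a small set,
    into finitely many sets C with 1_C K of small norm, and by centrality phi K is the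
    sum of the values of phi at the blocks 1_C K 1_C ([state_compact0]).

    To pass to the closure, let T - K be small in the (oo,1)-norm. This does not bound the
    operator norm of T - K, but by a Grothendieck inequality ([grothendieck]) it bounds
    the sum of |<(T - K) u, u>| over any family of functions u with sum of |u|^2 at most
    1 everywhere. A maximal family of this type that consists of functions with large
    |<(T - K) u, u>| / |u|^2 therefore has small total mass; outside a set of small
    measure it leaves room for further functions, of which there are none by maximality,
    so the corner of T - K on the complement of this set has small numerical range
    ([large_corner]). As phi restricts to the trace, the part of T that is cut off
    contributes little to phi T ([state_Koo1_0]).

    Families that are maximal in the limit are produced, without transfinite arguments,
    by the greedy construction [exhaustion]. *)

Set Implicit Arguments.
Unset Strict Implicit.
Unset Printing Implicit Defensive.

Local Open Scope classical_set_scope.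
Local Open Scope ring_scope.

(** * Integrable functions *)

Notation cRe := (@complex.Re _).
Notation cIm := (@complex.Im _).
Notation intble mu f := (mu.-integrable setT (EFin \o f)).

Section RealIntegral.
Context d (X : measurableType d) (R : realType) (mu : probability X R).
Implicit Types f g h : X -> R.

Lemma intble_meas f : intble mu f -> measurable_fun setT f.
Proof. by move=> /measurable_int /measurable_EFinP. Qed.

Lemma intble_le f g : measurable_fun setT f -> (forall x, `|f x| <= g x) ->
  intble mu g -> intble mu f.
Proof.
move=> mf fg ig; apply: (le_integrable measurableT _ _ ig).
  exact/measurable_EFinP.
by move=> x _ /=; rewrite lee_fin (le_trans (fg x))// ler_norm.
Qed.

Lemma intble_cst (c : R) : intble mu (fun=> c).
Proof. exact: finite_measure_integrable_cst. Qed.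

Lemma intble_bounded f (c : R) : measurable_fun setT f ->
  (forall x, `|f x| <= c) -> intble mu f.
Proof. by move=> mf fc; apply: intble_le mf fc (intble_cst c). Qed.

Lemma intbleD f g : intble mu f -> intble mu g -> intble mu (fun x => f x + g x).
Proof.
move=> hf hg; rewrite (_ : _ \o _ = (EFin \o f) \+ (EFin \o g))%E; last first.
  by apply/funext => x /=; rewrite EFinD.
exact: integrableD.
Qed.

Lemma intbleZ (c : R) f : intble mu f -> intble mu (fun x => c * f x).
Proof.
move=> hf; rewrite (_ : _ \o _ = (fun x => c%:E * (EFin \o f) x))%E; last first.
  by apply/funext => x /=; rewrite EFinM.
exact: integrableZl.
Qed.

Lemma intbleB f g : intble mu f -> intble mu g -> intble mu (fun x => f x - g x).
Proof.
move=> hf hg; rewrite (_ : (fun x => _) = (fun x => f x + -1 * g x)); last first.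
  by apply/funext => x; rewrite mulN1r.
by apply: intbleD => //; exact: intbleZ.
Qed.

Lemma intble_indic f (A : set X) : measurable A -> intble mu f ->
  intble mu (fun x => \1_A x * f x).
Proof.
move=> mA hf; have mf := intble_meas hf.
have ha : intble mu (fun x => `|f x|).
  by have := integrable_abse hf; rewrite /comp.
apply: intble_le ha.
  by apply: measurable_funM => //; exact: measurable_indic.
move=> x; rewrite normrM indicE; case: (_ \in _); last by rewrite normr0 mul0r.
by rewrite normr1 mul1r.
Qed.

Lemma RintB f g : intble mu f -> intble mu g ->
  \int[mu]_x (f x - g x) = \int[mu]_x f x - \int[mu]_x g x.
Proof. exact: RintegralB. Qed.

Lemma RintD f g : intble mu f -> intble mu g ->
  \int[mu]_x (f x + g x) = \int[mu]_x f x + \int[mu]_x g x.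
Proof. exact: RintegralD. Qed.

Lemma RintZ (c : R) f : intble mu f ->
  \int[mu]_x (c * f x) = c * \int[mu]_x f x.
Proof. by move=> hf; rewrite RintegralZl. Qed.

Lemma Rint_le f g : intble mu f -> intble mu g -> (forall x, f x <= g x) ->
  \int[mu]_x f x <= \int[mu]_x g x.
Proof. by move=> hf hg fg; apply: le_Rintegral. Qed.

Lemma Rint_cst (c : R) : \int[mu]_x c = c.
Proof. by rewrite Rintegral_cst//= probability_setT mulr1. Qed.

Lemma Rint_ge0 f : (forall x, 0 <= f x) -> 0 <= \int[mu]_x f x.
Proof. by move=> h; apply: Rintegral_ge0. Qed.

Lemma Rint_ae f g : measurable_fun setT f -> measurable_fun setT g ->
  {ae mu, forall x, f x = g x} -> \int[mu]_x f x = \int[mu]_x g x.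
Proof.
move=> mf mg fg; rewrite /Rintegral; congr fine; apply: ae_eq_integral => //.
- exact/measurable_EFinP.
- exact/measurable_EFinP.
by apply: filterS fg => x /= -> _.
Qed.

Lemma intble_ae f g : measurable_fun setT f -> measurable_fun setT g ->
  {ae mu, forall x, f x = g x} -> intble mu f -> intble mu g.
Proof.
move=> mf mg fg hf; apply/integrableP; split; first exact/measurable_EFinP.
move/integrableP: hf => [_]; congr (_ < _)%E; apply: ae_eq_integral => //.
- by apply: measurableT_comp => //; exact/measurable_EFinP.
- by apply: measurableT_comp => //; exact/measurable_EFinP.
by apply: filterS fg => x /= -> _.
Qed.

Lemma Rint_EFin f : intble mu f -> (\int[mu]_x f x)%:E = (\int[mu]_x (f x)%:E)%E.
Proof. by move=> hf; rewrite /Rintegral fineK//; exact: integrable_fin_num. Qed.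

Lemma Rint_indic (A : set X) : measurable A ->
  \int[mu]_x (\1_A x : R) = fine (mu A).
Proof. by move=> mA; rewrite /Rintegral integral_indic// setIT. Qed.

Lemma Rint_eq0 f : intble mu f -> (forall x, 0 <= f x) ->
  \int[mu]_x f x <= 0 -> {ae mu, forall x, f x = 0}.
Proof.
move=> hf f0 hle.
have mE : measurable_fun setT (EFin \o f) by apply/measurable_EFinP/intble_meas.
have : (\int[mu]_x `|(EFin \o f) x| = 0)%E.
  transitivity (\int[mu]_x f x)%:E; last first.
    by congr EFin; apply/eqP; rewrite eq_le hle Rint_ge0.
  by rewrite Rint_EFin//; apply: eq_integral => x _ /=; rewrite ger0_norm.
move/(ae_eq_integral_abs mu measurableT mE).
by apply: filterS => x /= /(_ Logic.I) /= [].
Qed.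

End RealIntegral.

Section Dominated.
Context d (X : measurableType d) (R : realType) (mu : probability X R).

Lemma Rint_dominated (F : nat -> X -> R) (F0 G : X -> R) :
  (forall n, measurable_fun setT (F n)) -> measurable_fun setT F0 ->
  (forall x, F n x @[n --> \oo] --> F0 x) -> (forall n x, `|F n x| <= G x) ->
  intble mu G -> \int[mu]_x F n x @[n --> \oo] --> \int[mu]_x F0 x.
Proof.
move=> mF mF0 cF FG iG.
have [i0 _ h] : [/\ intble mu F0,
    (fun n => \int[mu]_x `|(F n x)%:E - (F0 x)%:E|)%E @ \oo --> 0%E &
    (fun n => \int[mu]_x (F n x)%:E)%E @ \oo --> (\int[mu]_x (F0 x)%:E)%E].
  apply: (@dominated_convergence _ _ _ mu setT measurableT
    (fun n x => (F n x)%:E) (fun x => (F0 x)%:E) (fun x => (G x)%:E)) => //.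
  - by move=> n; exact/measurable_EFinP.
  - exact/measurable_EFinP.
  - by apply: nearW => x _; apply: cvg_EFin; [exact: nearW|exact: cF].
  - by apply: nearW => x n _; rewrite lee_fin.
by move: h; rewrite -Rint_EFin//; exact: fine_cvg.
Qed.

End Dominated.

(** * Complex-valued functions *)

Section ComplexNumbers.
Context (R : realType).
Implicit Types z w : R[i].

Lemma conjcD z w : (z + w)^*%C = z^*%C + w^*%C.
Proof. exact: (rmorphD (@conjc R)). Qed.

Lemma conjcM z w : (z * w)^*%C = z^*%C * w^*%C.
Proof. exact: (rmorphM (@conjc R)). Qed.

Lemma conjcN z : (- z)^*%C = - z^*%C.
Proof. exact: (rmorphN (@conjc R)). Qed.

Lemma conjcR (a : R) : (a%:C)%C^*%C = a%:C%C.
Proof. by apply/eqP; rewrite eq_complex /= oppr0 !eqxx. Qed.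

Lemma realcD (a b : R) : (a + b)%:C%C = a%:C%C + b%:C%C.
Proof. exact: (rmorphD (real_complex R)). Qed.

Lemma realcM (a b : R) : (a * b)%:C%C = a%:C%C * b%:C%C.
Proof. exact: (rmorphM (real_complex R)). Qed.

Lemma cReD z w : cRe (z + w) = cRe z + cRe w.
Proof. by case: z w => ? ? []. Qed.

Lemma cReN z : cRe (- z) = - cRe z.
Proof. by case: z. Qed.

Lemma cReB z w : cRe (z - w) = cRe z - cRe w.
Proof. by rewrite cReD cReN. Qed.

Lemma cReZ (a : R) z : cRe (a%:C%C * z) = a * cRe z.
Proof. by case: z => ? ? /=; rewrite mul0r subr0. Qed.

Lemma normc_sqr z : normc z ^+ 2 = cRe z ^+ 2 + cIm z ^+ 2.
Proof. by case: z => a b /=; rewrite sqr_sqrtr// addr_ge0 ?sqr_ge0. Qed.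

Lemma absC z : `|z| = (normc z)%:C%C.
Proof. by rewrite normc_def; case: z. Qed.

Lemma normc_real (r : R) : normc (r%:C)%C = `|r|.
Proof. by rewrite /= expr0n addr0 sqrtr_sqr. Qed.

Lemma normc_conj z : normc z^*%C = normc z.
Proof. by case: z => a b /=; rewrite sqrrN. Qed.

Lemma absRe_le z : `|cRe z| <= normc z.
Proof.
rewrite -(@ler_pXn2r _ 2) ?nnegrE ?normc_ge0// normc_sqr real_normK ?num_real//.
by rewrite lerDl sqr_ge0.
Qed.

Lemma absIm_le z : `|cIm z| <= normc z.
Proof.
rewrite -(@ler_pXn2r _ 2) ?nnegrE ?normc_ge0// normc_sqr real_normK ?num_real//.
by rewrite lerDr sqr_ge0.
Qed.

Lemma mulcJ z : z * z^*%C = (normc z ^+ 2)%:C%C.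
Proof.
rewrite normc_sqr; case: z => a b /=; apply/eqP; rewrite eq_complex /=.
by apply/andP; split; apply/eqP; ring.
Qed.

Lemma normc_prod_le z w : normc (z * w) <= normc z ^+ 2 + normc w ^+ 2.
Proof.
rewrite normcM; have := sqr_ge0 (normc z - normc w).
have := sqr_ge0 (normc z); have := sqr_ge0 (normc w); nra.
Qed.

(** The polar factor of [z]; it is [0], not [1], at [z = 0], so that it is a
    measurable function of [z] of modulus at most [1]. *)
Definition phase z : R[i] := ((normc z)^-1)%:C%C * z.

Lemma normc_phase_le1 z : normc (phase z) <= 1.
Proof.
rewrite /phase normcM normc_real ger0_norm ?invr_ge0 ?normc_ge0//.
have [->|z0] := eqVneq (normc z) 0; first by rewrite mulr0 ler01.
by rewrite mulVf.
Qed.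

Lemma mul_phaseJ z : z * (phase z)^*%C = (normc z)%:C%C.
Proof.
rewrite /phase conjcM conjcR mulrCA mulcJ.
rewrite -realcM; congr (_%:C)%C.
have [->|z0] := eqVneq (normc z) 0; first by rewrite expr0n mulr0.
by rewrite expr2 mulrA mulVf// mul1r.
Qed.

End ComplexNumbers.

Section ComplexFunctions.
Context d (X : measurableType d) (R : realType).
Implicit Types (f g : X -> R[i]).

Lemma cmeas_real (r : X -> R) : measurable_fun setT r ->
  cmeasurable (fun x => (r x)%:C%C).
Proof.
by move=> mr; split; [exact: mr|exact: (measurable_cst (0 : R))].
Qed.

Lemma cmeas_cst (z : R[i]) : cmeasurable (fun _ : X => z).
Proof. by split; exact: measurable_cst. Qed.

Lemma cmeas_conj f : cmeasurable f -> cmeasurable (fun x => (f x)^*%C).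
Proof.
move=> [fr fi]; split.
  by rewrite (_ : _ \o _ = cRe \o f)//; apply/funext => x /=; case: (f x).
rewrite (_ : _ \o _ = \- (cIm \o f)); first exact: measurable_funN.
by apply/funext => x /=; case: (f x).
Qed.

Lemma cmeasD f g : cmeasurable f -> cmeasurable g ->
  cmeasurable (fun x => f x + g x).
Proof.
move=> mf mg; have := cmeasurableP 1 mf mg; congr cmeasurable.
by apply/funext => x; rewrite -[LHS]/(1 * f x + g x) mul1r.
Qed.

Lemma cmeasM f g : cmeasurable f -> cmeasurable g ->
  cmeasurable (fun x => f x * g x).
Proof.
move=> [fr fi] [gr gi]; split.
- rewrite (_ : _ \o _ = (fun x => cRe (f x) * cRe (g x) - cIm (f x) * cIm (g x))).
    by apply: measurable_funB; exact: measurable_funM.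
  by apply/funext => x /=; case: (f x) (g x) => ? ? [].
- rewrite (_ : _ \o _ = (fun x => cRe (f x) * cIm (g x) + cIm (f x) * cRe (g x))).
    by apply: measurable_funD; exact: measurable_funM.
  by apply/funext => x /=; case: (f x) (g x) => ? ? [].
Qed.

Lemma cmeasB f g : cmeasurable f -> cmeasurable g ->
  cmeasurable (fun x => f x - g x).
Proof.
move=> mf mg; have := cmeasD mf (cmeasM (cmeas_cst (-1)) mg); congr cmeasurable.
by apply/funext => x; rewrite mulN1r.
Qed.

Lemma cmeas_indic (A : set X) : measurable A ->
  cmeasurable (fun x => (\1_A x : R)%:C%C).
Proof. by move=> mA; apply: cmeas_real; exact: measurable_indic. Qed.

Lemma meas_normc f : cmeasurable f -> measurable_fun setT (fun x => normc (f x)).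
Proof. exact: measurable_normc. Qed.

Lemma cmeas_phase f : cmeasurable f -> cmeasurable (fun x => phase (f x)).
Proof.
move=> mf; apply: cmeasM => //; apply: cmeas_real.
rewrite (_ : (fun x => _) = fun x => normc (f x) `^ (-1)).
  by apply: (measurableT_comp (measurable_powR _)); exact: meas_normc.
by apply/funext => x; rewrite powR_inv1// normc_ge0.
Qed.

End ComplexFunctions.

(** * Complex integrals and the spaces L1, L2, L^oo *)

Section ComplexIntegral.
Context d (X : measurableType d) (R : realType) (mu : probability X R).
Implicit Types (f g : X -> R[i]) (z : R[i]).

Definition cint f := cmeasurable f /\ intble mu (fun x => normc (f x)).

Lemma cint_le f (g : X -> R) : cmeasurable f ->
  (forall x, normc (f x) <= g x) -> intble mu g -> cint f.
Proof.
move=> mf fg ig; split=> //; apply: intble_le ig; first exact: meas_normc.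
by move=> x; rewrite ger0_norm ?normc_ge0.
Qed.

Lemma cint_Re f : cint f -> intble mu (fun x => cRe (f x)).
Proof. by move=> [mf hf]; apply: intble_le hf; [case: mf|move=> x; exact: absRe_le]. Qed.

Lemma cint_Im f : cint f -> intble mu (fun x => cIm (f x)).
Proof. by move=> [mf hf]; apply: intble_le hf; [case: mf|move=> x; exact: absIm_le]. Qed.

Lemma cintZ z f : cint f -> cint (fun x => z * f x).
Proof.
move=> [mf hf]; apply: cint_le (intbleZ (normc z) hf).
  by apply: cmeasM => //; exact: cmeas_cst.
by move=> x; rewrite normcM.
Qed.

Lemma cintegralD f g : cint f -> cint g ->
  cintegral mu (fun x => f x + g x) = cintegral mu f + cintegral mu g.
Proof.
move=> hf hg; apply/eqP; rewrite eq_complex /=; apply/andP; split; apply/eqP.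
- rewrite -RintD; [|exact: cint_Re..].
  by apply: eq_Rintegral => x _; case: (f x) (g x) => ? ? [].
- rewrite -RintD; [|exact: cint_Im..].
  by apply: eq_Rintegral => x _; case: (f x) (g x) => ? ? [].
Qed.

Lemma cintegralZ z f : cint f ->
  cintegral mu (fun x => z * f x) = z * cintegral mu f.
Proof.
move=> hf; have hr := cint_Re hf; have hi := cint_Im hf.
case: z => a b; apply/eqP; rewrite eq_complex /=; apply/andP; split; apply/eqP.
- rewrite -!RintZ// -RintB; [|exact: intbleZ..].
  by apply: eq_Rintegral => x _; case: (f x).
- rewrite -!RintZ// -RintD; [|exact: intbleZ..].
  by apply: eq_Rintegral => x _; case: (f x).
Qed.

Lemma cintegral_conj f : cint f ->
  cintegral mu (fun x => (f x)^*%C) = (cintegral mu f)^*%C.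
Proof.
move=> hf; have hi := cint_Im hf.
apply/eqP; rewrite eq_complex /=; apply/andP; split; apply/eqP.
- by apply: eq_Rintegral => x _; case: (f x).
- rewrite -mulN1r -RintZ//.
  by apply: eq_Rintegral => x _; case: (f x) => ? ? /=; rewrite mulN1r.
Qed.

Lemma cintegral_real (r : X -> R) :
  cintegral mu (fun x => (r x)%:C%C) = (\int[mu]_x r x)%:C%C.
Proof.
apply/eqP; rewrite eq_complex /=; apply/andP; split; apply/eqP => //.
by rewrite Rint_cst.
Qed.

Lemma eq_cintegral f g : (forall x, f x = g x) -> cintegral mu f = cintegral mu g.
Proof. by move=> /funext ->. Qed.

Lemma cintegral_ae f g : cmeasurable f -> cmeasurable g ->
  {ae mu, forall x, f x = g x} -> cintegral mu f = cintegral mu g.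
Proof.
move=> [fr fi] [gr gi] fg; apply/eqP; rewrite eq_complex /=.
apply/andP; split; apply/eqP; apply: Rint_ae => //;
  by apply: filterS fg => x ->.
Qed.

(** Rotate the integral to the positive real axis by a factor of modulus at most
    [1]; its real part is then the integral of a real part. *)
Lemma normc_cintegral_le f : cint f ->
  normc (cintegral mu f) <= \int[mu]_x normc (f x).
Proof.
move=> hf; set w := cintegral mu f.
have [u [u1 ->]] : exists u, normc u <= 1 /\ normc w = cRe (u * w).
  exists (phase w)^*%C; rewrite normc_conj normc_phase_le1; split=> //.
  by rewrite mulrC mul_phaseJ.
have hfw := cintZ u hf.
rewrite -cintegralZ//=; apply: Rint_le; [exact: cint_Re|by case: hf|].
move=> x; apply: le_trans (le_trans (ler_norm _) (absRe_le _)) _.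
by rewrite normcM ler_piMl ?normc_ge0.
Qed.

Definition L2fun f := cmeasurable f /\ intble mu (fun x => normc (f x) ^+ 2).

Lemma cLnorm2E f : cmeasurable f ->
  (cLnorm mu 2%:E f `^ 2 = \int[mu]_x (normc (f x) ^+ 2)%:E)%E.
Proof.
move=> mf; rewrite /cLnorm poweR_Lnorm//; apply: eq_integral => x _ /=.
by rewrite powR_mulrn// ger0_norm ?normc_ge0.
Qed.

Lemma intble_ge0 (g : X -> R) : measurable_fun setT g -> (forall x, 0 <= g x) ->
  (\int[mu]_x (g x)%:E < +oo)%E -> intble mu g.
Proof.
move=> mg g0 h; apply/integrableP; split; first exact/measurable_EFinP.
by rewrite (eq_integral (EFin \o g))// => x _ /=; rewrite ger0_norm.
Qed.

Lemma intble_lty (g : X -> R) : (forall x, 0 <= g x) -> intble mu g ->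
  (\int[mu]_x (g x)%:E < +oo)%E.
Proof.
move=> g0 /integrableP[_].
by rewrite (eq_integral (EFin \o g))// => x _ /=; rewrite ger0_norm.
Qed.

Lemma cLfun2P f : (f \in cLfun mu (@le1_2 R)) <-> L2fun f.
Proof.
split=> [/asboolP[mf h]|[mf h]]; [split=> //|apply/asboolP; split=> //].
  apply: intble_ge0; first by apply: measurable_funX; exact: meas_normc.
    by move=> x; exact: sqr_ge0.
  by rewrite -cLnorm2E// poweR_lty.
rewrite ltNge leye_eq; apply/negP => /eqP h1.
have := intble_lty (fun x => sqr_ge0 _) h; rewrite -cLnorm2E// h1.
by rewrite poweRyr.
Qed.

Lemma n2_sqr f : L2fun f ->
  fine (cLnorm mu 2%:E f) ^+ 2 = \int[mu]_x (normc (f x) ^+ 2).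
Proof.
move=> hf; have /asboolP[mf foo] := (cLfun2P f).2 hf.
rewrite /Rintegral -cLnorm2E// -powR_mulrn ?fine_ge0 ?Lnorm_ge0//.
have : cLnorm mu 2%:E f \is a fin_num by rewrite ge0_fin_numE// Lnorm_ge0.
by move=> /fineK {2}<-; rewrite poweR_EFin.
Qed.

Lemma cint_mul f g : L2fun f -> L2fun g -> cint (fun x => f x * g x).
Proof.
move=> [mf hf] [mg hg]; apply: cint_le (intbleD hf hg); first exact: cmeasM.
by move=> x; exact: normc_prod_le.
Qed.

Lemma L2fun_conj f : L2fun f -> L2fun (fun x => (f x)^*%C).
Proof.
move=> [mf hf]; split; first exact: cmeas_conj.
have -> // : (fun x => normc (f x)^*%C ^+ 2) = (fun x => normc (f x) ^+ 2).
by apply/funext => x; rewrite normc_conj.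
Qed.

Lemma L2fun_le f g : cmeasurable f -> (forall x, normc (f x) <= normc (g x)) ->
  L2fun g -> L2fun f.
Proof.
move=> mf fg [mg hg]; split=> //; apply: intble_le hg.
  by apply: measurable_funX; exact: meas_normc.
by move=> x; rewrite ger0_norm ?sqr_ge0// lerXn2r ?nnegrE ?normc_ge0.
Qed.

Lemma L2funD f g : L2fun f -> L2fun g -> L2fun (fun x => f x + g x).
Proof.
move=> /cLfun2P hf /cLfun2P hg; apply/cLfun2P.
exact: (rpredD (V := X -> R[i]) hf hg).
Qed.

Lemma L2funZ z f : L2fun f -> L2fun (fun x => z * f x).
Proof.
move=> /cLfun2P hf; apply/cLfun2P.
exact: (rpredZ (V := X -> R[i]) z hf).
Qed.

Lemma L2fun_bounded f (c : R) : cmeasurable f -> (forall x, normc (f x) <= c) ->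
  L2fun f.
Proof.
move=> mf fc; split=> //; apply: (@intble_bounded _ _ _ _ _ (c ^+ 2)).
  by apply: measurable_funX; exact: meas_normc.
move=> x; rewrite ger0_norm ?sqr_ge0// lerXn2r ?nnegrE ?normc_ge0//.
by rewrite (le_trans (normc_ge0 _) (fc x)).
Qed.

Lemma cint_L2 f : L2fun f -> cint f.
Proof.
move=> hf; have h1 : L2fun (fun=> 1).
  by apply: (@L2fun_bounded _ 1); [exact: cmeas_cst|move=> _; rewrite normc1].
have := cint_mul hf h1; have -> // : (fun x => f x * 1) = f.
by apply/funext => x; rewrite mulr1.
Qed.

Lemma cLnorm1E f : cLnorm mu 1%E f = (\int[mu]_x (normc (f x))%:E)%E.
Proof.
rewrite /cLnorm Lnorm1; apply: eq_integral => x _ /=.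
by rewrite ger0_norm ?normc_ge0.
Qed.

Lemma cLfunooP f (c : R) : cmeasurable f -> {ae mu, forall x, normc (f x) <= c} ->
  f \in cLfun mu (@le1_oo R) /\ (cLnorm mu +oo%E f <= c%:E)%E.
Proof.
move=> mf fc; suff h : (cLnorm mu +oo%E f <= c%:E)%E.
  by split=> //; apply/asboolP; split=> //; rewrite (le_lt_trans h)// ltry.
rewrite /cLnorm unlock; case: ifPn => _.
  by apply/ess_supP; apply: filterS fc => x /=; rewrite lee_fin ger0_norm ?normc_ge0.
have [x xc] : exists x, normc (f x) <= c.
  apply: contrapT => h; have : {ae mu, forall x, False}.
    by apply: filterS fc => x xc; apply: h; exists x.
  move=> [A [mA A0 /(_ _) sA]].
  have : A = setT by apply/seteqP; split => // x _; apply: sA.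
  by move=> AT; move: A0; rewrite AT probability_setT => /eqP; rewrite onee_eq0.
by rewrite lee_fin (le_trans (normc_ge0 _) xc).
Qed.

End ComplexIntegral.

(** * The Hilbert space of square-integrable functions *)

Notation toL2 mu f := (toLp mu (@le1_2 _) f).
Notation toLoo mu f := (toLp mu (@le1_oo _) f).

Arguments inner : simpl never.
Arguments cintegral : simpl never.

Section HilbertL2.
Context d (X : measurableType d) (R : realType) (mu : probability X R).
Local Notation H := (L2 mu).
Local Notation M := (Loo mu).
Implicit Types (f g h : H) (a b : M) (u v : X -> R[i]) (z : R[i]).

Lemma L2P f : L2fun mu f.
Proof. exact/cLfun2P/cLp_funP. Qed.

Lemma L2_meas f : cmeasurable f.
Proof. exact: (L2P f).1. Qed.
#[local] Hint Resolve L2P L2_meas : core.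

Lemma toL2E u : L2fun mu u -> {ae mu, forall x, toL2 mu u x = u x}.
Proof. by move=> hu; apply: toLpP; apply/cLfun2P. Qed.

Lemma toL2_eq u v : L2fun mu u -> L2fun mu v ->
  {ae mu, forall x, u x = v x} -> toL2 mu u = toL2 mu v.
Proof.
move=> hu hv uv; apply/cLp_eqP.
by apply: filterS3 (toL2E hu) (toL2E hv) uv => x -> ->.
Qed.

Lemma toL2D u v : L2fun mu u -> L2fun mu v ->
  toL2 mu (fun x => u x + v x) = toL2 mu u + toL2 mu v.
Proof.
move=> hu hv; apply/cLp_eqP.
apply: filterS2 (filterI (toL2E hu) (toL2E hv))
  (filterI (toL2E (L2funD hu hv)) (cLpD (toL2 mu u) (toL2 mu v))) => x [].
by move=> ux vx [-> ->]; rewrite ux vx.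
Qed.

Lemma toL2Z z u : L2fun mu u -> toL2 mu (fun x => z * u x) = z *: toL2 mu u.
Proof.
move=> hu; apply/cLp_eqP.
apply: filterS3 (toL2E hu) (toL2E (L2funZ z hu)) (cLp_scaleE z (toL2 mu u)) => x.
by move=> ux -> ; rewrite -ux => <-.
Qed.

Lemma L2fun_ae u v : cmeasurable v -> {ae mu, forall x, u x = v x} ->
  L2fun mu u -> L2fun mu v.
Proof.
move=> mv uv [um hu]; split=> //; apply: intble_ae hu.
- by apply: measurable_funX; exact: meas_normc.
- by apply: measurable_funX; exact: meas_normc.
by apply: filterS uv => x ->.
Qed.

Definition norm2 f : R := fine (cLnorm mu 2%:E f).

Lemma norm2E f : `|f| = (norm2 f)%:C%C. Proof. by []. Qed.

Lemma norm2_ge0 f : 0 <= norm2 f.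
Proof. by rewrite fine_ge0// Lnorm_ge0. Qed.

Lemma norm2_sqrE f : norm2 f ^+ 2 = \int[mu]_x (normc (f x) ^+ 2).
Proof. exact: n2_sqr. Qed.

Lemma cLpB f g : {ae mu, forall x, cLp_fun (f - g) x = f x - g x}.
Proof.
rewrite -scaleN1r; apply: filterS2 (cLpD f (-1 *: g)) (cLp_scaleE (-1) g) => x -> e.
by rewrite -[cLp_fun (_ *: _) x]/(cLp_scale (-1) g x) e mulN1r.
Qed.

Lemma norm2B_sqrE f g :
  norm2 (f - g) ^+ 2 = \int[mu]_x (normc (f x - g x) ^+ 2).
Proof.
rewrite norm2_sqrE; apply: Rint_ae.
- by apply: measurable_funX; exact: meas_normc.
- by apply: measurable_funX; apply: meas_normc; exact: cmeasB.
by apply: filterS (cLpB f g) => x ->.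
Qed.

Lemma norm2_toL2 u : L2fun mu u ->
  norm2 (toL2 mu u) ^+ 2 = \int[mu]_x (normc (u x) ^+ 2).
Proof.
move=> hu; rewrite norm2_sqrE; apply: Rint_ae.
- by apply: measurable_funX; exact: meas_normc.
- by apply: measurable_funX; apply: meas_normc; case: hu.
by apply: filterS (toL2E hu) => x ->.
Qed.

Lemma norm2_eq0 f : norm2 f = 0 -> f = 0.
Proof. by move=> f0; apply/normr0_eq0; rewrite norm2E f0. Qed.

Lemma norm20 : norm2 0 = 0.
Proof. by have := @normr0 _ H; rewrite norm2E => -[]. Qed.

Lemma norm2D f g : norm2 (f + g) <= norm2 f + norm2 g.
Proof. by rewrite -lecR realcD; exact: (ler_normD f g). Qed.

Lemma norm2Z z f : norm2 (z *: f) = normc z * norm2 f.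
Proof. by have := normrZ z f; rewrite !norm2E absC -realcM; exact: complexI. Qed.

Lemma norm2N f : norm2 (- f) = norm2 f.
Proof. by rewrite -scaleN1r norm2Z normcN normc1 mul1r. Qed.

Lemma norm2B f g : norm2 (f - g) <= norm2 f + norm2 g.
Proof. by rewrite -(norm2N g) norm2D. Qed.

Lemma inner_cint f g : cint mu (fun x => f x * (g x)^*%C).
Proof. by apply: cint_mul => //; exact: L2fun_conj. Qed.

Lemma cmeas_inner u v : cmeasurable u -> cmeasurable v ->
  cmeasurable (fun x : X => u x * (v x)^*%C).
Proof. by move=> um mv; apply: cmeasM => //; exact: cmeas_conj. Qed.

Lemma inner_toL2 u v : L2fun mu u -> L2fun mu v ->
  inner (toL2 mu u) (toL2 mu v) = cintegral mu (fun x => u x * (v x)^*%C).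
Proof.
move=> hu hv; apply: cintegral_ae.
- exact: cmeas_inner.
- by apply: cmeas_inner; [case: hu|case: hv].
by apply: filterS2 (toL2E hu) (toL2E hv) => x -> ->.
Qed.

Lemma innerDl f g h : inner (f + g) h = inner f h + inner g h.
Proof.
rewrite /inner -cintegralD; [|exact: inner_cint..].
apply: cintegral_ae.
- exact: cmeas_inner.
- by apply: cmeasD; exact: cmeas_inner.
by apply: filterS (cLpD f g) => x ->; rewrite mulrDl.
Qed.

Lemma innerZl z f h : inner (z *: f) h = z * inner f h.
Proof.
rewrite /inner -cintegralZ; last exact: inner_cint.
apply: cintegral_ae.
- exact: cmeas_inner.
- by apply: cmeasM; [exact: cmeas_cst|exact: cmeas_inner].
by apply: filterS (cLp_scaleE z f) => x ->; rewrite mulrA.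
Qed.

Lemma innerC f g : inner g f = (inner f g)^*%C.
Proof.
rewrite /inner -cintegral_conj; last exact: inner_cint.
by apply: eq_cintegral => x; rewrite conjcM conjcK mulrC.
Qed.

Lemma innerDr f g h : inner h (f + g) = inner h f + inner h g.
Proof.
by rewrite innerC innerDl conjcD -!innerC.
Qed.

Lemma innerZr z f h : inner h (z *: f) = z^*%C * inner h f.
Proof. by rewrite innerC innerZl conjcM -!innerC. Qed.

Lemma innerNl f h : inner (- f) h = - inner f h.
Proof. by rewrite -scaleN1r innerZl mulN1r. Qed.

Lemma innerBl f g h : inner (f - g) h = inner f h - inner g h.
Proof. by rewrite innerDl innerNl. Qed.

Lemma innerNr f h : inner h (- f) = - inner h f.
Proof. by rewrite innerC innerNl conjcN -innerC. Qed.

Lemma innerBr f g h : inner h (f - g) = inner h f - inner h g.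
Proof. by rewrite innerDr innerNr. Qed.

Lemma inner0l f : inner 0 f = 0.
Proof. by rewrite -(scale0r (0 : H)) innerZl mul0r. Qed.

Lemma inner_norm2 f : inner f f = (norm2 f ^+ 2)%:C%C.
Proof.
rewrite norm2_sqrE -cintegral_real; apply: eq_cintegral => x; exact: mulcJ.
Qed.

Lemma norm2D_sqr f g :
  norm2 (f + g) ^+ 2 = norm2 f ^+ 2 + norm2 g ^+ 2 + 2 * cRe (inner f g).
Proof.
apply: complexI; rewrite -inner_norm2 innerDl !innerDr (innerC f g) !inner_norm2.
case: (inner f g) => p q; apply/eqP; rewrite eq_complex /=.
by apply/andP; split; apply/eqP; ring.
Qed.

Lemma inner_CS f g : normc (inner f g) <= norm2 f * norm2 g.
Proof.
set w := inner f g; set c := normc w.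
(* Expand |f - s w g|^2 >= 0; the optimal real parameter is s = |g|^-2. *)
have key (s : R) : 0 <= norm2 f ^+ 2 - 2 * s * c ^+ 2 + s ^+ 2 * c ^+ 2 * norm2 g ^+ 2.
  have := sqr_ge0 (norm2 (f + (- (s%:C)%C * w) *: g)).
  rewrite norm2D_sqr norm2Z innerZr -/w normcM normcN normc_real.
  rewrite (_ : cRe _ = - s * c ^+ 2); last first.
    by rewrite /c normc_sqr; case: (w) => p q /=; ring.
  move=> h; apply: le_trans h _; rewrite le_eqVlt; apply/orP; left; apply/eqP.
  by rewrite -/c !exprMn real_normK ?num_real//; ring.
have [g0|g0] := eqVneq (norm2 g) 0.
  by rewrite /c /w (norm2_eq0 g0) innerC inner0l conjc0 normc0 norm20 mulr0.
have g2 : 0 < norm2 g ^+ 2 by rewrite exprn_gt0// lt_neqAle eq_sym g0 norm2_ge0.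
rewrite -(@ler_pXn2r _ 2) ?nnegrE ?normc_ge0 ?mulr_ge0 ?norm2_ge0//.
have := key (norm2 g ^+ 2)^-1; rewrite exprMn -/c.
set B := norm2 g ^+ 2 in g2 *; set A := norm2 f ^+ 2 => hA.
rewrite -ler_pdivrMr//.
suff : 0 <= A - c ^+ 2 / B by rewrite subr_ge0.
apply: le_trans hA _; rewrite le_eqVlt; apply/orP; left; apply/eqP.
by field; exact: lt0r_neq0.
Qed.

Lemma inner_eq f g : (forall h, inner f h = inner g h) -> f = g.
Proof.
move=> fg; apply/eqP; rewrite -subr_eq0; apply/eqP/norm2_eq0.
have : inner (f - g) (f - g) = 0 by rewrite innerBl fg subrr.
by rewrite inner_norm2 => -[] /eqP; rewrite sqrf_eq0 => /eqP.
Qed.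

End HilbertL2.
#[global] Hint Resolve L2P L2_meas : core.

(** * Multiplication operators *)

Section Multiplication.
Context d (X : measurableType d) (R : realType) (mu : probability X R).
Local Notation H := (L2 mu).
Local Notation M := (Loo mu).
Implicit Types (f g h : H) (a b : M) (u v : X -> R[i]) (z : R[i]) (A : set X).

Lemma oo_meas a : cmeasurable a.
Proof. exact: cLp_meas. Qed.
#[local] Hint Resolve oo_meas : core.

Definition normoo a : R := fine (cLnorm mu +oo%E a).

Lemma normooE a : `|a| = (normoo a)%:C%C. Proof. by []. Qed.

Lemma normoo_ge0 a : 0 <= normoo a.
Proof. by rewrite fine_ge0// Lnorm_ge0. Qed.

Lemma ooP a : {ae mu, forall x, normc (a x) <= normoo a}.
Proof.
have h : ((normoo a)%:E = cLnorm mu +oo%E a) by rewrite fineK// cLnorm_fin.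
have : (ess_sup mu (fun x => `|(EFin \o (@normc R \o a)) x|) <= (normoo a)%:E)%E.
  rewrite h /cLnorm unlock; case: ifPn => // /negP[].
  by rewrite /= probability_setT lte01.
move/ess_supP; apply: filterS => x /=.
by rewrite lee_fin ger0_norm ?normc_ge0.
Qed.

Lemma toLooE u (c : R) : cmeasurable u -> {ae mu, forall x, normc (u x) <= c} ->
  {ae mu, forall x, toLoo mu u x = u x}.
Proof. by move=> mf uc; apply: toLpP; have [] := cLfunooP mf uc. Qed.

Lemma normoo_le u (c : R) a : cmeasurable u -> {ae mu, forall x, normc (u x) <= c} ->
  {ae mu, forall x, a x = u x} -> normoo a <= c.
Proof.
move=> mf uc au; have ac : {ae mu, forall x, normc (a x) <= c}.
  by apply: filterS2 uc au => x + ->.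
have [_ h] := cLfunooP (oo_meas a) ac.
by rewrite -lee_fin fineK// cLnorm_fin.
Qed.

Lemma lmul_L2 a f : L2fun mu (fun x => a x * f x).
Proof.
split; first exact: cmeasM.
have hb := intbleZ (normoo a ^+ 2) (L2P f).2.
have ha : {ae mu, forall x, normc (a x) ^+ 2 <= normoo a ^+ 2}.
  by apply: filterS (ooP a) => x ax; rewrite lerXn2r// ?nnegrE ?normc_ge0 ?normoo_ge0.
(* The bound on a holds only almost everywhere: truncate to get it everywhere. *)
pose F x := Num.min (normc (a x) ^+ 2) (normoo a ^+ 2) * normc (f x) ^+ 2.
have mF : measurable_fun setT F.
  apply: measurable_funM; last by apply: measurable_funX; exact: meas_normc.
  apply: measurable_minr => //; apply: measurable_funX; exact: meas_normc.
apply: (@intble_ae _ _ _ _ F) => //.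
- by apply: measurable_funX; apply: meas_normc; exact: cmeasM.
- apply: filterS ha => x hx; rewrite /F normcM exprMn.
  by rewrite min_l.
apply: intble_le hb => // x.
rewrite ger0_norm; last by rewrite mulr_ge0 ?sqr_ge0// le_min !sqr_ge0.
by rewrite ler_wpM2r ?sqr_ge0// ge_min lexx orbT.
Qed.

Lemma lmul_ae a f : {ae mu, forall x, lmul a f x = a x * f x}.
Proof. exact/toL2E/lmul_L2. Qed.

Lemma lmul_is_linear a : linear (lmul a : H -> H).
Proof.
move=> z f g; rewrite /lmul -toL2Z; last exact: lmul_L2.
rewrite -toL2D; [|exact/L2funZ/lmul_L2|exact: lmul_L2].
apply: toL2_eq; [exact: lmul_L2| |].
  by apply: L2funD; [apply: L2funZ|]; exact: lmul_L2.
apply: filterS2 (cLpD (z *: f) g) (cLp_scaleE z f) => x -> e.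
rewrite -[cLp_fun (z *: f) x]/(cLp_scale z f x) e.
by rewrite mulrDr mulrCA.
Qed.

Lemma norm2_ae_le f g (c : R) : 0 <= c ->
  {ae mu, forall x, normc (f x) <= c * normc (g x)} -> norm2 f <= c * norm2 g.
Proof.
move=> c0 fg; rewrite -(@ler_pXn2r _ 2) ?nnegrE ?mulr_ge0 ?norm2_ge0//.
rewrite exprMn !norm2_sqrE -RintZ; last by case: (L2P g).
pose F x := Num.min (normc (f x) ^+ 2) (c ^+ 2 * normc (g x) ^+ 2).
have mg : measurable_fun setT (fun x => c ^+ 2 * normc (g x) ^+ 2).
  by apply: measurable_funM => //; apply: measurable_funX; exact: meas_normc.
have mf : measurable_fun setT (fun x => normc (f x) ^+ 2).
  by apply: measurable_funX; exact: meas_normc.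
have ig := intbleZ (c ^+ 2) (L2P g).2.
have mF : measurable_fun setT F by exact: measurable_minr.
have F0 x : 0 <= F x by rewrite le_min sqr_ge0 /= mulr_ge0 ?sqr_ge0.
rewrite (@Rint_ae _ _ _ _ _ F)//.
  apply: Rint_le => //.
    apply: intble_le ig => // x; rewrite ger0_norm//.
    by rewrite ge_min lexx orbT.
  by move=> x; rewrite ge_min lexx orbT.
apply: filterS fg => x h; rewrite /F min_l// -exprMn.
by rewrite lerXn2r// nnegrE ?mulr_ge0 ?normc_ge0.
Qed.

Lemma norm2_lmul a f : norm2 (lmul a f) <= normoo a * norm2 f.
Proof.
apply: norm2_ae_le; first exact: normoo_ge0.
apply: filterS2 (ooP a) (lmul_ae a f) => x ax ->.
by rewrite normcM ler_wpM2r// normc_ge0.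
Qed.

Lemma star_ae a : {ae mu, forall x, star a x = (a x)^*%C}.
Proof.
apply: (toLooE (c := normoo a)); first exact: cmeas_conj.
by apply: filterS (ooP a) => x; rewrite normc_conj.
Qed.

Lemma starK a : star (star a) = a.
Proof.
apply/cLp_eqP; apply: filterS2 (star_ae a) (star_ae (star a)) => x ax ->.
by rewrite ax conjcK.
Qed.

Lemma inner_lmul a f g : inner (lmul a f) g = inner f (lmul (star a) g).
Proof.
apply: cintegral_ae; [exact: cmeas_inner|exact: cmeas_inner|].
apply: filterS3 (lmul_ae a f) (lmul_ae (star a) g) (star_ae a) => x -> -> ->.
by rewrite conjcM conjcK mulrCA mulrA.
Qed.

Lemma lmulC a b f : lmul a (lmul b f) = lmul b (lmul a f).
Proof.
apply/cLp_eqP.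
apply: filterS2 (filterI (lmul_ae a (lmul b f)) (lmul_ae b f))
  (filterI (lmul_ae b (lmul a f)) (lmul_ae a f)) => x [-> ->] [-> ->].
by rewrite mulrCA.
Qed.

Lemma JlmulJ a : J (mu:=mu) \o lmul a \o J (mu:=mu) = lmul (star a) :> (H -> H).
Proof.
apply/funext => f /=; apply/cLp_eqP.
have hJ g : {ae mu, forall x, J g x = (g x)^*%C} by exact/toL2E/L2fun_conj.
apply: filterS2 (filterI (hJ (lmul a (J f))) (lmul_ae a (J f)))
  (filterI (hJ f) (filterI (lmul_ae (star a) f) (star_ae a))).
by move=> x [-> ->] [-> [-> ->]]; rewrite conjcM conjcK.
Qed.

Lemma L2fun_oo a : L2fun mu a.
Proof.
pose u x := if normc (a x) <= normoo a then a x else 0.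
have um : cmeasurable u.
  have -> : u = (fun x => (\1_[set x | normc (a x) <= normoo a] x : R)%:C%C * a x).
    apply/funext => x; rewrite /u indicE; case: ifPn => h.
      by rewrite mem_set// mul1r.
    by rewrite memNset ?mul0r//; exact/negP.
  apply: cmeasM => //; apply: cmeas_indic.
  rewrite (_ : [set x | _] = (fun x => normc (a x)) @^-1` `]-oo, normoo a]).
    by rewrite -[X in measurable X]setTI; exact: (meas_normc (oo_meas a)).
  by apply/seteqP; split => x /=; rewrite in_itv.
apply: (@L2fun_ae _ _ _ _ u) => //.
  by apply: filterS (ooP a) => x ax; rewrite /u ax.
apply: (@L2fun_bounded _ _ _ _ _ (normoo a)) => // x; rewrite /u.
by case: ifPn => // _; rewrite normc0 normoo_ge0.
Qed.

Lemma hat_ae a : {ae mu, forall x, hat a x = a x}.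
Proof. exact/toL2E/L2fun_oo. Qed.

Lemma indicator_ae A : measurable A ->
  {ae mu, forall x, indicator mu A x = (\1_A x : R)%:C%C}.
Proof.
move=> mA; apply: (toLooE (c := 1)); first exact: cmeas_indic.
by apply: nearW => x; rewrite normc_real indicE; case: (_ \in _);
  rewrite ?normr0 ?normr1.
Qed.

Lemma normoo_indicator A : measurable A -> normoo (indicator mu A) <= 1.
Proof.
move=> mA; apply: (normoo_le _ _ (indicator_ae mA)); first exact: cmeas_indic.
by apply: nearW => x; rewrite normc_real indicE; case: (_ \in _);
  rewrite ?normr0 ?normr1.
Qed.

Lemma proj_ae A f : measurable A ->
  {ae mu, forall x, lmul (indicator mu A) f x = (\1_A x : R)%:C%C * f x}.
Proof.
move=> mA; apply: filterS2 (lmul_ae (indicator mu A) f) (indicator_ae mA).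
by move=> x -> ->.
Qed.

Lemma star_indicator A : measurable A -> star (indicator mu A) = indicator mu A.
Proof.
move=> mA; apply/cLp_eqP.
apply: filterS2 (star_ae (indicator mu A)) (indicator_ae mA) => x -> ->.
by rewrite conjcR.
Qed.

Lemma norm2_proj A f : measurable A -> norm2 (lmul (indicator mu A) f) <= norm2 f.
Proof.
move=> mA; apply: le_trans (norm2_lmul _ _) _.
by rewrite ler_piMl ?norm2_ge0 ?normoo_indicator.
Qed.

Lemma proj_idem A f : measurable A ->
  lmul (indicator mu A) (lmul (indicator mu A) f) = lmul (indicator mu A) f.
Proof.
move=> mA; apply/cLp_eqP.
apply: filterS2 (proj_ae (lmul (indicator mu A) f) mA) (proj_ae f mA) => x -> ->.
by rewrite mulrA -realcM indicE; case: (_ \in _); rewrite ?mulr0 ?mul0r ?mulr1.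
Qed.

Lemma inner_proj A f : measurable A ->
  inner (lmul (indicator mu A) f) f = (norm2 (lmul (indicator mu A) f) ^+ 2)%:C%C.
Proof.
by move=> mA; rewrite -inner_norm2 -{1}(proj_idem f mA) inner_lmul star_indicator.
Qed.

(** Bounded functions are dense: truncate, and use dominated convergence. *)
Lemma dense_bounded f (e : R) : 0 < e ->
  exists u, [/\ cmeasurable u, exists N : R, forall x, normc (u x) <= N,
    forall x, normc (u x) <= normc (f x) & norm2 (f - toL2 mu u) < e].
Proof.
move=> e0; pose A n := [set x | normc (f x) <= n%:R].
have mA n : measurable (A n).
  rewrite (_ : A n = (fun x => normc (f x)) @^-1` `]-oo, n%:R]).
    by rewrite -[X in measurable X]setTI; exact: (meas_normc (L2_meas f)).
  by apply/seteqP; split => x /=; rewrite in_itv.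
pose u n x := (\1_(A n) x : R)%:C%C * f x.
have um n : cmeasurable (u n) by apply: cmeasM => //; exact: cmeas_indic.
pose F n x := \1_(~` A n) x * normc (f x) ^+ 2.
have h : \int[mu]_x F n x @[n --> \oo] --> \int[mu]_x (0 : R).
  apply: Rint_dominated (L2P f).2.
  - move=> n; apply: measurable_funM.
      by apply: measurable_indic; exact: measurableC.
    by apply: measurable_funX; exact: meas_normc.
  - exact: measurable_cst.
  - move=> x; apply: cvg_near_cst; apply: filterS (nbhs_infty_ger (normc (f x))) => n hn.
    by rewrite /F indicE memNset ?mul0r// => /(_ hn).
  - move=> n x; rewrite ger0_norm ?mulr_ge0 ?normc_ge0//.
    by rewrite ler_piMl ?sqr_ge0// indicE; case: (_ \in _); rewrite ?normc_ge0.
rewrite Rint_cst in h.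
have [n hn] : exists n, \int[mu]_x F n x < e ^+ 2.
  have e2 : 0 < e ^+ 2 by rewrite exprn_gt0.
  have [n _ /(_ n (leqnn n))] := (cvgr_lt _ h) _ e2.
  by exists n.
have uc x : normc (u n x) <= n%:R.
  rewrite /u indicE; have [xA|xA] := boolP (x \in A n).
    by rewrite mul1r; move: xA; rewrite inE.
  by rewrite mul0r normc0.
exists (u n); split=> //; first by exists n%:R.
  move=> x; rewrite /u normcM normc_real ler_piMl ?normc_ge0// indicE.
  by case: (_ \in _); rewrite ?normr0 ?normr1.
rewrite -(@ltr_pXn2r _ 2) ?nnegrE ?norm2_ge0 ?ltW//.
suff -> : norm2 (f - toL2 mu (u n)) ^+ 2 = \int[mu]_x F n x by [].
rewrite norm2B_sqrE; apply: Rint_ae.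
- by apply: measurable_funX; apply: meas_normc; exact: cmeasB.
- apply: measurable_funM.
    by apply: measurable_indic; exact: measurableC.
  by apply: measurable_funX; exact: meas_normc.
apply: filterS (toL2E (L2fun_bounded mu (um n) uc)) => x ->.
rewrite /u /F !indicE; have [xA|xA] := boolP (x \in A n).
  by rewrite memNset ?mul1r ?subrr ?normc0 ?expr0n ?mul0r// => /(_ (set_mem xA)).
by rewrite mem_set ?mul0r ?subr0 ?mul1r// => h'; rewrite mem_set in xA.
Qed.

End Multiplication.

(** * Completeness of L2, the Riesz representation and adjoints *)

Section CompletenessL2.
Context d (X : measurableType d) (R : realType) (mu : probability X R).
Local Notation H := (L2 mu).
Implicit Types (f g h : H) (u v : X -> R[i]) (z : R[i]).

Lemma Rint_normc_le u (e : R) : 0 < e -> L2fun mu u ->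
  \int[mu]_x (normc (u x) ^+ 2) <= e ^+ 2 -> \int[mu]_x normc (u x) <= e.
Proof.
move=> e0 hu he; have [um hu2] := hu; have [_ hu1] := cint_L2 hu.
have hle x : normc (u x) <= e / 2 + (2 * e)^-1 * normc (u x) ^+ 2.
  rewrite -(ler_pM2l (_ : 0 < 2 * e)) ?mulr_gt0//.
  rewrite (_ : 2 * e * (e / 2 + _) = e ^+ 2 + normc (u x) ^+ 2); last first.
    by field; exact: lt0r_neq0.
  by have := sqr_ge0 (normc (u x) - e); lra.
have hi := intbleZ (2 * e)^-1 hu2.
apply: le_trans (Rint_le hu1 (intbleD (intble_cst mu (e / 2)) hi) hle) _.
rewrite RintD//; last exact: intble_cst.
rewrite Rint_cst RintZ//.
rewrite [leRHS](_ : e = e / 2 + (2 * e)^-1 * e ^+ 2); last first.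
  by field; exact: lt0r_neq0.
by rewrite lerD2l ler_wpM2l// invr_ge0 mulr_ge0 ?ltW.
Qed.

Lemma bounded_variation_cvg (r : R^nat) (c : R) :
  (forall n, \sum_(0 <= k < n) `|r k.+1 - r k| <= c) -> cvgn r.
Proof.
move=> hr; have h : cvgn (series (telescope r)).
  apply: normed_cvg; apply: nondecreasing_is_cvgn.
    apply/nondecreasing_seqP => n.
    rewrite -subr_ge0 /series /= [X in _ <= X - _]big_nat_recr//=.
    by rewrite addrAC subrr add0r normr_ge0.
  by exists c => _ [n _ <-]; exact: hr.
have -> : r = (fun n => r 0%N + series (telescope r) n).
  by apply/funext => n; exact: eq_sum_telescope.
by apply: is_cvgD => //; exact: is_cvg_cst.
Qed.

(** Riesz-Fischer: a rapidly Cauchy sequence converges almost everywhere, since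
    its increments are absolutely summable at almost every point, and the
    pointwise limit is the limit in L2 by Fatou's lemma. *)
Lemma L2_complete (f : nat -> H) :
  (forall n, norm2 (f n.+1 - f n) <= 2^-1 ^+ n) ->
  exists g, forall n, norm2 (g - f n) <= 2 * 2^-1 ^+ n.
Proof.
move=> hf.
pose D n x : R := normc (f n.+1 x - f n x).
have hD2 n : L2fun mu (fun x => f n.+1 x - f n x).
  apply: (@L2fun_ae _ _ _ _ (cLp_fun (f n.+1 - f n))) => //.
    exact: cmeasB.
  exact: cLpB.
have p0 n : 0 < (2^-1 : R) ^+ n by rewrite exprn_gt0.
have hD n : \int[mu]_x D n x <= 2^-1 ^+ n.
  apply: Rint_normc_le => //.
  by rewrite -norm2B_sqrE lerXn2r ?nnegrE ?norm2_ge0// ltW.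
have iD n : intble mu (D n) by have [_] := cint_L2 (hD2 n).
have D0 n x : 0 <= D n x by exact: normc_ge0.
have mD n : measurable_fun setT (D n) by exact: intble_meas (iD n).
pose G x := (\sum_(n <oo) (D n x)%:E)%E.
have mG : measurable_fun setT G.
  apply: (@ge0_emeasurable_sum _ _ _ setT (fun n x => (D n x)%:E) xpredT).
    by move=> k x _ _; rewrite lee_fin.
  by move=> k _; exact/measurable_EFinP.
have hsum n : \sum_(0 <= k < n) (2^-1 : R) ^+ k <= 2.
  suff : \sum_(0 <= k < n) (2^-1 : R) ^+ k = 2 - 2 * 2^-1 ^+ n.
    by move=> ->; rewrite lerBlDr lerDl mulr_ge0// ltW.
  elim: n => [|n ih]; first by rewrite big_geq// expr0 mulr1 subrr.
  by rewrite big_nat_recr//= ih exprS; lra.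
have iG : mu.-integrable setT G.
  apply/integrableP; split=> //.
  rewrite (eq_integral G); last first.
    by move=> x _; rewrite gee0_abs// nneseries_ge0// => n _; rewrite lee_fin.
  rewrite integral_nneseries//; last 2 first.
  - by move=> n; exact/measurable_EFinP.
  - by move=> n x _; rewrite lee_fin.
  apply: (@le_lt_trans _ _ 2%:E); last exact: ltry.
  apply: lime_le.
    by apply: is_cvg_nneseries => n _ _; apply: integral_ge0 => x _; rewrite lee_fin.
  apply: nearW => n.
  apply: (@le_trans _ _ (\sum_(0 <= k < n) (2^-1 ^+ k)%:E)%E).
    by apply: lee_sum => k _; rewrite -Rint_EFin// lee_fin.
  by rewrite sumEFin lee_fin.
have finG := integrable_ae measurableT iG.
pose C := [set x | (G x < +oo)%E].
have mC : measurable C.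
  by rewrite -[C]setTI; exact: emeasurable_fun_infty_o.
have aeC : {ae mu, forall x, C x}.
  by apply: filterS finG => x /(_ Logic.I); rewrite fin_numE /C /= ltey => /andP[].
(* Off the null set where the variation is infinite the sequence is replaced by 0,
   so that it converges everywhere and its limit is measurable. *)
pose F n x := (\1_C x : R)%:C%C * f n x.
have mF n : cmeasurable (F n) by apply: cmeasM => //; exact: cmeas_indic.
have incr n x : C x -> normc (F n.+1 x - F n x) = D n x.
  by move=> Cx; rewrite /F indicE mem_set// !mul1r.
have varC x : C x -> exists c, forall n, \sum_(0 <= k < n) normc (F k.+1 x - F k x) <= c.
  move=> Cx; exists (fine (G x)) => n.
  have Gfin : G x \is a fin_num.
    by rewrite ge0_fin_numE// nneseries_ge0// => k _; rewrite lee_fin.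
  rewrite -lee_fin fineK// -sumEFin.
  under eq_bigr do rewrite incr//.
  by apply: nneseries_lim_ge => k _; rewrite lee_fin.
have var x : exists c, forall n, \sum_(0 <= k < n) normc (F k.+1 x - F k x) <= c.
  have [/varC//|nC] := pselect (C x); exists 0 => n.
  by rewrite big1// => k _; rewrite /F indicE memNset// !mul0r subrr normc0.
have cvRe x : cvgn (fun n => cRe (F n x)).
  have [c hc] := var x; apply: (@bounded_variation_cvg _ c) => n.
  apply: le_trans (hc n); apply: ler_sum => k _.
  by rewrite -raddfB; exact: absRe_le.
have cvIm x : cvgn (fun n => cIm (F n x)).
  have [c hc] := var x; apply: (@bounded_variation_cvg _ c) => n.
  apply: le_trans (hc n); apply: ler_sum => k _.
  by rewrite -raddfB; exact: absIm_le.
pose Fr x := limn (fun n => cRe (F n x)).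
pose Fi x := limn (fun n => cIm (F n x)).
pose F0 x := (Fr x +i* Fi x)%C.
have mF0 : cmeasurable F0.
  split.
    apply: (@measurable_fun_cvg _ _ _ setT (fun n x => cRe (F n x)) Fr).
      by move=> n; case: (mF n).
    by move=> x _; exact: cvRe.
  apply: (@measurable_fun_cvg _ _ _ setT (fun n x => cIm (F n x)) Fi).
    by move=> n; case: (mF n).
  by move=> x _; exact: cvIm.
have fatouF n : (\int[mu]_x (normc (F0 x - F n x) ^+ 2)%:E
    <= ((2 * 2^-1 ^+ n) ^+ 2)%:E)%E.
  pose h m x := ((normc (F m x - F n x) ^+ 2)%:E)%E.
  have lim_h x : h ^~ x @ \oo --> (normc (F0 x - F n x) ^+ 2)%:E.
    apply: cvg_EFin; first exact: nearW.
    pose r m : R := cRe (F m x) - cRe (F n x).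
    pose i m : R := cIm (F m x) - cIm (F n x).
    have cr : r @ \oo --> Fr x - cRe (F n x).
      by apply: (@cvgB R R^o); [exact: cvRe|exact: cvg_cst].
    have ci : i @ \oo --> Fi x - cIm (F n x).
      by apply: (@cvgB R R^o); [exact: cvIm|exact: cvg_cst].
    have -> : fine \o h^~ x = (fun m => r m * r m + i m * i m).
      by apply/funext => m /=; rewrite normc_sqr !raddfB -!expr2.
    rewrite normc_sqr !raddfB /= !expr2.
    exact: (@cvgD R R^o _ _ _ _ _ _ _ (cvgM cr cr) (cvgM ci ci)).
  have -> : (\int[mu]_x (normc (F0 x - F n x) ^+ 2)%:E =
             \int[mu]_x limn_einf (h ^~ x))%E.
    apply: eq_integral => x _; rewrite is_cvg_limn_einfE.
      exact/esym/cvg_lim/lim_h.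
    by apply/cvg_ex; eexists; exact: lim_h.
  apply: le_trans (@fatou _ _ _ mu setT measurableT h _ _) _.
  - move=> m; apply/measurable_EFinP/measurable_funX/meas_normc; exact: cmeasB.
  - by move=> m x _; rewrite lee_fin sqr_ge0.
  have hm m : (n <= m)%N -> (\int[mu]_x h m x <= ((2 * 2^-1 ^+ n) ^+ 2)%:E)%E.
    move=> nm; have hfm : norm2 (f m - f n) <= 2 * 2^-1 ^+ n - 2 * 2^-1 ^+ m.
      elim: m nm => [|m ih]; first by rewrite leqn0 => /eqP ->; rewrite !subrr norm20.
      rewrite leq_eqVlt => /orP[/eqP <-|]; first by rewrite !subrr norm20.
      rewrite ltnS => /ih {}ih.
      rewrite (_ : f m.+1 - f n = (f m.+1 - f m) + (f m - f n)); last first.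
        by rewrite addrA subrK.
      have := norm2D (f m.+1 - f m) (f m - f n); have := hf m.
      by move: ih; rewrite exprS; lra.
    have mh k : measurable_fun setT (fun x => normc (F k x - F n x) ^+ 2).
      by apply/measurable_funX/meas_normc; exact: cmeasB.
    have hE : (\int[mu]_x h m x = (norm2 (f m - f n) ^+ 2)%:E)%E.
      rewrite norm2B_sqrE Rint_EFin; last first.
        apply: (intble_ae _ _ _ (L2P (f m - f n)).2).
        - by apply/measurable_funX/meas_normc.
        - by apply/measurable_funX/meas_normc; exact: cmeasB.
        - by apply: filterS (cLpB (f m) (f n)) => x ->.
      apply: ae_eq_integral => //.
      - exact/measurable_EFinP.
      - by apply/measurable_EFinP/measurable_funX/meas_normc; exact: cmeasB.
      by apply: filterS aeC => x Cx _; rewrite /h /F indicE mem_set// !mul1r.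
    have le2 : norm2 (f m - f n) <= 2 * 2^-1 ^+ n.
      by apply: le_trans hfm _; rewrite lerBlDr lerDl mulr_ge0// ltW.
    rewrite hE lee_fin; apply: lerXn2r => //; rewrite nnegrE ?norm2_ge0//.
  rewrite limn_einf_lim; apply: lime_le; first exact: is_cvg_einfs.
  apply: nearW => k; apply: (@le_trans _ _ (\int[mu]_x h (maxn k n) x)%E).
    by apply: ereal_inf_lbound; exists (maxn k n) => //=; exact: leq_maxl.
  by apply: hm; exact: leq_maxr.
have hF n : L2fun mu (F n).
  by apply: (L2fun_le (mF n) _ (L2P (f n))) => x; rewrite /F normcM normc_real
    ler_piMl ?normc_ge0// indicE; case: (_ \in _); rewrite ?normr0 ?normr1.
have hFB n : L2fun mu (fun x => F0 x - F n x).
  split; first exact: cmeasB.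
  apply: intble_ge0.
  - by apply/measurable_funX/meas_normc; exact: cmeasB.
  - by move=> x; exact: sqr_ge0.
  - by apply: le_lt_trans (fatouF n) _; exact: ltry.
have hF0 : L2fun mu F0.
  have := L2funD (hFB 0%N) (hF 0%N); congr L2fun.
  by apply/funext => x; rewrite subrK.
exists (toL2 mu F0) => n.
rewrite -(@ler_pXn2r _ 2) ?nnegrE ?norm2_ge0 ?mulr_ge0 ?(ltW (p0 n))//.
have h := fatouF n; rewrite -Rint_EFin in h; last by case: (hFB n).
rewrite lee_fin in h. apply: le_trans _ h.
rewrite norm2B_sqrE le_eqVlt; apply/orP; left; apply/eqP; apply: Rint_ae.
- by apply/measurable_funX/meas_normc; exact: cmeasB.
- by apply/measurable_funX/meas_normc; exact: cmeasB.
apply: filterS2 (toL2E hF0) aeC => x -> Cx.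
by rewrite /F indicE mem_set// mul1r.
Qed.

End CompletenessL2.

Section Riesz.
Context d (X : measurableType d) (R : realType) (mu : probability X R).
Local Notation H := (L2 mu).
Implicit Types (f g h : H) (z : R[i]).

Lemma quadratic_ge0_linear (A B : R) :
  (forall t : R, 0 <= t ^+ 2 * A + 2 * t * B) -> B = 0.
Proof.
move=> h; have A0 : 0 <= A by have := h 1; have := h (-1); lra.
have [|A1] := leP A 0.
  by move=> ?; have := h 1; have := h (-1); lra.
have := h (- B / A); rewrite (_ : _ + _ = - (B ^+ 2 / A)); last first.
  by field; exact: lt0r_neq0.
rewrite oppr_ge0 pmulr_lle0 ?invr_gt0// => B0.
by apply/eqP; rewrite -sqrf_eq0; apply/eqP/le_anti; rewrite B0 sqr_ge0.
Qed.

Lemma exp_half_small (e : R) : 0 < e -> exists n : nat, 2^-1 ^+ n < e.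
Proof.
move=> e0; have h : `|2^-1 : R| < 1 by rewrite ger0_norm ?invr_ge0// invf_lt1// ltr1n.
have [n _ /(_ n (leqnn n))] := cvgr_lt _ (cvg_expr h) _ e0.
by exists n.
Qed.

(** The functional [J f = |f|^2 - 2 Re (l f)] is bounded below; a sequence that
    minimises it is Cauchy by the parallelogram identity, and its limit
    represents [l]. *)
Lemma riesz (l : H -> R[i]) (c : R) :
  (forall z f g, l (z *: f + g) = z * l f + l g) ->
  (forall f, normc (l f) <= c * norm2 f) ->
  exists g, forall f, l f = inner f g.
Proof.
move=> lin bnd.
have lD f g : l (f + g) = l f + l g by rewrite -[f in LHS]scale1r lin mul1r.
have l0 : l 0 = 0 by apply: (addrI (l 0)); rewrite -lD !addr0.
have lZ z f : l (z *: f) = z * l f by rewrite -[_ *: _]addr0 lin l0 addr0.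
pose J f : R := norm2 f ^+ 2 - 2 * cRe (l f).
have Jge f : - c ^+ 2 <= J f.
  have h1 := le_trans (ler_norm _) (le_trans (absRe_le (l f)) (bnd f)).
  by rewrite /J; have := sqr_ge0 (norm2 f - c); lra.
pose m := inf (range J).
have hinf : has_inf (range J).
  by split; [exists (J 0), 0|exists (- c ^+ 2) => _ [f _ <-]].
have mle f : m <= J f by apply: ge_inf; [case: hinf|exists f].
have near_inf (e : R) : 0 < e -> exists f, J f < m + e.
  by move=> e0; have [_ [f _ <-] ?] := inf_adherent e0 hinf; exists f.
have p0 n : 0 < (2^-1 : R) ^+ n by rewrite exprn_gt0.
have /choice[f hf] : forall n, exists f, J f < m + (2^-1 ^+ n) ^+ 2 / 4.
  by move=> n; apply: near_inf; rewrite divr_gt0// exprn_gt0.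
(* The parallelogram identity, with J at the midpoint bounded below by m. *)
have para f1 f2 : norm2 (f1 - f2) ^+ 2 <= 2 * (J f1 - m) + 2 * (J f2 - m).
  have := mle ((2^-1)%:C%C *: (f1 + f2)).
  rewrite /J lZ lD norm2Z normc_real ger0_norm ?invr_ge0// exprMn.
  rewrite cReZ cReD.
  have := norm2D_sqr f1 f2; have := norm2D_sqr f1 (- f2).
  rewrite norm2N innerNr cReN; set p := cRe (inner _ _).
  move=> -> ->.
  set A := norm2 f1 ^+ 2; set B := norm2 f2 ^+ 2; set a := cRe _; set b := cRe _.
  have -> : (2^-1 : R) ^+ 2 = 4^-1 by field.
  lra.
have cau n : norm2 (f n.+1 - f n) <= 2^-1 ^+ n.
  rewrite -(@ler_pXn2r _ 2) ?nnegrE ?norm2_ge0 ?(ltW (p0 n))//.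
  apply: le_trans (para _ _) _.
  have := hf n; have := hf n.+1; rewrite (exprS _ n) exprMn; have := sqr_ge0 (2^-1 ^+ n : R).
  have -> : (2^-1 : R) ^+ 2 = 4^-1 by field.
  lra.
have [g hg] := L2_complete cau; exists g.
have key h : cRe (inner g h) = cRe (l h).
  suff : cRe (inner g h) - cRe (l h) = 0 by move=> /eqP; rewrite subr_eq0 => /eqP.
  apply: (@quadratic_ge0_linear (norm2 h ^+ 2)) => t; rewrite leNgt; apply/negP => neg.
  set q := _ + _ in neg.
  have [n hn] : exists n, 2^-1 ^+ n * (1 + 4 * `|t| * norm2 h) < - q.
    have k0 : 0 < 1 + 4 * `|t| * norm2 h.
      by rewrite ltr_pwDl// mulr_ge0 ?norm2_ge0// mulr_ge0.
    have q0 : 0 < - q by rewrite oppr_gt0.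
    have [n hn] := exp_half_small (divr_gt0 q0 k0).
    by exists n; rewrite -ltr_pdivlMr.
  have := mle (f n + t%:C%C *: h).
  rewrite /J lD lZ norm2D_sqr norm2Z innerZr normc_real exprMn real_normK ?num_real//.
  rewrite conjcR cReD !cReZ.
  have := hf n; rewrite /J.
  have hCS : `|cRe (inner (f n) h) - cRe (inner g h)| <= 2 * 2^-1 ^+ n * norm2 h.
    rewrite -cReB -innerBl; apply: le_trans (absRe_le _) _.
    apply: le_trans (inner_CS _ _) _; rewrite ler_wpM2r ?norm2_ge0//.
    by rewrite -opprB norm2N.
  have hCS' : t * cRe (inner (f n) h) <=
      t * cRe (inner g h) + `|t| * (2 * 2^-1 ^+ n * norm2 h).
    rewrite -lerBlDl -mulrBr; apply: le_trans (ler_norm _) _.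
    by rewrite normrM ler_wpM2l.
  have e1 : (2^-1 ^+ n : R) ^+ 2 <= 2^-1 ^+ n.
    rewrite expr2 ler_piMl ?(ltW (p0 n))//; apply: exprn_ile1; lra.
  move: hn neg; rewrite /q.
  set u := cRe (inner (f n) h) in hCS' *; set v := cRe (inner g h) in hCS' *.
  move=> hn neg hJ hm; have P0 := p0 n; clear l0; lra.
move=> h; rewrite (innerC g h).
(* The imaginary parts agree by applying [key] to i h. *)
have kIm : cIm (inner g h) = - cIm (l h).
  have := key ('i%C *: h); rewrite innerZr lZ.
  by case: (inner g h) (l h) => ? ? [? ?] /=; lra.
apply/eqP; rewrite eq_complex; have := key h; move: kIm.
by case: (inner g h) (l h) => ? ? [? ?] /= -> ->; rewrite opprK !eqxx.
Qed.

End Riesz.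

Definition bounded_by d (X : measurableType d) (R : realType)
  (mu : probability X R) d' (Y : measurableType d') (nu : probability Y R)
  (T : L2 mu -> L2 nu) (c : R) :=
  linear T /\ forall f, norm2 (T f) <= c * norm2 f.

Section Adjoint.
Context (R : realType) d (X : measurableType d) (mu : probability X R).
Context d' (Y : measurableType d') (nu : probability Y R).

Lemma bounded_by_ge0 (T : L2 mu -> L2 nu) (c : R) :
  bounded_by T c -> bounded_by T `|c|.
Proof.
move=> [lT bT]; split=> // f; apply: le_trans (bT f) _.
by rewrite ler_wpM2r ?norm2_ge0// ler_norm.
Qed.

Lemma linD (T : L2 mu -> L2 nu) f g : linear T -> T (f + g) = T f + T g.
Proof. by move=> lT; have := lT 1 f g; rewrite !scale1r. Qed.

Lemma lin0 (T : L2 mu -> L2 nu) : linear T -> T 0 = 0.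
Proof. by move=> lT; apply: (addrI (T 0)); rewrite -linD// !addr0. Qed.

Lemma linZ (T : L2 mu -> L2 nu) z f : linear T -> T (z *: f) = z *: T f.
Proof. by move=> lT; have := lT z f 0; rewrite lin0// !addr0. Qed.

Lemma linN (T : L2 mu -> L2 nu) f : linear T -> T (- f) = - T f.
Proof. by move=> lT; rewrite -scaleN1r linZ// scaleN1r. Qed.

Lemma linB (T : L2 mu -> L2 nu) f g : linear T -> T (f - g) = T f - T g.
Proof. by move=> lT; rewrite linD// linN. Qed.

Lemma adjoint_exists (T : L2 mu -> L2 nu) (c : R) : 0 <= c -> bounded_by T c ->
  exists S : L2 nu -> L2 mu, bounded_by S c /\
    forall f g, inner (T f) g = inner f (S g).
Proof.
move=> c0 [lT bT].
have /choice[S hS] : forall g, exists k, forall f, inner (T f) g = inner f k.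
  move=> g; apply: (@riesz _ _ _ _ (fun f => inner (T f) g) (c * norm2 g)).
    by move=> z f h; rewrite lT innerDl innerZl.
  move=> f; apply: le_trans (inner_CS _ _) _.
  by rewrite mulrAC ler_wpM2r ?norm2_ge0.
exists S; split; last by move=> f g; exact: hS.
split.
  move=> z f g; apply: inner_eq => h.
  rewrite innerC (innerC h (_ + _)); congr conjc.
  by rewrite innerDr innerZr -!hS innerDr innerZr.
move=> g; have [->|S0] := eqVneq (norm2 (S g)) 0; first by rewrite mulr_ge0 ?norm2_ge0.
have S1 : 0 < norm2 (S g) by rewrite lt_neqAle eq_sym S0 norm2_ge0.
rewrite -(ler_pM2r S1) -expr2.
have : normc (inner (S g) (S g)) <= c * norm2 g * norm2 (S g).
  rewrite -hS; apply: le_trans (inner_CS _ _) _.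
  by rewrite mulrAC ler_wpM2r ?norm2_ge0.
by rewrite inner_norm2 normc_real ger0_norm ?sqr_ge0.
Qed.

End Adjoint.

(** * Compact operators and the ideal of operators approximable in the (oo,1)-norm *)

Section BoundedOps.
Context (R : realType) d (X : measurableType d) (mu : probability X R).
Local Notation H := (L2 mu).
Local Notation B := (@bounded_operators R (L2 mu)).
Implicit Types (T : H -> H) (a b : Loo mu).

Lemma boundedP T : B T <-> exists2 c : R, 0 <= c & bounded_by T c.
Proof.
split=> [[lT [c bT]]|[c c0 [lT bT]]].
  exists `|c| => //; apply: bounded_by_ge0; split=> // f.
  by have := bT f; rewrite !norm2E -realcM lecR.
by split=> //; exists c => f; rewrite !norm2E -realcM lecR.
Qed.

Lemma bounded_id : B id.
Proof. by apply/boundedP; exists 1 => //; split=> // f; rewrite mul1r. Qed.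

Lemma bounded_lin z T1 T2 : B T1 -> B T2 -> B (z *: T1 + T2).
Proof.
move=> /boundedP[c1 c10 [lin1 b1]] /boundedP[c2 c20 [lin2 b2]]; apply/boundedP.
exists (normc z * c1 + c2); first by rewrite addr_ge0// mulr_ge0 ?normc_ge0.
split=> [w f g|f].
  rewrite -![(z *: T1 + T2) _]/(z *: T1 _ + T2 _) lin1 lin2 !scalerDr !scalerA.
  by rewrite (mulrC z) addrACA.
rewrite -[(z *: T1 + T2) _]/(z *: T1 _ + T2 _); apply: le_trans (norm2D _ _) _.
by rewrite norm2Z mulrDl -mulrA lerD// ler_wpM2l ?normc_ge0.
Qed.

Lemma bounded0 : B 0.
Proof.
apply/boundedP; exists 0 => //; split=> [z f g|f].
  by rewrite -[RHS]/(z *: 0 + 0) scaler0 addr0.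
by rewrite -[X in norm2 X]/(0 : H) norm20 mul0r.
Qed.

Lemma boundedD T1 T2 : B T1 -> B T2 -> B (T1 + T2).
Proof. by move=> h1 h2; have := bounded_lin 1 h1 h2; rewrite scale1r. Qed.

Lemma boundedZ z T : B T -> B (z *: T).
Proof. by move=> h; have := bounded_lin z h bounded0; rewrite addr0. Qed.

Lemma boundedB T1 T2 : B T1 -> B T2 -> B (T1 - T2).
Proof.
move=> h1 h2; have := boundedD h1 (boundedZ (-1) h2).
by rewrite scaleN1r.
Qed.

Lemma lmul_by a : bounded_by (lmul a : H -> H) (normoo a).
Proof. by split; [exact: lmul_is_linear|exact: norm2_lmul]. Qed.

Lemma bounded_lmul a : B (lmul a).
Proof. by apply/boundedP; exists (normoo a); [exact: normoo_ge0|exact: lmul_by]. Qed.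

End BoundedOps.

Lemma bounded_by_comp (R : realType)
    d1 (X1 : measurableType d1) (m1 : probability X1 R)
    d2 (X2 : measurableType d2) (m2 : probability X2 R)
    d3 (X3 : measurableType d3) (m3 : probability X3 R)
    (S : L2 m1 -> L2 m2) (T : L2 m2 -> L2 m3) (c1 c2 : R) : 0 <= c2 ->
  bounded_by S c1 -> bounded_by T c2 -> bounded_by (T \o S) (c2 * c1).
Proof.
move=> c20 [lS bS] [lT bT]; split=> [z f g /=|f /=]; first by rewrite lS lT.
by apply: le_trans (bT _) _; rewrite -mulrA ler_wpM2l.
Qed.

Lemma bounded_comp (R : realType) d (X : measurableType d) (mu : probability X R)
    (S T : L2 mu -> L2 mu) :
  bounded_operators S -> bounded_operators T -> bounded_operators (T \o S).
Proof.
move=> /boundedP[c1 c10 h1] /boundedP[c2 c20 h2]; apply/boundedP.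
by exists (c2 * c1); [rewrite mulr_ge0|exact: bounded_by_comp h2].
Qed.

Section Compact.
Context (R : realType).

Lemma bounded_by_continuous d1 (X1 : measurableType d1) (m1 : probability X1 R)
    d2 (X2 : measurableType d2) (m2 : probability X2 R)
    (S : L2 m1 -> L2 m2) (c : R) : 0 <= c -> bounded_by S c -> continuous S.
Proof.
move=> c0 [lS bS] f A /nbhs_ballP[e /= e0 eA].
have c1 : 0 < (c + 1)%:C%C :> R[i] by rewrite ltcR ltr_wpDl.
apply/nbhs_ballP; exists (e / (c + 1)%:C%C) => /=; first by rewrite divr_gt0.
move=> g; rewrite -ball_normE /= => fg; apply: eA; rewrite -ball_normE /=.
rewrite -linB// norm2E; apply: (@le_lt_trans _ _ ((c + 1)%:C%C * `|f - g|)).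
  rewrite norm2E -realcM lecR; apply: le_trans (bS _) _.
  by rewrite ler_wpM2r ?norm2_ge0// lerDl.
by rewrite mulrC -ltr_pdivlMr.
Qed.

Variables (d1 d2 : measure_display).
Context (X1 : measurableType d1) (m1 : probability X1 R).
Context (X2 : measurableType d2) (m2 : probability X2 R).

(** The image of the unit ball under the composite lies in a continuous image of a
    dilate of the compact set that [K] provides. *)
Lemma compact_comp (S1 : L2 m1 -> L2 m2) (S2 : L2 m2 -> L2 m1) (c1 c2 : R)
    (K : L2 m2 -> L2 m2) : 0 <= c1 -> 0 <= c2 ->
  bounded_by S1 c1 -> bounded_by S2 c2 -> compact_operators K ->
  compact_operators (S2 \o K \o S1).
Proof.
move=> c10 c20 h1 h2 [bK cK]; have [lK _] := bK.
split.
  have /boundedP[c c0 hK] := bK; apply/boundedP.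
  exists (c2 * c * c1); first by rewrite !mulr_ge0.
  exact: (bounded_by_comp (mulr_ge0 c20 c0) h1 (bounded_by_comp c20 hK h2)).
pose c := c1 + 1; have c0 : 0 < c by rewrite /c ltr_wpDl.
pose S g := S2 (c%:C%C *: g).
have hS : bounded_by S (c2 * c).
  split=> [z f g|f]; first by rewrite /S scalerDr scalerA mulrC -scalerA h2.1.
  apply: le_trans (h2.2 _) _.
  by rewrite norm2Z normc_real ger0_norm ?(ltW c0)// mulrA.
have cS : compact (S @` closure (K @` [set v | `|v| <= 1])).
  apply: continuous_compact cK; apply: continuous_subspaceT.
  by apply: bounded_by_continuous hS; rewrite mulr_ge0// ltW.
apply: (subclosed_compact _ cS); first exact: closed_closure.
have clS := compact_closed (@norm_hausdorff _ (L2 m1)) cS.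
rewrite [X in _ `<=` X](_ : _ = closure (S @` closure (K @` [set v | `|v| <= 1])));
  last by apply/closure_id.
apply: closureS => _ [v /= v1 <-].
exists (K (c^-1%:C%C *: S1 v)).
  apply: subset_closure; exists (c^-1%:C%C *: S1 v) => //=.
  move: v1; rewrite !norm2E !lecR => v1.
  rewrite norm2Z normc_real ger0_norm ?invr_ge0 ?(ltW c0)//.
  rewrite mulrC ler_pdivrMr// mul1r; apply: le_trans (h1.2 v) _.
  apply: (@le_trans _ _ c1); last by rewrite lerDl.
  by rewrite ler_piMr.
rewrite /S -(linZ _ _ lK) scalerA -realcM divff ?scale1r//.
exact: lt0r_neq0.
Qed.

Lemma compact_net (K : L2 m1 -> L2 m1) (e : R) : compact_operators K -> 0 < e ->
  exists s : seq (L2 m1), forall f, norm2 f <= 1 ->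
    exists2 g, g \in s & norm2 (K f - g) < e.
Proof.
move=> [_]; rewrite compact_cover => cK e0.
have e0' : 0 < e%:C%C :> R[i] by rewrite ltcR.
have [||D' _ hD] := cK (L2 m1) setT (fun g => ball g e%:C%C).
- by move=> g _; exact: ball_open.
- by move=> g _; exists g => //; exact: ballxx.
exists (finmap.enum_fset D') => f f1.
have : closure (K @` [set v | `|v| <= 1]) (K f).
  by apply: subset_closure; exists f => //=; rewrite norm2E lecR.
move=> /hD[g /= gD]; rewrite -ball_normE /= norm2E ltcR => h.
by exists g => //; rewrite -opprB norm2N.
Qed.

End Compact.

Section L1.
Context (R : realType) d (X : measurableType d) (mu : probability X R).
Implicit Types (f g : L2 mu) (a b : Loo mu) (T : L2 mu -> L2 mu).

Definition norm1 f : R := \int[mu]_x normc (f x).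

Lemma L2_cint f : cint mu f. Proof. exact: cint_L2. Qed.

Lemma cLnorm1_norm1 f : cLnorm mu 1%E f = (norm1 f)%:E.
Proof. by rewrite cLnorm1E /norm1 Rint_EFin//; case: (L2_cint f). Qed.

Lemma norm1_ae f (u : X -> R[i]) : cmeasurable u -> {ae mu, forall x, f x = u x} ->
  norm1 f = \int[mu]_x normc (u x).
Proof.
move=> mf fu; apply: Rint_ae; [exact: meas_normc|exact: meas_normc|].
by apply: filterS fu => x ->.
Qed.

Lemma norm1Z z f : norm1 (z *: f) = normc z * norm1 f.
Proof.
rewrite (@norm1_ae _ (fun x => z * f x)).
- rewrite -RintZ; last by case: (L2_cint f).
  by apply: eq_Rintegral => x _; rewrite normcM.
- by apply: cmeasM => //; exact: cmeas_cst.
- exact: (cLp_scaleE z f).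
Qed.

Lemma norm_oo1P T (e : R) : (norm_oo1 T < e%:E)%E ->
  forall a, normoo a <= 1 -> norm1 (T (hat a)) <= e.
Proof.
move=> hT a a1; rewrite -lee_fin -cLnorm1_norm1; apply/ltW; apply: le_lt_trans _ hT.
by apply: ereal_sup_ubound; exists a => //=; rewrite normooE lecR.
Qed.

Lemma norm_oo1_le T (c : R) : (forall a, normoo a <= 1 -> norm1 (T (hat a)) <= c) ->
  (norm_oo1 T <= c%:E)%E.
Proof.
move=> h; apply: ge_ereal_sup => _ [a /= a1 <-].
by rewrite cLnorm1_norm1 lee_fin h//; move: a1; rewrite normooE lecR.
Qed.

Lemma norm1_ae_le f g (c : R) : 0 <= c ->
  {ae mu, forall x, normc (f x) <= c * normc (g x)} -> norm1 f <= c * norm1 g.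
Proof.
move=> c0 fg; have [_ ig] := L2_cint g; have [_ jf] := L2_cint f.
rewrite /norm1 -RintZ//; pose F x := Num.min (normc (f x)) (c * normc (g x)).
have mF : measurable_fun setT F.
  apply: measurable_minr; first exact: meas_normc.
  by apply: measurable_funM => //; exact: meas_normc.
have F0 x : 0 <= F x by rewrite le_min normc_ge0 mulr_ge0 ?normc_ge0.
have icg := intbleZ c ig.
rewrite (@Rint_ae _ _ _ _ _ F)//; last 2 first.
- exact: meas_normc.
- by apply: filterS fg => x h; rewrite /F min_l.
apply: Rint_le => //.
  by apply: intble_le icg => // x; rewrite ger0_norm// ge_min lexx orbT.
by move=> x; rewrite ge_min lexx orbT.
Qed.

End L1.

(** The (oo,1)-norm of [S2 \o T \o S1] is controlled by that of [T] when [S1]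
    satisfies the first of the following conditions and [S2] the second one. *)
Definition oo_bounded (R : realType)
    d1 (X1 : measurableType d1) (m1 : probability X1 R)
    d2 (X2 : measurableType d2) (m2 : probability X2 R)
    (S : L2 m1 -> L2 m2) (c : R) :=
  forall a : Loo m1, normoo a <= 1 ->
    exists2 b : Loo m2, normoo b <= 1 & S (hat a) = c%:C%C *: hat b.

Definition l1_bounded (R : realType)
    d1 (X1 : measurableType d1) (m1 : probability X1 R)
    d2 (X2 : measurableType d2) (m2 : probability X2 R)
    (S : L2 m1 -> L2 m2) (c : R) :=
  forall f, norm1 (S f) <= c * norm1 f.

(** This one stability property serves both for the multiplication operators and for
    the passage to a factor; approximants [K] of [T] give [S2 \o K \o S1]. *)
Lemma Koo1_comp (R : realType)
    d1 (X1 : measurableType d1) (m1 : probability X1 R)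
    d2 (X2 : measurableType d2) (m2 : probability X2 R)
    (S1 : L2 m1 -> L2 m2) (S2 : L2 m2 -> L2 m1) (b1 b2 c1 c2 : R)
    (T : L2 m2 -> L2 m2) : 0 <= b1 -> 0 <= b2 -> 0 <= c1 -> 0 <= c2 ->
  bounded_by S1 b1 -> bounded_by S2 b2 -> oo_bounded S1 c1 -> l1_bounded S2 c2 ->
  Koo1 T -> Koo1 (S2 \o T \o S1).
Proof.
move=> b10 b20 c10 c20 h1 h2 o1 l2 [bT hT]; split.
  have /boundedP[c c0 hK] := bT; apply/boundedP.
  exists (b2 * c * b1); first by rewrite !mulr_ge0.
  exact: (bounded_by_comp (mulr_ge0 b20 c0) h1 (bounded_by_comp b20 hK h2)).
move=> e e0; pose e' := e / (c1 * c2 + 1).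
have k0 : 0 < c1 * c2 + 1 by rewrite ltr_wpDl// mulr_ge0.
have e'0 : 0 < e' by rewrite divr_gt0.
have [K cK hK] := hT _ e'0; exists (S2 \o K \o S1); first exact: compact_comp h1 h2 cK.
apply: (@le_lt_trans _ _ (c1 * c2 * e')%:E); last first.
  rewrite lte_fin /e' mulrA ltr_pdivrMr// mulrC mulrDr mulr1 ltrDl//.
apply: norm_oo1_le => a a1; have [b b1' ab] := o1 a a1.
have [lT _] := bT; have [[lK _] _] := cK.
rewrite (_ : _ (hat a) = S2 (c1%:C%C *: (T - K) (hat b))); last first.
  rewrite -[LHS]/(S2 (T (S1 (hat a))) - S2 (K (S1 (hat a)))) ab.
  rewrite -(linB _ _ h2.1) (linZ _ _ lT) (linZ _ _ lK) -scalerBr.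
  by [].
rewrite (linZ _ _ h2.1) norm1Z normc_real ger0_norm// -mulrA ler_wpM2l//.
apply: le_trans (l2 _) _; rewrite ler_wpM2l//.
exact: norm_oo1P hK _ b1'.
Qed.

Section SM.
Context (R : realType) d (X : measurableType d) (mu : probability X R).
Implicit Types (f g : L2 mu) (a b : Loo mu) (T : L2 mu -> L2 mu).

Lemma lmul_oo_bounded a : oo_bounded (lmul a) (normoo a + 1).
Proof.
move=> b b1; set c := normoo a + 1.
have c0 : 0 < c by rewrite ltr_wpDl ?normoo_ge0.
(* The constant is [normoo a + 1] rather than [normoo a] to allow division. *)
pose u x := (c^-1)%:C%C * (a x * b x).
have um : cmeasurable u.
  apply: cmeasM; first exact: cmeas_cst.
  by apply: cmeasM; exact: oo_meas.
have u1 : {ae mu, forall x, normc (u x) <= 1}.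
  apply: filterS2 (ooP a) (ooP b) => x ax bx.
  rewrite /u !normcM normc_real ger0_norm ?invr_ge0 ?(ltW c0)//.
  rewrite mulrC ler_pdivrMr// mul1r; apply: (@le_trans _ _ (normoo a * 1)).
    by apply: ler_pM; rewrite ?normc_ge0//; exact: le_trans bx b1.
  by rewrite mulr1 lerDl.
have hu := toLooE um u1.
exists (toLoo mu u); first exact: normoo_le um u1 hu.
apply/cLp_eqP.
have h1 := cLp_scaleE c%:C%C (hat (toLoo mu u)).
apply: filterS2 (filterI (lmul_ae a (hat b)) (hat_ae b))
  (filterI (filterI h1 (hat_ae (toLoo mu u))) hu) => x [-> ->] [[e1 e2] e3].
rewrite -[cLp_fun (_ *: _) x]/(cLp_scale c%:C%C (hat (toLoo mu u)) x) e1 e2 e3.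
by rewrite /u mulrA -realcM divff ?mul1r// lt0r_neq0.
Qed.

Lemma lmul_l1_bounded a : l1_bounded (lmul a) (normoo a).
Proof.
move=> f; apply: norm1_ae_le; first exact: normoo_ge0.
apply: filterS2 (ooP a) (lmul_ae a f) => x ax ->.
by rewrite normcM ler_wpM2r ?normc_ge0.
Qed.

Lemma id_by1 : bounded_by (@id (L2 mu)) 1.
Proof. by split=> // f; rewrite mul1r. Qed.

Lemma id_oo_bounded : oo_bounded (@id (L2 mu)) 1.
Proof. by move=> a a1; exists a => //; rewrite scale1r. Qed.

Lemma id_l1_bounded : l1_bounded (@id (L2 mu)) 1.
Proof. by move=> f; rewrite mul1r. Qed.

Lemma Koo1_lmull a T : Koo1 T -> Koo1 (lmul a \o T).
Proof.
exact: (Koo1_comp (b1 := 1) ler01 (normoo_ge0 a) ler01 (normoo_ge0 a) id_by1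
  (lmul_by a) id_oo_bounded (lmul_l1_bounded a)).
Qed.

Lemma Koo1_lmulr a T : Koo1 T -> Koo1 (T \o lmul a).
Proof.
have c0 : 0 <= normoo a + 1 by rewrite addr_ge0 ?normoo_ge0.
exact: (Koo1_comp (b2 := 1) (normoo_ge0 a) ler01 c0 ler01 (lmul_by a)
  id_by1 (lmul_oo_bounded a) id_l1_bounded).
Qed.

(** As L^oo is abelian, [J a J] is the multiplication by the adjoint of [a]. *)
Lemma SMP T : SM T <-> bounded_operators T /\
  forall a, Koo1 ((T \o lmul a) - (lmul a \o T)).
Proof.
split=> -[bT h]; split=> // a.
  by have := h (star a); rewrite /= JlmulJ starK.
by move=> JaJ; rewrite /JaJ JlmulJ; exact: h.
Qed.

Lemma SM_lmull a T : SM T -> SM (lmul a \o T).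
Proof.
move=> /SMP[bT h]; apply/SMP; split.
  by apply: bounded_comp => //; exact: bounded_lmul.
move=> b; have := Koo1_lmull a (h b); congr Koo1; apply/funext => f.
rewrite -[LHS]/(lmul a (T (lmul b f) - lmul b (T f))).
by rewrite (linB _ _ (lmul_is_linear a)) (lmulC a b).
Qed.

Lemma SM_lmulr a T : SM T -> SM (T \o lmul a).
Proof.
move=> /SMP[bT h]; apply/SMP; split.
  by apply: bounded_comp => //; exact: bounded_lmul.
move=> b; have := Koo1_lmulr a (h b); congr Koo1; apply/funext => f.
rewrite -[LHS]/(T (lmul b (lmul a f)) - lmul b (T (lmul a f))).
by rewrite (lmulC b a).
Qed.

End SM.

(** * Exhaustion *)

Section Exhaustion.
Context (R : realType) (I : Type).
Variables (m : I -> R) (P : seq I -> Prop) (C : R).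
Hypotheses (m0 : forall i, 0 <= m i) (P0 : P [::]).
Hypothesis PC : forall s, P s -> \sum_(i <- s) m i <= C.

Lemma exhaustion_step n s : P s -> exists t, [/\ P t, exists u, t = u ++ s &
  forall i, P (i :: t) -> m i <= 2^-1 ^+ n].
Proof.
move=> Ps.
pose E := [set r | exists u, P (u ++ s) /\ r = \sum_(i <- u ++ s) m i].
have hE : has_sup E.
  split; first by exists (\sum_(i <- s) m i), [::].
  by exists C => _ [u [Pu ->]]; exact: PC.
have e0 : 0 < (2^-1 : R) ^+ n by rewrite exprn_gt0.
have [_ [u [Pu ->]] hu] := sup_adherent e0 hE.
exists (u ++ s); split; [by []|by exists u|move=> i Pi].
have : \sum_(j <- (i :: u) ++ s) m j <= sup E.
  by apply: ub_le_sup; [case: hE|exists (i :: u)].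
by rewrite cat_cons big_cons; move: hu; lra.
Qed.

(** A greedy construction: extend a list of admissible items again and again by
    nearly as much total mass as is possible. In the limit no item of positive
    mass can be added to all the lists. *)
Lemma exhaustion : exists s : nat -> seq I,
  [/\ forall n, P (s n), forall n, exists u, s n.+1 = u ++ s n &
      forall i, (forall n, P (i :: s n)) -> m i = 0].
Proof.
have /choice[next hnext] : forall ns : nat * seq I, exists t, P ns.2 ->
    [/\ P t, exists u, t = u ++ ns.2 & forall i, P (i :: t) -> m i <= 2^-1 ^+ ns.1].
  move=> [n s]; have [Ps|nPs] := pselect (P s); last by exists s.
  by have [t ht] := exhaustion_step n Ps; exists t.
pose s := fix s n := if n is k.+1 then next (k, s k) else [::].
have Ps n : P (s n) by elim: n => [//|n ih]; have [] := hnext (n, s n) ih.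
exists s; split=> //; first by move=> n; have [_ + _] := hnext (n, s n) (Ps n).
move=> i hi; apply/eqP; rewrite eq_le m0 andbT leNgt; apply/negP => mi.
have [n hn] := exp_half_small mi.
have [_ _ /(_ i (hi n.+1))] := hnext (n, s n) (Ps n).
by rewrite leNgt hn.
Qed.

End Exhaustion.

(** * States on the bounded operators *)

Section States.
Context (R : realType) d (X : measurableType d) (mu : probability X R).
Local Notation H := (L2 mu).
Local Notation B := (@bounded_operators R (L2 mu)).
Implicit Types (f g : H) (a b : Loo mu) (T K : H -> H).
Variable phi : (H -> H) -> R[i].
Hypothesis st : state_on B phi.

#[local] Hint Resolve bounded_id bounded_lmul boundedZ boundedD : core.

Lemma stateD T1 T2 : B T1 -> B T2 -> phi (T1 + T2) = phi T1 + phi T2.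
Proof. by move=> h1 h2; case: st => /(_ 1 T1 T2 h1 h2); rewrite scale1r mul1r. Qed.

Lemma state0 : phi 0 = 0.
Proof.
by apply: (addrI (phi 0)); rewrite -stateD ?addr0//; exact: bounded0.
Qed.

Lemma stateZ z T : B T -> phi (z *: T) = z * phi T.
Proof.
move=> h; case: st => /(_ z T 0 h (bounded0 _)) + _ _.
by rewrite addr0 state0 addr0.
Qed.

Lemma state_pos T : B T -> (forall f, 0 <= inner (T f) f) -> 0 <= phi T.
Proof. by case: st => _ h _; exact: h. Qed.

Lemma state1 : phi id = 1. Proof. by case: st. Qed.

(** Adding a large multiple of the identity makes [T] positive, and the values of
    [phi] on positive operators are real. *)
Lemma state_real T : B T -> (forall f, cIm (inner (T f) f) = 0) -> cIm (phi T) = 0.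
Proof.
move=> bT hT; have /boundedP[c c0 [lT nT]] := bT.
have bS : B (T + c%:C%C *: id) by apply: boundedD => //; apply: boundedZ; exact: bounded_id.
have : 0 <= phi (T + c%:C%C *: id).
  apply: state_pos => // f.
  rewrite -[(_ + _) f]/(T f + c%:C%C *: f) innerDl innerZl inner_norm2 -realcM.
  have := hT f; have := inner_CS (T f) f; have := nT f; have := norm2_ge0 f.
  have := absRe_le (inner (T f) f).
  case: (inner (T f) f) => p q /= hp f0 Tf hpq ->.
  rewrite lecE /= addr0 eqxx /=.
  have : `|p| <= c * norm2 f ^+ 2.
    by rewrite expr2 mulrA (le_trans hp)// (le_trans hpq)// ler_wpM2r.
  by rewrite ler_norml; lra.
rewrite stateD ?stateZ ?state1//; try by auto.
by rewrite mulr1; case: (phi T) => p q; rewrite lecE /= addr0 => /andP[/eqP].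
Qed.

(** The modulus of [phi T] is controlled by the numerical range of [T]: rotate
    [phi T] to the positive real axis and apply positivity to the real part of
    the rotated operator. *)
Lemma state_dom T P : B T -> B P ->
  (forall f, (normc (inner (T f) f))%:C%C <= inner (P f) f) ->
  normc (phi T) <= cRe (phi P).
Proof.
move=> bT bP dom.
pose u := (phase (phi T))^*%C.
have u1 : normc u <= 1 by rewrite normc_conj normc_phase_le1.
pose A := u *: T; have bA : B A by exact: boundedZ.
have phiA : phi A = (normc (phi T))%:C%C.
  by rewrite stateZ// mulrC mul_phaseJ.
have AE f : A f = u *: T f by [].
clearbody A; have /boundedP[c c0 hA] := bA.
have [A' [hA' adj]] := adjoint_exists c0 hA.
have bA' : B A' by apply/boundedP; exists c.
have adj' f : inner (A' f) f = (inner (A f) f)^*%C by rewrite adj innerC.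
have re : cRe (phi A') = cRe (phi A).
  have := @state_real ('i%C *: (A + (-1) *: A')).
  have b1 : B ((-1) *: A') by exact: boundedZ.
  have b2 : B (A + (-1) *: A') by exact: boundedD.
  rewrite stateZ// stateD// stateZ// => /(_ (boundedZ _ b2)) /(_ _)/wrap[].
    move=> f; rewrite -[(_ *: _) f]/('i%C *: (A f + (-1) *: A' f)).
    rewrite (innerZl 'i%C) innerDl (innerZl (-1)) adj'.
    by case: (inner (A f) f) => p q /=; ring.
  by case: (phi A) (phi A') => p q [r s] /=; lra.
have bS : B (2%:C%C *: P + (-1) *: (A + A')).
  by apply: boundedD; apply: boundedZ => //; apply: boundedD.
have : 0 <= phi (2%:C%C *: P + (-1) *: (A + A')).
  apply: state_pos => // f.
  rewrite -[(_ + _) f]/(2%:C%C *: P f + (-1) *: (A f + A' f)).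
  rewrite innerDl (innerZl 2%:C%C) (innerZl (-1)) innerDl adj'.
  have h : normc (inner (A f) f) <= normc (inner (T f) f).
    rewrite AE innerZl normcM ler_piMl ?normc_ge0//.
  have := absRe_le (inner (A f) f); rewrite ler_norml => /andP[_].
  move: h (dom f); case: (inner (A f) f) (inner (P f) f) => p q [r s].
  move: (normc (inner (T f) f)) => t; rewrite !lecE => /= h /andP[/eqP -> hP] hp.
  by apply/andP; split; [apply/eqP; ring|lra].
rewrite stateD ?stateZ ?stateD//; try by auto.
rewrite phiA in re *; move: re.
case: (phi P) (phi A') => p q [r s] /= ->; rewrite lecE /= => /andP[_].
by lra.
Qed.

Lemma state_norm T (c : R) : B T ->
  (forall f, normc (inner (T f) f) <= c * norm2 f ^+ 2) -> normc (phi T) <= c.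
Proof.
move=> bT hT; have -> : c = cRe (phi (c%:C%C *: id)).
  by rewrite stateZ ?state1 ?mulr1//; exact: bounded_id.
apply: state_dom => //; first by apply: boundedZ; exact: bounded_id.
move=> f; rewrite -[(_ *: _) f]/(c%:C%C *: f) innerZl inner_norm2 -realcM lecR.
exact: hT.
Qed.

Hypothesis tr : forall a, phi (lmul a) = tau a.
Hypothesis ce : central_on B phi.

Lemma tau_indicator (A : set X) : measurable A ->
  tau (indicator mu A) = (fine (mu A))%:C%C.
Proof.
move=> mA; rewrite /tau -Rint_indic// -cintegral_real.
by apply: cintegral_ae; [exact: oo_meas|exact: cmeas_indic|exact: indicator_ae].
Qed.

Lemma state_norm_on (A : set X) T (c : R) : measurable A -> B T ->
  (forall f, normc (inner (T f) f) <= c * norm2 (lmul (indicator mu A) f) ^+ 2) ->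
  normc (phi T) <= c * fine (mu A).
Proof.
move=> mA bT hT.
have -> : c * fine (mu A) = cRe (phi (c%:C%C *: lmul (indicator mu A))).
  by rewrite stateZ ?tr ?tau_indicator -?realcM//; exact: bounded_lmul.
apply: state_dom => //; first by apply: boundedZ; exact: bounded_lmul.
move=> f; rewrite -[(_ *: _) f]/(c%:C%C *: lmul (indicator mu A) f).
by rewrite innerZl inner_proj// -realcM lecR.
Qed.

(** By centrality one of two equal projections on the left can be moved to the
    right. *)
Lemma state_corner (A : set X) T : measurable A -> B T ->
  phi (lmul (indicator mu A) \o T) =
  phi (lmul (indicator mu A) \o T \o lmul (indicator mu A)).
Proof.
move=> mA bT; rewrite -ce; last by apply: bounded_comp => //; exact: bounded_lmul.
by congr phi; apply/funext => f /=; rewrite proj_idem.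
Qed.

Lemma inner_corner (A : set X) T f : measurable A ->
  inner (lmul (indicator mu A) (T (lmul (indicator mu A) f))) f =
  inner (T (lmul (indicator mu A) f)) (lmul (indicator mu A) f).
Proof. by move=> mA; rewrite inner_lmul star_indicator. Qed.

Lemma bounded_corner (A : set X) T : B T ->
  B (lmul (indicator mu A) \o T \o lmul (indicator mu A)).
Proof.
move=> bT; apply: bounded_comp; first exact: bounded_lmul.
by apply: bounded_comp => //; exact: bounded_lmul.
Qed.

(** The marginal of [phi] being absolutely continuous, cutting an operator down to a
    set of small measure makes its value small: this takes the place of
    normality, which [phi] may lack. *)
Lemma state_cut_le (A : set X) T (c : R) : measurable A -> bounded_by T c -> B T ->
  normc (phi (lmul (indicator mu A) \o T)) <= c * fine (mu A).
Proof.
move=> mA hT bT; rewrite state_corner//; apply: state_norm_on => //.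
  exact: bounded_corner.
move=> f; rewrite (inner_corner T f mA); apply: le_trans (inner_CS _ _) _.
by rewrite expr2 mulrA ler_wpM2r ?norm2_ge0//; exact: hT.2.
Qed.

Lemma indicatorU_lmul (A A' : set X) f : measurable A -> measurable A' ->
  A `&` A' = set0 -> lmul (indicator mu (A `|` A')) f =
  lmul (indicator mu A) f + lmul (indicator mu A') f.
Proof.
move=> mA mA' AA'; apply/cLp_eqP.
apply: filterS2 (filterI (proj_ae f mA) (proj_ae f mA'))
  (filterI (proj_ae f (measurableU _ _ mA mA'))
     (cLpD (lmul (indicator mu A) f) (lmul (indicator mu A') f))) => x [e1 e2] [-> ->].
rewrite e1 e2 -mulrDl -realcD !indicE in_setU.
have [xA|xA] /= := boolP (x \in A); last by rewrite add0r.
rewrite (_ : x \in A' = false) ?addr0//; apply/negbTE/negP => xA'.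
by have : (A `&` A') x by [split; exact: set_mem]; rewrite AA'.
Qed.

Lemma state_split (A : set X) T : measurable A -> B T ->
  phi T = phi (lmul (indicator mu A) \o T) + phi (lmul (indicator mu (~` A)) \o T).
Proof.
move=> mA bT; rewrite -stateD; last 2 first.
- by apply: bounded_comp => //; exact: bounded_lmul.
- by apply: bounded_comp => //; exact: bounded_lmul.
congr phi; apply/funext => f.
rewrite -[RHS]/(lmul (indicator mu A) (T f) + lmul (indicator mu (~` A)) (T f)).
rewrite -indicatorU_lmul ?setICr//; last exact: measurableC.
rewrite setUv; apply/cLp_eqP.
apply: filterS (proj_ae (T f) (@measurableT _ X)) => x ->.
by rewrite indicT /= mul1r.
Qed.

End States.

(** * Central states with diffuse marginal vanish on compact operators *)

Section Diffuse.
Context (R : realType) d (X : measurableType d) (mu : probability X R).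
Implicit Types (f g : L2 mu) (A C : set X).

Lemma fine_mu_ge0 A : 0 <= fine (mu A).
Proof. exact: fine_ge0. Qed.

Lemma fine_mu_gt0 A : measurable A -> (0 < mu A)%E = (0 < fine (mu A)).
Proof.
by move=> mA; rewrite -lte_fin fineK// fin_num_measure.
Qed.

Lemma fine_muU A C : measurable A -> measurable C -> A `&` C = set0 ->
  fine (mu (A `|` C)) = fine (mu A) + fine (mu C).
Proof.
by move=> mA mC AC; rewrite measureU// fineD// fin_num_measure.
Qed.

Lemma fine_muC A : measurable A -> fine (mu (~` A)) = 1 - fine (mu A).
Proof.
move=> mA; have := fine_muU mA (measurableC mA) (setICr A).
by rewrite setUv probability_setT /= => ->; rewrite addrC addKr.
Qed.

Hypothesis diff : diffuse mu.

Lemma diffuse_half A : measurable A -> 0 < fine (mu A) ->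
  exists C, [/\ measurable C, C `<=` A, 0 < fine (mu C) &
    fine (mu C) <= fine (mu A) / 2].
Proof.
move=> mA A0.
have [|C [mC CA C0 CltA]] := diff mA; first by rewrite fine_mu_gt0.
have mD : measurable (A `\` C) by exact: measurableD.
have e : fine (mu A) = fine (mu C) + fine (mu (A `\` C)).
  by rewrite -fine_muU// ?setDUK// setDIK.
have CA' : fine (mu C) < fine (mu A).
  by rewrite -lte_fin !fineK// fin_num_measure.
rewrite fine_mu_gt0// in C0.
have [h|h] := leP (fine (mu C)) (fine (mu A) / 2); first by exists C.
exists (A `\` C); split=> //; lra.
Qed.

Lemma diffuse_small A (e : R) : measurable A -> 0 < fine (mu A) -> 0 < e ->
  exists C, [/\ measurable C, C `<=` A, 0 < fine (mu C) & fine (mu C) <= e].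
Proof.
move=> mA A0 e0.
have h n : exists C, [/\ measurable C, C `<=` A, 0 < fine (mu C) &
    fine (mu C) <= fine (mu A) * 2^-1 ^+ n].
  elim: n => [|n [C [mC CA C0 Cn]]].
    by exists A; split=> //; rewrite expr0 mulr1.
  have [C' [mC' CC' C'0 C'n]] := diffuse_half mC C0.
  exists C'; split=> //; first exact: subset_trans CC' CA.
  by move: C'n Cn; rewrite exprS; lra.
have [n hn] := exp_half_small (divr_gt0 e0 A0).
have [C [mC CA C0 Cn]] := h n; exists C; split=> //; apply: le_trans Cn _.
by rewrite mulrC -ler_pdivlMr// ltW.
Qed.

Lemma norm2_proj_sub A C f : measurable A -> measurable C -> C `<=` A ->
  norm2 (lmul (indicator mu C) f) <= norm2 (lmul (indicator mu A) f).
Proof.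
move=> mA mC CA; rewrite -[leRHS]mul1r; apply: norm2_ae_le => //.
apply: filterS2 (proj_ae f mA) (proj_ae f mC) => x -> ->.
rewrite mul1r !normcM ler_wpM2r ?normc_ge0// !normc_real !indicE.
have [xC|xC] := boolP (x \in C); last by rewrite normr0.
by rewrite (mem_set (CA _ (set_mem xC))).
Qed.

(** Below any set of positive measure an L2 function becomes arbitrarily small in
    norm on a subset of positive measure: first bound it, then shrink the set. *)
Lemma small_cut f A (e : R) : measurable A -> 0 < fine (mu A) -> 0 < e ->
  exists C, [/\ measurable C, C `<=` A, 0 < fine (mu C) &
    norm2 (lmul (indicator mu C) f) <= e].
Proof.
move=> mA A0 e0.
pose L n := [set x | normc (f x) <= n%:R].
have mL n : measurable (L n).
  rewrite (_ : L n = (fun x => normc (f x)) @^-1` `]-oo, n%:R]).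
    by rewrite -[X in measurable X]setTI; exact: (meas_normc (L2_meas f)).
  by apply/seteqP; split => x /=; rewrite in_itv.
have [n hn] : exists n, 0 < fine (mu (A `&` L n)).
  apply: contrapT => /forallNP h.
  have : mu A = 0%E.
    apply/(negligibleP mu mA).
    have -> : A = \bigcup_n (A `&` L n).
      rewrite -setI_bigcupr [X in _ `&` X](_ : _ = setT) ?setIT//.
      apply/seteqP; split=> // x _.
      have [n _ /(_ n (leqnn n)) hn] := nbhs_infty_ger (normc (f x)).
      by exists n.
    apply: negligible_bigcup => n; apply/(negligibleP mu); first exact: measurableI.
    apply/eqP; rewrite -measure_le0 leNgt fine_mu_gt0; last exact: measurableI.
    by apply/negP; exact: h.
  by move=> h0; move: A0; rewrite h0 ltxx.
have mAL : measurable (A `&` L n) by exact: measurableI.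
pose N : R := n%:R + 1.
have N0 : 0 < N by rewrite /N ltr_wpDl.
have e' : 0 < (e / N) ^+ 2 by rewrite exprn_gt0// divr_gt0.
have [C [mC CA C0 Ce]] := diffuse_small mAL hn e'.
exists C; split=> //; first by move=> x /CA[].
rewrite -(@ler_pXn2r _ 2) ?nnegrE ?norm2_ge0 ?(ltW e0)//.
rewrite norm2_sqrE.
rewrite (@Rint_ae _ _ _ _ _ (fun x => \1_C x * normc (f x) ^+ 2)); first last.
- apply: filterS (proj_ae f mC) => x ->; rewrite normcM normc_real indicE.
  by case: (_ \in _); rewrite ?normr0 ?normr1 ?mul0r ?mul1r// expr0n.
- apply: measurable_funM; first exact: measurable_indic.
  by apply: measurable_funX; exact: meas_normc.
- by apply: measurable_funX; exact: meas_normc.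
apply: (@le_trans _ _ (\int[mu]_x (N ^+ 2 * \1_C x))).
  apply: Rint_le.
  - by apply: intble_indic => //; case: (L2P f).
  - apply: intbleZ; apply: (@intble_bounded _ _ _ _ _ 1).
      exact: measurable_indic.
    by move=> x; rewrite indicE; case: (_ \in _); rewrite ?normr0 ?normr1.
  move=> x; rewrite indicE; have [xC|_] := boolP (x \in C); last first.
    by rewrite mul0r mulr0.
  have [_ hx] := CA _ (set_mem xC); rewrite mul1r mulr1.
  by rewrite lerXn2r// ?nnegrE ?normc_ge0 ?(ltW N0)// (le_trans hx)// lerDl.
rewrite RintZ; last first.
  apply: (@intble_bounded _ _ _ _ _ 1); first exact: measurable_indic.
  by move=> x; rewrite indicE; case: (_ \in _); rewrite ?normr0 ?normr1.
rewrite Rint_indic// mulrC -ler_pdivlMr ?exprn_gt0//.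
by move: Ce; rewrite exprMn exprVn.
Qed.

Lemma small_cuts (s : seq (L2 mu)) A (e : R) :
  measurable A -> 0 < fine (mu A) -> 0 < e ->
  exists C, [/\ measurable C, C `<=` A, 0 < fine (mu C) &
    forall g, g \in s -> norm2 (lmul (indicator mu C) g) <= e].
Proof.
move=> mA A0 e0; elim: s => [|g s [C [mC CA C0 hC]]]; first by exists A; split.
have [D [mD DC D0 hD]] := small_cut g mC C0 e0.
exists D; split=> //; first exact: subset_trans DC CA.
move=> h; rewrite inE => /predU1P[->//|hs].
exact: le_trans (norm2_proj_sub h mC mD DC) (hC h hs).
Qed.

(** By compactness [K] is small on the range of some indicator below any set. *)
Lemma compact_small_cut (K : L2 mu -> L2 mu) A (e : R) : compact_operators K ->
  measurable A -> 0 < fine (mu A) -> 0 < e ->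
  exists C, [/\ measurable C, C `<=` A, 0 < fine (mu C) &
    forall f, norm2 (lmul (indicator mu C) (K f)) <= e * norm2 f].
Proof.
move=> cK mA A0 e0; have e2 : 0 < e / 2 by rewrite divr_gt0.
have [s hs] := compact_net cK e2.
have [C [mC CA C0 hC]] := small_cuts s mA A0 e2.
exists C; split=> // f; have [[lK _] _] := cK.
have [f0|f0] := eqVneq (norm2 f) 0.
  by rewrite (norm2_eq0 f0) (lin0 lK) (lin0 (lmul_is_linear _)) norm20 mulr0.
have f1 : 0 < norm2 f by rewrite lt_neqAle eq_sym f0 norm2_ge0.
pose h := ((norm2 f)^-1)%:C%C *: f.
have fE : f = (norm2 f)%:C%C *: h by rewrite scalerA -realcM divff// scale1r.
have h1 : norm2 h <= 1.
  by rewrite norm2Z normc_real ger0_norm ?invr_ge0 ?norm2_ge0// mulVf.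
have [g gs hg] := hs h h1.
rewrite {1}fE (linZ _ _ lK) (linZ _ _ (lmul_is_linear _)) norm2Z normc_real.
rewrite ger0_norm ?norm2_ge0// mulrC ler_pM2r//.
rewrite -(subrK g (K h)) (linD _ _ (lmul_is_linear _)).
apply: le_trans (norm2D _ _) _; rewrite [leRHS](splitr e).
by apply: lerD; [exact: le_trans (norm2_proj _ mC) (ltW hg)|exact: hC].
Qed.

Variable phi : (L2 mu -> L2 mu) -> R[i].
Hypothesis st : state_on (@bounded_operators R (L2 mu)) phi.
Hypothesis tr : forall a : Loo mu, phi (lmul a) = tau a.
Hypothesis ce : central_on (@bounded_operators R (L2 mu)) phi.

(** Cut the space into sets on whose indicators [K] is small; by centrality only
    the diagonal blocks contribute to [phi K]. *)
Lemma state_compact0 (K : L2 mu -> L2 mu) : compact_operators K -> phi K = 0.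
Proof.
move=> cK; have [bK _] := cK; have /boundedP[c c0 hK] := bK.
suff small (e : R) : 0 < e -> normc (phi K) <= e + e * c.
  apply/eq0_normc/eqP; rewrite eq_le normc_ge0 andbT leNgt; apply/negP => h.
  have c1 : 0 < 1 + c by rewrite ltr_pwDl.
  have := small (normc (phi K) / (1 + c) / 2); rewrite !divr_gt0// => /(_ isT).
  rewrite -[X in _ <= X](_ : normc (phi K) / 2 = _).
    by rewrite leNgt => /negP; apply; rewrite ltr_pdivrMr// mulr_natr mulr2n ltrDl.
  by field; exact: lt0r_neq0.
move=> e0.
pose U := foldr (fun A V : set X => A `|` V) set0.
pose good A := measurable A /\ forall f, norm2 (lmul (indicator mu A) (K f)) <= e * norm2 f.
pose P := fix P (s : seq (set X)) :=
  if s is A :: s' then [/\ good A, A `&` U s' = set0 & P s'] else True.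
have PU s : P s -> measurable (U s) /\ fine (mu (U s)) = \sum_(A <- s) fine (mu A).
  elim: s => [|A s ih] /=; first by rewrite measure0 big_nil.
  move=> [[mA _] AU /ih[mU eU]]; split; first exact: measurableU.
  by rewrite fine_muU// big_cons eU.
have Ple s : P s -> \sum_(A <- s) fine (mu A) <= 1.
  move=> /PU[mU <-]; rewrite -lee_fin fineK ?fin_num_measure//.
  exact: probability_le1.
have [s [Ps ext max]] := exhaustion fine_mu_ge0 (I : P [::]) Ple.
pose W n := U (s n).
have mW n : measurable (W n) by have [] := PU _ (Ps n).
have Wincr n m : (n <= m)%N -> W n `<=` W m.
  elim: m => [|m ih]; first by rewrite leqn0 => /eqP ->.
  rewrite leq_eqVlt => /orP[/eqP -> //|]; rewrite ltnS => /ih{}ih.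
  apply: (subset_trans ih); rewrite /W; have [u ->] := ext m.
  elim: u => //= A u {}ih x /ih h; right; exact: h.
pose V := \bigcup_n W n.
have mV : measurable V by exact: bigcup_measurable.
have V1 : fine (mu (~` V)) = 0.
  apply/eqP; rewrite eq_le fine_mu_ge0 andbT leNgt; apply/negP => h.
  have [C [mC CV C0 hC]] := compact_small_cut cK (measurableC mV) h e0.
  have : fine (mu C) = 0.
    apply: max => n; split=> //.
    by apply/seteqP; split=> // x [/CV] /= nV Wx; apply: nV; exists n.
  by move=> h0; rewrite h0 ltxx in C0.
have [n hn] : exists n, fine (mu (~` W n)) < e.
  have cv : (mu \o W) @ \oo --> mu V.
    by apply: nondecreasing_cvg_mu => // n m nm; apply/subsetPset/Wincr.
  have muV : mu V = 1%:E.
    have := fine_muC mV; rewrite V1 => /eqP; rewrite eq_sym subr_eq0 => /eqP h.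
    by rewrite -[mu V]fineK ?fin_num_measure// -h.
  rewrite muV in cv.
  have cv' : (fun n => fine (mu (W n))) @ \oo --> (1 : R) by exact: fine_cvg cv.
  have e1 : 1 - e < 1 by rewrite ltrBlDr ltrDl.
  have [n _ /(_ n (leqnn n)) hn] := cvgr_gt _ cv' _ e1.
  by exists n; rewrite fine_muC//; move: hn => /=; lra.
rewrite (state_split st (mW n) bK).
apply: le_trans (le_normcD _ _) _; apply: lerD; last first.
  apply: le_trans (state_cut_le st tr ce (measurableC (mW n)) hK bK) _.
  by rewrite mulrC ler_wpM2r// ltW.
apply: (@le_trans _ _ (e * fine (mu (W n)))); last first.
  rewrite ler_piMr ?(ltW e0)// -lee_fin fineK ?fin_num_measure//.
  exact: probability_le1.
rewrite /W; elim: (s n) (Ps n) => [|A t ih] /=.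
  move=> _; rewrite (_ : _ \o _ = 0) ?state0// ?normc0 ?measure0 ?mulr0//.
  apply/funext => f /=; apply/cLp_eqP.
  apply: filterS2 (proj_ae (K f) measurable0) (cLp0 mu (@le1_2 R)) => x -> h.
  by rewrite indic0 mul0r -[cLp_fun _ x]/(cLp_fun (0 : L2 mu) x) h.
move=> [[mA hA] AU /[dup] Pt /ih{}ih]; have [mU _] := PU _ Pt.
rewrite fine_muU// mulrDr.
have -> : lmul (indicator mu (A `|` U t)) \o K =
    (lmul (indicator mu A) \o K) + (lmul (indicator mu (U t)) \o K).
  by apply/funext => f /=; rewrite indicatorU_lmul.
rewrite stateD//; last 2 first.
- by apply: bounded_comp => //; exact: bounded_lmul.
- by apply: bounded_comp => //; exact: bounded_lmul.
apply: le_trans (le_normcD _ _) _; apply: lerD => //.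
rewrite (state_corner ce)//; apply: (state_norm_on st tr) => //.
  exact: bounded_corner.
move=> f; rewrite (inner_corner K f mA).
set g := lmul (indicator mu A) f.
have -> : inner (K g) g = inner (lmul (indicator mu A) (K g)) g.
  by rewrite inner_lmul star_indicator// proj_idem.
apply: le_trans (inner_CS _ _) _.
by rewrite expr2 mulrA ler_wpM2r ?norm2_ge0.
Qed.

End Diffuse.

(** * A Grothendieck inequality *)

(** Signed sums are enumerated with repetitions, so that the average over independent
    random signs is a sum over this list divided by [2 ^ size s]. *)
Fixpoint signs (V : zmodType) (s : seq V) : seq V :=
  if s is p :: s' then
    [seq q + p | q <- signs s'] ++ [seq q - p | q <- signs s'] else [:: 0].

Section Signs.

Lemma size_signs (V : zmodType) (s : seq V) : size (signs s) = (2 ^ size s)%N.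
Proof.
by elim: s => //= p s ih; rewrite size_cat !size_map ih expnS mul2n addnn.
Qed.

Lemma signs_map (V W : zmodType) (f : V -> W) (s : seq V) : f 0 = 0 ->
  {morph f : p q / p + q} -> {morph f : p q / p - q} ->
  signs (map f s) = map f (signs s).
Proof.
move=> f0 fD fB; elim: s => /= [|p s ih]; first by rewrite f0.
rewrite ih map_cat -!map_comp; congr (_ ++ _); apply: eq_map => q /=.
  by rewrite fD.
by rewrite fB.
Qed.

Lemma signs_in (V : zmodType) (D : V -> Prop) (s : seq V) : D 0 ->
  (forall p q, D p -> D q -> D (p + q)) -> (forall p q, D p -> D q -> D (p - q)) ->
  (forall p, p \in s -> D p) -> forall q, q \in signs s -> D q.
Proof.
move=> D0 DD DB; elim: s => /= [|p s ih] hs q; first by rewrite inE => /eqP ->.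
have {}ih : forall q, q \in signs s -> D q.
  by apply: ih => r rs; apply: hs; rewrite inE rs orbT.
have Dp : D p by apply: hs; rewrite inE eqxx.
by rewrite mem_cat => /orP[] /mapP[r /ih Dr ->]; [exact: DD|exact: DB].
Qed.

(** Averaging over signs decouples a quadratic form, by induction from the
    parallelogram law. The law is required on a subgroup [D] only, since the forms
    below are additive for square-integrable functions only. *)
Lemma signs_quad (V W : zmodType) (D : V -> Prop) (Q : V -> W) (s : seq V) :
  D 0 -> (forall p q, D p -> D q -> D (p + q)) ->
  (forall p q, D p -> D q -> D (p - q)) -> Q 0 = 0 ->
  (forall p q, D p -> D q -> Q (q + p) + Q (q - p) = Q q *+ 2 + Q p *+ 2) ->
  (forall p, p \in s -> D p) ->
  \sum_(q <- signs s) Q q = (\sum_(p <- s) Q p) *+ 2 ^ size s.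
Proof.
move=> D0 DD DB Q0 Qpar; elim: s => /= [|p s ih] hs; first by rewrite big_seq1 big_nil.
have hs' : forall r, r \in s -> D r by move=> r rs; apply: hs; rewrite inE rs orbT.
have Dp : D p by apply: hs; rewrite inE eqxx.
rewrite big_cat !big_map /= -big_split /= big_cons expnS mulrnDl.
rewrite (eq_big_seq (fun q => Q q *+ 2 + Q p *+ 2)); last first.
  by move=> q qs; apply: Qpar => //; exact: (signs_in D0 DD DB hs' qs).
rewrite big_split /= sumrMnl ih// addrC.
rewrite big_const_seq count_predT size_signs iter_addr addr0.
by rewrite -!mulrnA (mulnC 2).
Qed.

Context (R : realType).
Implicit Types (z : R[i]) (s : seq R[i]).

Lemma normc_par z w : normc (w + z) ^+ 2 + normc (w - z) ^+ 2 =
  normc w ^+ 2 *+ 2 + normc z ^+ 2 *+ 2.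
Proof. by rewrite !normc_sqr; case: z w => ? ? [? ?] /=; ring. Qed.

Lemma signs_sqr s : \sum_(q <- signs s) normc q ^+ 2 =
  (2 ^ size s)%:R * \sum_(z <- s) normc z ^+ 2.
Proof.
rewrite (@signs_quad _ _ (fun=> True) (fun z => normc z ^+ 2 : R))//.
- by rewrite mulr_natl.
- by rewrite normc0 expr0n.
- by move=> p q _ _; exact: normc_par.
Qed.

Lemma normc_fourth z w : normc (w + z) ^+ 4 + normc (w - z) ^+ 4 <=
  2 * normc w ^+ 4 + 12 * (normc w ^+ 2 * normc z ^+ 2) + 2 * normc z ^+ 4.
Proof.
have e4 (t : R[i]) : normc t ^+ 4 = (normc t ^+ 2) ^+ 2 by rewrite -exprM.
rewrite !e4 !normc_sqr; case: z w => a b [c e] /=.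
have := sqr_ge0 (c * b - e * a); have := sqr_ge0 (a * c + b * e); nra.
Qed.

(** Khinchine's inequality for the fourth moment: the terms of odd order in the last
    entry cancel between its two signs. *)
Lemma signs_fourth s : \sum_(q <- signs s) normc q ^+ 4 <=
  3 * (2 ^ size s)%:R * (\sum_(z <- s) normc z ^+ 2) ^+ 2.
Proof.
elim: s => [|z s ih] /=; first by rewrite big_seq1 big_nil normc0 !expr0n mulr0.
rewrite big_cat !big_map /= -big_split /= big_cons expnS natrM.
apply: (@le_trans _ _ (\sum_(q <- signs s)
    (2 * normc q ^+ 4 + 12 * (normc q ^+ 2 * normc z ^+ 2) + 2 * normc z ^+ 4))).
  by apply: ler_sum => q _; exact: normc_fourth.
rewrite !big_split /= -[X in X + _ + _]mulr_sumr -[X in _ + X + _]mulr_sumr.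
rewrite -[X in _ + _ + X]mulr_sumr -[X in _ + 12 * X + _]mulr_suml signs_sqr.
have -> : \sum_(q <- signs s) normc z ^+ 4 = (2 ^ size s)%:R * normc z ^+ 4.
  by rewrite big_const_seq count_predT size_signs iter_addr addr0 mulr_natl.
set N := (2 ^ size s)%:R in ih *; set S := \sum_(j <- s) _ in ih *.
have N0 : 0 <= N by rewrite ler0n.
have z0 : 0 <= normc z ^+ 4 by rewrite exprn_ge0 ?normc_ge0.
have -> : normc z ^+ 4 = (normc z ^+ 2) ^+ 2 by rewrite -exprM.
have := mulr_ge0 N0 (sqr_ge0 (normc z ^+ 2)); move: ih.
set F := \sum_(q <- _) _; set t := normc z ^+ 2.
by move=> *; lra.
Qed.

(** Truncation at the level [8], high enough for the two remainders in [grothendieck]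
    to be absorbed by half of a supremum. *)
Definition lo z : R[i] := if normc z <= 8 then z else 0.

Lemma normc_lo z : normc (lo z) <= 8.
Proof. by rewrite /lo; case: ifPn => // _; rewrite normc0. Qed.

Lemma normc_lo_le z : normc (lo z) <= normc z.
Proof. by rewrite /lo; case: ifPn => // _; rewrite normc0 normc_ge0. Qed.

Lemma normc_hi z : 64 * normc (z - lo z) ^+ 2 <= normc z ^+ 4.
Proof.
rewrite /lo; case: ifPn => [_|].
  by rewrite subrr normc0 expr0n mulr0 exprn_ge0 ?normc_ge0.
rewrite subr0 -ltNge => h.
rewrite (_ : _ ^+ 4 = normc z ^+ 2 * normc z ^+ 2); last by rewrite -exprD.
rewrite ler_wpM2r ?sqr_ge0//.
by rewrite (_ : 64 = 8 ^+ 2) ?lerXn2r ?nnegrE ?normc_ge0 ?(ltW h)// -natrX.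
Qed.

End Signs.

Lemma cmeas_lo d (X : measurableType d) (R : realType) (u : X -> R[i]) :
  cmeasurable u -> cmeasurable (fun x => lo (u x)).
Proof.
move=> mu.
have -> : (fun x => lo (u x)) = (fun x => (\1_[set x | normc (u x) <= 8] x : R)%:C%C * u x).
  apply/funext => x; rewrite /lo indicE; case: ifPn => h.
    by rewrite mem_set// mul1r.
  by rewrite memNset ?mul0r//; exact/negP.
apply: cmeasM => //; apply: cmeas_indic.
rewrite (_ : [set x | _] = (fun x => normc (u x)) @^-1` `]-oo, 8]).
  by rewrite -[X in measurable X]setTI; exact: (meas_normc mu).
by apply/seteqP; split => x /=; rewrite in_itv.
Qed.

Section Grothendieck.
Context (R : realType) d (X : measurableType d) (mu : probability X R).
Local Notation H := (L2 mu).
Local Notation V := ((X -> R[i]) * (X -> R[i]))%type.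
Variables (T : H -> H) (c eps : R).
Hypotheses (c0 : 0 <= c) (hT : bounded_by T c).
Hypothesis oo1 : forall a : Loo mu, normoo a <= 1 -> norm1 (T (hat a)) <= eps.

Definition sform (u v : X -> R[i]) : R[i] := inner (T (toL2 mu u)) (toL2 mu v).

Definition L2pair (p : V) := L2fun mu p.1 /\ L2fun mu p.2.

(** These families are the unit ball of L^oo with values in l2; Grothendieck's
    inequality compares a form on it with the same form on the scalar unit ball. *)
Definition l2_family (s : seq V) :=
  (forall p, p \in s -> cmeasurable p.1 /\ cmeasurable p.2) /\
  forall x, \sum_(p <- s) normc (p.1 x) ^+ 2 <= 1 /\
            \sum_(p <- s) normc (p.2 x) ^+ 2 <= 1.

Lemma le_sum_mem (I : eqType) (s : seq I) (F : I -> R) (i : I) :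
  (forall i, 0 <= F i) -> i \in s -> F i <= \sum_(j <- s) F j.
Proof. by move=> F0 si; rewrite (big_rem i)//= lerDl sumr_ge0. Qed.

Lemma l2_family_L2 s : l2_family s -> forall p, p \in s -> L2pair p.
Proof.
move=> [ms hs] p ps; have [m1 m2] := ms p ps.
split; apply: (@L2fun_bounded _ _ _ _ _ 1) => // x; have [h1 h2] := hs x.
- rewrite -(@ler_pXn2r _ 2) ?nnegrE ?normc_ge0// expr1n; apply: le_trans h1.
  by apply: (le_sum_mem (F := fun p : V => normc (p.1 x) ^+ 2)) => // q; exact: sqr_ge0.
- rewrite -(@ler_pXn2r _ 2) ?nnegrE ?normc_ge0// expr1n; apply: le_trans h2.
  by apply: (le_sum_mem (F := fun p : V => normc (p.2 x) ^+ 2)) => // q; exact: sqr_ge0.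
Qed.

Lemma L2funB (u v : X -> R[i]) : L2fun mu u -> L2fun mu v ->
  L2fun mu (fun x => u x - v x).
Proof.
move=> hu hv; have := L2funD hu (L2funZ (-1) hv); congr L2fun.
by apply/funext => x; rewrite mulN1r.
Qed.

Lemma toL2B (u v : X -> R[i]) : L2fun mu u -> L2fun mu v ->
  toL2 mu (fun x => u x - v x) = toL2 mu u - toL2 mu v.
Proof.
move=> hu hv; rewrite -scaleN1r -toL2Z// -toL2D//; last exact: L2funZ.
by congr toLp; apply/funext => x; rewrite mulN1r.
Qed.

Lemma sformDl u u' v : L2fun mu u -> L2fun mu u' ->
  sform (fun x => u x + u' x) v = sform u v + sform u' v.
Proof. by move=> hu hu'; rewrite /sform toL2D// (linD _ _ hT.1) innerDl. Qed.

Lemma sformBl u u' v : L2fun mu u -> L2fun mu u' ->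
  sform (fun x => u x - u' x) v = sform u v - sform u' v.
Proof. by move=> hu hu'; rewrite /sform toL2B// (linB _ _ hT.1) innerBl. Qed.

Lemma sformDr u v v' : L2fun mu v -> L2fun mu v' ->
  sform u (fun x => v x + v' x) = sform u v + sform u v'.
Proof. by move=> hu hu'; rewrite /sform toL2D// innerDr. Qed.

Lemma sformBr u v v' : L2fun mu v -> L2fun mu v' ->
  sform u (fun x => v x - v' x) = sform u v - sform u v'.
Proof. by move=> hu hu'; rewrite /sform toL2B// innerBr. Qed.

Lemma sformZ (a b : R) u v : L2fun mu u -> L2fun mu v ->
  sform (fun x => a%:C%C * u x) (fun x => b%:C%C * v x) = (a * b)%:C%C * sform u v.
Proof.
move=> hu hv; rewrite /sform !toL2Z// (linZ _ _ hT.1) innerZl innerZr conjcR.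
by rewrite mulrA -realcM.
Qed.

Lemma normc_sform u v : L2fun mu u -> L2fun mu v -> normc (sform u v) <=
  c * (\int[mu]_x (normc (u x) ^+ 2) + \int[mu]_x (normc (v x) ^+ 2)).
Proof.
move=> hu hv; apply: le_trans (inner_CS _ _) _.
rewrite -!norm2_toL2//; set a := norm2 (toL2 mu u); set b := norm2 (toL2 mu v).
apply: (@le_trans _ _ (c * a * b)); first by rewrite ler_wpM2r ?norm2_ge0//; exact: hT.2.
rewrite -mulrA ler_wpM2l//.
have := sqr_ge0 (a - b); have := sqr_ge0 a; have := sqr_ge0 b; nra.
Qed.

Lemma normc_sform_bounded u v : cmeasurable u -> cmeasurable v ->
  (forall x, normc (u x) <= 8) -> (forall x, normc (v x) <= 8) ->
  normc (sform u v) <= 64 * eps.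
Proof.
move=> um mv u8 v8; have hu := L2fun_bounded mu um u8; have hv := L2fun_bounded mu mv v8.
pose w x := (8^-1 : R)%:C%C * u x.
have mw : cmeasurable w by apply: cmeasM => //; exact: cmeas_cst.
have w1 : {ae mu, forall x, normc (w x) <= 1}.
  apply: nearW => x; rewrite normcM normc_real ger0_norm ?invr_ge0//.
  by rewrite mulrC ler_pdivrMr// mul1r.
have hw := toLooE mw w1.
have uE : toL2 mu u = 8%:C%C *: hat (toLoo mu w).
  apply/cLp_eqP; have h1 := cLp_scaleE (8 : R)%:C%C (hat (toLoo mu w)).
  apply: filterS2 (filterI (toL2E hu) hw) (filterI h1 (hat_ae (toLoo mu w))).
  move=> x [-> e1] [e2 e3]; rewrite -[RHS]/(cLp_scale _ _ x) e2 e3 e1 /w.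
  by rewrite mulrA -realcM divff ?mul1r.
have a1 : normoo (toLoo mu w) <= 1 by exact: normoo_le mw w1 hw.
rewrite /sform uE (linZ _ _ hT.1) innerZl normcM normc_real ger0_norm//.
rewrite (_ : 64 * eps = 8 * (8 * eps)); last by rewrite mulrA -natrM.
rewrite ler_wpM2l//; apply: le_trans (normc_cintegral_le (inner_cint _ _)) _.
have [_ iT] := L2_cint (T (hat (toLoo mu w))).
apply: (@le_trans _ _ (8 * norm1 (T (hat (toLoo mu w))))); last first.
  by rewrite ler_wpM2l// oo1.
rewrite /norm1 -RintZ//.
have mI : cmeasurable (fun x => T (hat (toLoo mu w)) x * (v x)^*%C).
  by apply: cmeas_inner.
rewrite (@Rint_ae _ _ _ _ _ (fun x => normc (T (hat (toLoo mu w)) x * (v x)^*%C))).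
- apply: Rint_le.
  + apply: intble_le (intbleZ 8 iT); first exact: meas_normc.
    move=> x; rewrite ger0_norm ?normc_ge0// normcM normc_conj mulrC.
    by rewrite ler_wpM2r ?normc_ge0.
  + exact: intbleZ.
  + by move=> x; rewrite normcM normc_conj mulrC ler_wpM2r ?normc_ge0.
- by apply: meas_normc; exact: cmeas_inner.
- exact: meas_normc.
- by apply: filterS (toL2E hv) => x ->.
Qed.

Let Gset := [set r | exists2 s, l2_family s & r = normc (\sum_(p <- s) sform p.1 p.2)].

Lemma Gset_bounded r : Gset r -> r <= c * (1 + 1).
Proof.
move=> [s hs ->]; have hL := l2_family_L2 hs.
pose I1 (p : V) := \int[mu]_x (normc (p.1 x) ^+ 2).
pose I2 (p : V) := \int[mu]_x (normc (p.2 x) ^+ 2).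
have sumI (J : V -> X -> R) (t : seq V) : (forall p, p \in t -> intble mu (J p)) ->
    intble mu (fun x => \sum_(p <- t) J p x) /\
    \sum_(p <- t) \int[mu]_x J p x = \int[mu]_x (\sum_(p <- t) J p x).
  elim: t => [|p t ih] ht.
    split; first by under eq_fun do rewrite big_nil; exact: intble_cst.
    by rewrite big_nil; under eq_Rintegral do rewrite big_nil; rewrite Rint_cst.
  have [i1 e1] : _ /\ _ := ih (fun q qt => ht q (mem_behead (s := p :: t) qt)).
  have ip : intble mu (J p) by apply: ht; rewrite inE eqxx.
  split; first by under eq_fun do rewrite big_cons; exact: intbleD.
  rewrite big_cons e1 -RintD//.
  by apply: eq_Rintegral => x _; rewrite big_cons.
have [i1 e1] := sumI (fun p x => normc (p.1 x) ^+ 2) s (fun p ps => (hL p ps).1.2).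
have [i2 e2] := sumI (fun p x => normc (p.2 x) ^+ 2) s (fun p ps => (hL p ps).2.2).
have s1 : \sum_(p <- s) I1 p <= 1.
  rewrite e1 -[leRHS](Rint_cst mu); apply: Rint_le => //; first exact: intble_cst.
  by move=> x; case: (hs.2 x).
have s2 : \sum_(p <- s) I2 p <= 1.
  rewrite e2 -[leRHS](Rint_cst mu); apply: Rint_le => //; first exact: intble_cst.
  by move=> x; case: (hs.2 x).
apply: (@le_trans _ _ (c * (\sum_(p <- s) I1 p + \sum_(p <- s) I2 p))); last first.
  by rewrite ler_wpM2l// lerD.
rewrite -big_split /=; move: hL.
elim: (s) => [|p s' ih] hL; first by rewrite !big_nil normc0 mulr0.
rewrite !big_cons; apply: le_trans (le_normcD _ _) _; rewrite mulrDr lerD//.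
  by have [h1 h2] := hL p (mem_head _ _); exact: normc_sform.
by apply: ih => q qs; apply: hL; rewrite inE qs orbT.
Qed.

Lemma normc_sum (I : Type) (s : seq I) (F : I -> R[i]) :
  normc (\sum_(i <- s) F i) <= \sum_(i <- s) normc (F i).
Proof.
elim: s => [|i s ih]; first by rewrite !big_nil normc0.
by rewrite !big_cons (le_trans (le_normcD _ _))// lerD2l.
Qed.

(** Replace the sum over the family by an average over signs of
    [sform g h], where [g] and [h] are signed sums, and truncate [g] and [h]: the
    truncated part is controlled by the (oo,1)-norm, and by Khinchine's inequality
    the remainders form families again after multiplication by [4], so that they
    are absorbed by half of the supremum. The constant does not depend on the norm
    of [T] on L2, which matters since [T] will be a difference [T - K] with no
    control on the norm of [K]. *)
Theorem grothendieck s : l2_family s ->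
  normc (\sum_(p <- s) sform p.1 p.2) <= 128 * eps.
Proof.
have hG : has_sup Gset.
  split; last by exists (c * (1 + 1)); exact: Gset_bounded.
  exists (normc (\sum_(p <- [::] : seq V) sform p.1 p.2)), [::] => //.
  by split=> // x; rewrite !big_nil.
pose G := sup Gset.
have leG t : l2_family t -> normc (\sum_(p <- t) sform p.1 p.2) <= G.
  by move=> ht; apply: ub_le_sup; [case: hG|exists t].
suff step t : l2_family t ->
    normc (\sum_(p <- t) sform p.1 p.2) <= 64 * eps + G / 2.
  have : G <= 64 * eps + G / 2.
    by apply: ge_sup; [case: hG|move=> _ [t ht ->]; exact: step].
  by move=> h hs; apply: le_trans (leG s hs) _; lra.
move: s => _ ht; have hL := l2_family_L2 ht.
pose N : R := (2 ^ size t)%:R.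
have N0 : 0 < N by rewrite ltr0n expn_gt0.
pose r : R := (Num.sqrt N)^-1.
have r0 : 0 <= r by rewrite invr_ge0 sqrtr_ge0.
have r2 : r ^+ 2 = N^-1 by rewrite exprVn sqr_sqrtr ?(ltW N0).
have D0 : L2pair 0.
  by split; apply: (@L2fun_bounded _ _ _ _ _ 0); try exact: cmeas_cst;
    move=> x; rewrite normc0.
have DD p q : L2pair p -> L2pair q -> L2pair (p + q).
  by move=> [p1 p2] [q1 q2]; split; exact: L2funD.
have DB p q : L2pair p -> L2pair q -> L2pair (p - q).
  by move=> [p1 p2] [q1 q2]; split; exact: L2funB.
have qD q : q \in signs t -> L2pair q by exact: (signs_in D0 DD DB hL).
have avg : \sum_(q <- signs t) sform q.1 q.2 = N%:C%C * \sum_(p <- t) sform p.1 p.2.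
  rewrite (signs_quad D0 DD DB _ _ hL (Q := fun p => sform p.1 p.2)).
  - by rewrite -mulr_natl; congr (_ * _); rewrite /N rmorph_nat.
  - have := sformBl (0 : V).2 D0.1 D0.1; rewrite subrr => <-.
    by congr sform; apply/funext => x; rewrite subrr.
  - move=> p q [p1 p2] [q1 q2].
    rewrite -[(q + p).1]/(fun x => q.1 x + p.1 x) -[(q + p).2]/(fun x => q.2 x + p.2 x).
    rewrite -[(q - p).1]/(fun x => q.1 x - p.1 x) -[(q - p).2]/(fun x => q.2 x - p.2 x).
    rewrite (sformDl _ q1 p1) (sformBl _ q1 p1) !(sformDr _ q2 p2).
    by rewrite !(sformBr _ q2 p2) !mulr2n; ring.
have evs (i : V -> X -> R[i]) x : i 0 x = 0 ->
    (forall p q, i (p + q) x = i p x + i q x) ->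
    (forall p q, i (p - q) x = i p x - i q x) ->
    \sum_(p <- t) normc (i p x) ^+ 2 <= 1 ->
    \sum_(q <- signs t) normc (i q x) ^+ 2 <= N /\
    \sum_(q <- signs t) normc (i q x) ^+ 4 <= 3 * N.
  move=> i0 iD iB hS.
  have hm : signs [seq i p x | p <- t] = [seq i q x | q <- signs t].
    exact: signs_map.
  have := signs_sqr [seq i p x | p <- t]; have := signs_fourth [seq i p x | p <- t].
  rewrite hm !big_map size_map -/N => h4 h2; rewrite h2; split.
    by rewrite ler_piMr// ltW.
  apply: le_trans h4 _; rewrite ler_piMr ?mulr_ge0 ?(ltW N0)//.
  by rewrite exprn_ile1// sumr_ge0// => p _; exact: sqr_ge0.
have ev1 x := evs (fun p => p.1) x erefl (fun _ _ => erefl) (fun _ _ => erefl) (ht.2 x).1.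
have ev2 x := evs (fun p => p.2) x erefl (fun _ _ => erefl) (fun _ _ => erefl) (ht.2 x).2.
have L2lo (u : X -> R[i]) : L2fun mu u -> L2fun mu (fun x => lo (u x)).
  by move=> hu; apply: (L2fun_le (cmeas_lo hu.1) _ hu) => x; exact: normc_lo_le.
have L2hi (u : X -> R[i]) : L2fun mu u -> L2fun mu (fun x => u x - lo (u x)).
  by move=> hu; apply: L2funB => //; exact: L2lo.
(* Rescaled by the factor r = N^(-1/2), the signed sums form a family again; if there
   is room for scaling its two sides up by a and b, the estimate gains a * b. *)
have fam (a b : R) (f g : (X -> R[i]) -> X -> R[i]) : 0 <= a -> 0 <= b ->
    (forall q, q \in signs t -> L2fun mu (f q.1) /\ L2fun mu (g q.2)) ->
    (forall x, a ^+ 2 * \sum_(q <- signs t) normc (f q.1 x) ^+ 2 <= N) ->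
    (forall x, b ^+ 2 * \sum_(q <- signs t) normc (g q.2 x) ^+ 2 <= N) ->
    a * b * normc (\sum_(q <- signs t) sform (f q.1) (g q.2)) <= N * G.
  move=> a0 b0 hfg hf hg.
  pose sc (q : V) : V := (fun x => (r * a)%:C%C * f q.1 x, fun x => (r * b)%:C%C * g q.2 x).
  have hsc : l2_family [seq sc q | q <- signs t].
    split=> [p /mapP[q qs ->]|x].
      have [h1 h2] := hfg q qs.
      by split; apply: cmeasM; [exact: cmeas_cst|exact: h1.1|exact: cmeas_cst|exact: h2.1].
    rewrite !big_map /=; split.
    - under eq_bigr do rewrite normcM exprMn normc_real real_normK ?num_real//.
      by rewrite -mulr_sumr exprMn r2 -mulrA mulrC ler_pdivrMr// mul1r.
    - under eq_bigr do rewrite normcM exprMn normc_real real_normK ?num_real//.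
      by rewrite -mulr_sumr exprMn r2 -mulrA mulrC ler_pdivrMr// mul1r.
  have := leG _ hsc; rewrite big_map /=.
  have -> : \sum_(q <- signs t) sform (fun x => (r * a)%:C%C * f q.1 x)
       (fun x => (r * b)%:C%C * g q.2 x) =
     (r * a * (r * b))%:C%C * \sum_(q <- signs t) sform (f q.1) (g q.2).
    rewrite mulr_sumr; apply: eq_big_seq => q qs.
    by have [h1 h2] := hfg q qs; exact: sformZ.
  rewrite normcM normc_real ger0_norm ?mulr_ge0//.
  rewrite (_ : r * a * (r * b) = r ^+ 2 * (a * b)); last by ring.
  by rewrite r2 => h; rewrite -ler_pdivrMl// mulrA; exact: h.
have split3 q : q \in signs t -> sform q.1 q.2 =
    sform (fun x => lo (q.1 x)) (fun x => lo (q.2 x)) +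
    sform (fun x => q.1 x - lo (q.1 x)) q.2 +
    sform (fun x => lo (q.1 x)) (fun x => q.2 x - lo (q.2 x)).
  move=> /qD[q1 q2]; rewrite (sformBl _ q1 (L2lo _ q1)) (sformBr _ q2 (L2lo _ q2)).
  ring.
have hi_small (i : V -> X -> R[i]) x :
    \sum_(q <- signs t) normc (i q x) ^+ 4 <= 3 * N ->
    4 ^+ 2 * \sum_(q <- signs t) normc (i q x - lo (i q x)) ^+ 2 <= N.
  move=> h; have : \sum_(q <- signs t) (64 * normc (i q x - lo (i q x)) ^+ 2) <= 3 * N.
    by apply: le_trans h; apply: ler_sum => q _; exact: normc_hi.
  by rewrite -mulr_sumr; move: N0; lra.
have lo_small (i : V -> X -> R[i]) x :
    \sum_(q <- signs t) normc (i q x) ^+ 2 <= N ->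
    1 ^+ 2 * \sum_(q <- signs t) normc (lo (i q x)) ^+ 2 <= N.
  move=> h; rewrite expr1n mul1r; apply: le_trans h; apply: ler_sum => q _.
  by rewrite lerXn2r ?nnegrE ?normc_ge0//; exact: normc_lo_le.
have f1 := @fam 4 1 (fun u x => u x - lo (u x)) id (ler0n _ 4) ler01.
have f2 := @fam 1 4 (fun u x => lo (u x)) (fun u x => u x - lo (u x)) ler01 (ler0n _ 4).
have {}f1 : 4 * normc (\sum_(q <- signs t) sform (fun x => q.1 x - lo (q.1 x)) q.2) <= N * G.
  rewrite -[X in X * _]mulr1; apply: f1.
  - by move=> q /qD[q1 q2]; split=> //; exact: L2hi.
  - by move=> x; apply: (hi_small (fun p => p.1)); case: (ev1 x).
  - by move=> x; rewrite expr1n mul1r; case: (ev2 x).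
have {}f2 : 4 * normc (\sum_(q <- signs t)
    sform (fun x => lo (q.1 x)) (fun x => q.2 x - lo (q.2 x))) <= N * G.
  rewrite -[X in X * _]mul1r; apply: f2.
  - by move=> q /qD[q1 q2]; split; [exact: L2lo|exact: L2hi].
  - by move=> x; apply: (lo_small (fun p => p.1)); case: (ev1 x).
  - by move=> x; apply: (hi_small (fun p => p.2)); case: (ev2 x).
have f0 : normc (\sum_(q <- signs t)
    sform (fun x => lo (q.1 x)) (fun x => lo (q.2 x))) <= N * (64 * eps).
  apply: le_trans (normc_sum _ _) _.
  rewrite (_ : N * _ = \sum_(q <- signs t) 64 * eps); last first.
    by rewrite big_const_seq count_predT size_signs iter_addr addr0 /N mulr_natl.
  rewrite big_seq [leRHS]big_seq; apply: ler_sum => q /qD[q1 q2].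
  apply: normc_sform_bounded.
  - exact: cmeas_lo q1.1.
  - exact: cmeas_lo q2.1.
  - by move=> x; exact: normc_lo.
  - by move=> x; exact: normc_lo.
rewrite -(ler_pM2l N0).
have -> : N * normc (\sum_(p <- t) sform p.1 p.2) =
    normc (\sum_(q <- signs t) sform q.1 q.2).
  by rewrite avg normcM normc_real ger0_norm// ltW.
rewrite (eq_big_seq _ split3) !big_split /=.
apply: le_trans (le_normcD _ _) _; apply: le_trans (lerD (le_normcD _ _) (lexx _)) _.
by move: f0 f1 f2; lra.
Qed.

End Grothendieck.

(** * Central states with diffuse marginal vanish on Koo1 *)

Lemma small_measure_sqr (R : realType) d (X : measurableType d)
    (mu : probability X R) (w : X -> R) (c : R) :
  intble mu w -> (forall x, 0 <= w x) -> \int[mu]_x w x <= c ->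
  measurable [set x | 2^-1 < w x] /\ fine (mu [set x | 2^-1 < w x]) <= 2 * c.
Proof.
move=> iw w0 wc; have mA : measurable [set x | 2^-1 < w x].
  rewrite (_ : [set x | _] = w @^-1` `]2^-1, +oo[).
    by rewrite -[X in measurable X]setTI; exact: (intble_meas iw).
  by apply/seteqP; split => x /=; rewrite in_itv /= andbT.
split=> //; rewrite -Rint_indic//; apply: (@le_trans _ _ (\int[mu]_x (2 * w x))).
  apply: Rint_le.
  - apply: (@intble_bounded _ _ _ _ _ 1); first exact: measurable_indic.
    by move=> x; rewrite indicE; case: (_ \in _); rewrite ?normr0 ?normr1.
  - exact: intbleZ.
  move=> x; rewrite indicE; have [xA|_] := boolP (x \in _).
    by move: (set_mem xA) => /=; lra.
  by rewrite mulr_ge0.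
by rewrite RintZ// ler_wpM2l.
Qed.

Section LargeCorner.
Context (R : realType) d (X : measurableType d) (mu : probability X R).
Local Notation H := (L2 mu).
Variables (T : H -> H) (c eps : R).
Hypotheses (c0 : 0 <= c) (hT : bounded_by T c).
Hypothesis oo1 : forall a : Loo mu, normoo a <= 1 -> norm1 (T (hat a)) <= eps.
Variable delta : R.
Hypothesis delta0 : 0 < delta.

Let m (u : X -> R[i]) : R := \int[mu]_x normc (u x) ^+ 2.

Let bad (u : X -> R[i]) := delta * m u <= normc (sform T u u).

Let P (s : seq (X -> R[i])) :=
  (forall u, u \in s -> cmeasurable u /\ bad u) /\
  forall x, \sum_(u <- s) normc (u x) ^+ 2 <= 1.

Let m_ge0 u : 0 <= m u.
Proof. by apply: Rint_ge0 => x; exact: sqr_ge0. Qed.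

Let P_L2 s : P s -> forall u, u \in s -> L2fun mu u.
Proof.
move=> [ms hs] u us; have [um _] := ms u us.
apply: (@L2fun_bounded _ _ _ _ _ 1) => // x.
rewrite -(@ler_pXn2r _ 2) ?nnegrE ?normc_ge0// expr1n; apply: le_trans (hs x).
by apply: (le_sum_mem (F := fun u : X -> R[i] => normc (u x) ^+ 2)) => // q; exact: sqr_ge0.
Qed.

(* Apply Grothendieck's inequality to the pairs (u, z u), where z is the phase of
   [sform T u u]. *)
Let P_mass s : P s -> \sum_(u <- s) m u <= 128 * eps / delta.
Proof.
move=> Ps; have hL := P_L2 Ps; rewrite ler_pdivlMr// mulrC mulr_sumr.
pose z u := phase (sform T u u).
have z1 u : normc (z u) <= 1 by exact: normc_phase_le1.
have fam : l2_family [seq (u, (fun x => z u * u x)) | u <- s].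
  split=> [_ /mapP[u us ->] /=|x].
    have [um _] := Ps.1 u us; split=> //.
    by apply: cmeasM => //; exact: cmeas_cst.
  rewrite !big_map /=; split; first exact: Ps.2.
  apply: le_trans (Ps.2 x); apply: ler_sum => u _.
  by rewrite normcM lerXn2r ?nnegrE ?mulr_ge0 ?normc_ge0// ler_piMl ?normc_ge0.
have := grothendieck c0 hT oo1 fam; rewrite big_map /=.
have -> : \sum_(u <- s) sform T u (fun x => z u * u x) =
    (\sum_(u <- s) normc (sform T u u))%:C%C.
  rewrite (big_morph (real_complex R) (@realcD R) (erefl _)).
  apply: eq_big_seq => u us; rewrite /sform toL2Z; last exact: hL.
  by rewrite innerZr mulrC mul_phaseJ.
rewrite normc_real ger0_norm; last by apply: sumr_ge0 => u _; exact: normc_ge0.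
apply: le_trans; rewrite big_seq [leRHS]big_seq; apply: ler_sum => u us.
by have [] := Ps.1 u us.
Qed.

(* Remove the bound on the sup norm by scaling. *)
Let diag_bounded (A : set X) : measurable A ->
  (forall u, cmeasurable u -> (forall x, normc (u x) ^+ 2 <= 2^-1) ->
     (forall x, ~ A x -> u x = 0) -> normc (sform T u u) <= delta * m u) ->
  forall u, cmeasurable u -> (exists N : R, forall x, normc (u x) <= N) ->
    (forall x, ~ A x -> u x = 0) -> normc (sform T u u) <= delta * m u.
Proof.
move=> mA h u um [N uN] uA; pose t := (2 * (`|N| + 1))^-1.
have t0 : 0 < t by rewrite invr_gt0 mulr_gt0// ltr_wpDl.
have hu := L2fun_bounded mu um uN.
have := h (fun x => t%:C%C * u x).
have -> : m (fun x => t%:C%C * u x) = t ^+ 2 * m u.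
  rewrite /m -RintZ; last by case: hu.
  apply: eq_Rintegral => x _.
  by rewrite normcM exprMn normc_real real_normK// num_real.
rewrite (sformZ hT)// normcM normc_real ger0_norm; last by rewrite mulr_ge0// ltW.
rewrite -expr2 mulrCA ler_pM2l ?exprn_gt0//; apply.
- by apply: cmeasM => //; exact: cmeas_cst.
- move=> x; rewrite normcM normc_real ger0_norm ?(ltW t0)//.
  apply: (@le_trans _ _ (2^-1 ^+ 2)); last by rewrite expr2; lra.
  rewrite lerXn2r ?nnegrE ?mulr_ge0 ?normc_ge0 ?(ltW t0)// /t.
  rewrite invfM -mulrA ler_piMr// mulrC ler_pdivrMr ?ltr_wpDl// mul1r.
  by apply: le_trans (uN x) _; rewrite (le_trans (ler_norm _))// lerDl.
- by move=> x nA; rewrite uA// mulr0.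
Qed.

(* Remove boundedness by density. *)
Let diag_all (A : set X) : measurable A ->
  (forall u, cmeasurable u -> (exists N : R, forall x, normc (u x) <= N) ->
    (forall x, ~ A x -> u x = 0) -> normc (sform T u u) <= delta * m u) ->
  forall f, normc (inner (T (lmul (indicator mu A) f)) (lmul (indicator mu A) f))
    <= delta * norm2 (lmul (indicator mu A) f) ^+ 2.
Proof.
move=> mA h f; set g := lmul (indicator mu A) f.
suff key (e : R) : 0 < e -> e <= 1 -> normc (inner (T g) g) <=
    delta * norm2 g ^+ 2 + e * (c * (2 * norm2 g + 1)).
  apply/ler_addgt0Pr => e e0; pose K := c * (2 * norm2 g + 1) + 1.
  have K0 : 0 < K by rewrite ltr_wpDl// mulr_ge0// addr_ge0// mulr_ge0 ?norm2_ge0.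
  have e1 : 0 < Num.min 1 (e / K) by rewrite lt_min ltr01 divr_gt0.
  have := key _ e1; rewrite ge_min lexx => /(_ isT) hk; apply: le_trans hk _.
  rewrite lerD2l; apply: (@le_trans _ _ (e / K * K)); last by rewrite divfK ?lt0r_neq0.
  apply: ler_pM; [exact: ltW|by rewrite mulr_ge0// addr_ge0// mulr_ge0 ?norm2_ge0| |].
    by rewrite ge_min lexx orbT.
  by rewrite /K lerDl.
move=> e0 e1; have [u [um [N uN] ug gu]] := dense_bounded g e0.
pose v x := (\1_A x : R)%:C%C * u x.
have mv : cmeasurable v by apply: cmeasM => //; exact: cmeas_indic.
have vu x : normc (v x) <= normc (u x).
  rewrite /v normcM normc_real ler_piMl ?normc_ge0// indicE.
  by case: (_ \in _); rewrite ?normr0 ?normr1.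
have vN x : normc (v x) <= N by exact: le_trans (vu x) (uN x).
have hv := L2fun_bounded mu mv vN; have hu := L2fun_bounded mu um uN.
have uv : toL2 mu u = toL2 mu v.
  apply: toL2_eq => //; apply: filterS (proj_ae f mA) => x; rewrite -/g => gx.
  rewrite /v indicE; have [xA|xA] := boolP (x \in A); first by rewrite mul1r.
  rewrite mul0r; apply/eq0_normc/eqP; rewrite eq_le normc_ge0 andbT.
  by apply: le_trans (ug x) _; rewrite gx indicE (negbTE xA) mul0r normc0.
set k := toL2 mu v; rewrite uv -/k in gu.
have hk : normc (inner (T k) k) <= delta * norm2 k ^+ 2.
  rewrite /k norm2_toL2//; apply: h => //; first by exists N.
  by move=> x nA; rewrite /v indicE memNset// mul0r.
have kg : norm2 k ^+ 2 <= norm2 g ^+ 2.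
  rewrite /k norm2_toL2// norm2_sqrE; apply: Rint_le; [by case: hv|by case: (L2P g)|].
  by move=> x; rewrite lerXn2r ?nnegrE ?normc_ge0// (le_trans (vu x)).
have kg' : norm2 k <= norm2 g by rewrite -(@ler_pXn2r _ 2) ?nnegrE ?norm2_ge0.
have -> : inner (T g) g = inner (T k) k + inner (T k) (g - k) + inner (T (g - k)) g.
  by rewrite innerBr (linB _ _ hT.1) innerBl; ring.
have b1 : normc (inner (T k) (g - k)) <= c * norm2 g * e.
  apply: le_trans (inner_CS _ _) _; apply: ler_pM; rewrite ?norm2_ge0 ?(ltW gu)//.
  by apply: le_trans (hT.2 k) _; rewrite ler_wpM2l.
have b2 : normc (inner (T (g - k)) g) <= c * e * norm2 g.
  apply: le_trans (inner_CS _ _) _; rewrite ler_wpM2r ?norm2_ge0//.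
  by apply: le_trans (hT.2 _) _; rewrite ler_wpM2l// ltW.
apply: le_trans (le_normcD _ _) _; apply: le_trans (lerD (le_normcD _ _) (lexx _)) _.
have b3 : delta * norm2 k ^+ 2 <= delta * norm2 g ^+ 2 by rewrite ler_pM2l.
have ce : 0 <= c * e by rewrite mulr_ge0// ltW.
by lra.
Qed.

(** Exhaust the vectors on which the numerical range of [T] is large by a
    maximal pointwise l2-bounded family; outside the small set where this family
    has used up half of its room, no such vector is left. *)
Lemma large_corner : exists A : set X, [/\ measurable A,
  fine (mu (~` A)) <= 2 * (128 * eps / delta) &
  forall f, normc (inner (T (lmul (indicator mu A) f)) (lmul (indicator mu A) f))
    <= delta * norm2 (lmul (indicator mu A) f) ^+ 2].
Proof.
have P0 : P [::] by split=> // x; rewrite big_nil.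
have [s [Ps ext max]] := exhaustion m_ge0 P0 P_mass.
pose w n x : R := \sum_(u <- s n) normc (u x) ^+ 2.
pose W n := [set x | 2^-1 < w n x].
have hw n : intble mu (w n) /\ \int[mu]_x w n x = \sum_(u <- s n) m u.
  rewrite /w; elim: (s n) (P_L2 (Ps n)) => [|u t ih] ht.
    split; first by under eq_fun do rewrite big_nil; exact: intble_cst.
    by rewrite big_nil; under eq_Rintegral do rewrite big_nil; rewrite Rint_cst.
  have [i1 e1] : _ /\ _ := ih (fun q qt => ht q (mem_behead (s := u :: t) qt)).
  have [_ iu] := ht u (mem_head _ _).
  split; first by under eq_fun do rewrite big_cons; exact: intbleD.
  rewrite big_cons -e1 -RintD//.
  by apply: eq_Rintegral => x _; rewrite big_cons.
have w0 n x : 0 <= w n x by apply: sumr_ge0 => u _; exact: sqr_ge0.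
have hW n : measurable (W n) /\ fine (mu (W n)) <= 2 * (128 * eps / delta).
  have [iw ew] := hw n; apply: small_measure_sqr => //.
  by rewrite ew; exact: P_mass.
have mW n : measurable (W n) by case: (hW n).
have wincr n m' x : (n <= m')%N -> w n x <= w m' x.
  elim: m' => [|k ih]; first by rewrite leqn0 => /eqP ->.
  rewrite leq_eqVlt => /orP[/eqP -> //|]; rewrite ltnS => /ih h.
  apply: le_trans h _; rewrite /w; have [u ->] := ext k.
  by rewrite big_cat /= lerDr sumr_ge0// => q _; exact: sqr_ge0.
pose A := ~` \bigcup_n W n.
have mA : measurable A by apply: measurableC; exact: bigcup_measurable.
exists A; split=> //.
  rewrite /A setCK.
  have cv : (mu \o W) @ \oo --> mu (\bigcup_n W n).
    apply: nondecreasing_cvg_mu => //; first exact: bigcup_measurable.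
    move=> n k nk; apply/subsetPset => x; rewrite /W /= => h.
    exact: lt_le_trans h (wincr n k x nk).
  have fin : mu (\bigcup_n W n) = (fine (mu (\bigcup_n W n)))%:E.
    by rewrite fineK// fin_num_measure//; exact: bigcup_measurable.
  rewrite fin in cv.
  have cv' : (fun n => fine (mu (W n))) @ \oo --> fine (mu (\bigcup_n W n)).
    exact: fine_cvg cv.
  apply: (cvgr_to_le cv'); apply: nearW => n; by case: (hW n).
apply: diag_all => //; apply: diag_bounded => // u um u1 uA.
rewrite leNgt; apply/negP => h.
have hu : L2fun mu u.
  apply: (@L2fun_bounded _ _ _ _ _ 1) => // x.
  rewrite -(@ler_pXn2r _ 2) ?nnegrE ?normc_ge0// expr1n.
  by apply: le_trans (u1 x) _; lra.
have m_u : m u = 0.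
  apply: max => n; have [h1 h2] := Ps n; split=> [q|x].
    by rewrite inE => /predU1P[->|/h1//]; split=> //; exact: ltW.
  rewrite big_cons; have [xW|xW] := pselect (exists k, W k x).
    rewrite uA ?normc0 ?expr0n ?add0r; first exact: h2.
    by rewrite /A /=; apply; case: xW => k ?; exists k.
  have : w n x <= 2^-1 by rewrite leNgt; apply/negP => hx; apply: xW; exists n.
  by rewrite /w; have := u1 x; lra.
move: h; rewrite m_u mulr0 /sform.
have -> : toL2 mu u = 0.
  by apply/norm2_eq0/eqP; rewrite -sqrf_eq0 norm2_toL2//; apply/eqP.
by rewrite (lin0 hT.1) inner0l normc0 ltxx.
Qed.

End LargeCorner.

Section VanishKoo1.
Context (R : realType) d (X : measurableType d) (mu : probability X R).
Hypothesis diff : diffuse mu.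
Variable phi : (L2 mu -> L2 mu) -> R[i].
Hypothesis st : state_on (@bounded_operators R (L2 mu)) phi.
Hypothesis tr : forall a : Loo mu, phi (lmul a) = tau a.
Hypothesis ce : central_on (@bounded_operators R (L2 mu)) phi.

(** Approximate [T] by a compact operator [K] in the (oo,1)-norm and cut down to the
    set [A] of [large_corner] for [T - K]. There [T - K] is small in numerical range
    and [K] is killed by [phi]; the rest is small as the complement of [A] is. *)
Lemma state_Koo1_0 (T : L2 mu -> L2 mu) : Koo1 T -> phi T = 0.
Proof.
move=> [bT hKT]; have /boundedP[c c0 hT] := bT.
suff small (e : R) : 0 < e -> normc (phi T) <= e * (1 + 256 * c).
  apply/eq0_normc/eqP; rewrite eq_le normc_ge0 andbT.
  apply/ler_addgt0Pr => e e0; rewrite add0r.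
  have c1 : 0 < 1 + 256 * c by rewrite ltr_pwDl// mulr_ge0.
  apply: le_trans (small _ (divr_gt0 e0 c1)) _.
  by rewrite divfK// lt0r_neq0.
move=> e0; have [K cK hK] := hKT (e ^+ 2) (exprn_gt0 _ e0).
have [bK _] := cK; have bS : bounded_operators (T - K) by exact: boundedB.
have /boundedP[c' c'0 hS] := bS.
have [A [mA A1 hA]] := large_corner c'0 hS (norm_oo1P hK) e0.
pose p := lmul (indicator mu A).
have bp : bounded_operators p by exact: bounded_lmul.
rewrite (state_split st mA bT) mulrDr mulr1.
apply: le_trans (le_normcD _ _) _; apply: lerD; last first.
  apply: le_trans (state_cut_le st tr ce (measurableC mA) hT bT) _.
  rewrite (_ : e * (256 * c) = c * (256 * e)); last by ring.
  rewrite ler_wpM2l//; apply: le_trans A1 _.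
  rewrite (_ : 2 * _ = 256 * e)//; field; exact: lt0r_neq0.
rewrite (state_corner ce mA bT) -/p.
have -> : p \o T \o p = (p \o (T - K) \o p) + (p \o K \o p).
  apply/funext => f; rewrite -[RHS]/(p (T (p f) - K (p f)) + p (K (p f))).
  by rewrite -(linD _ _ (lmul_is_linear (indicator mu A) : linear p)) subrK.
rewrite (stateD st); last 2 first.
- exact: bounded_corner.
- exact: bounded_corner.
have cp : compact_operators (p \o K \o p).
  have hp := lmul_by (indicator mu A).
  exact: (compact_comp (normoo_ge0 _) (normoo_ge0 _) hp hp cK).
rewrite (state_compact0 diff st tr ce cp) addr0.
apply: (state_norm st); first exact: bounded_corner.
move=> f; rewrite (inner_corner (T - K) f mA); apply: le_trans (hA f) _.
by rewrite ler_pM2l// lerXn2r ?nnegrE ?norm2_ge0//; exact: norm2_proj.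
Qed.

End VanishKoo1.

(** * Normality of the trace *)

Section TauNormal.
Context (R : realType) d (X : measurableType d) (mu : probability X R).
Implicit Types (a b : Loo mu) (D : set (Loo mu)).

Lemma oo_cint a : cint mu a.
Proof. exact: cint_L2 (L2fun_oo a). Qed.

Lemma cRe_tau a : cRe (tau a) = \int[mu]_x cRe (a x).
Proof. by []. Qed.

Lemma le_Loo_Re a b : le_Loo a b -> {ae mu, forall x, cRe (a x) <= cRe (b x)}.
Proof. by apply: filterS => x; rewrite lecE => /andP[]. Qed.

Lemma le_Loo_Im a b : le_Loo a b -> {ae mu, forall x, cIm (b x) = cIm (a x)}.
Proof. by apply: filterS => x; rewrite lecE => /andP[/eqP]. Qed.

Lemma le_Loo_trans a b c : le_Loo a b -> le_Loo b c -> le_Loo a c.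
Proof. by apply: filterS2 => x; exact: le_trans. Qed.

Lemma Rint_ae_le (f g : X -> R) : intble mu f -> intble mu g ->
  {ae mu, forall x, f x <= g x} -> \int[mu]_x f x <= \int[mu]_x g x.
Proof.
move=> hf hg fg; have mf := intble_meas hf; have mg := intble_meas hg.
rewrite (@Rint_ae _ _ _ _ f (fun x => Num.min (f x) (g x)))//.
- apply: Rint_le => //.
    apply: intble_ae hf => //; first exact: measurable_minr.
    by apply: filterS fg => x h; rewrite min_l.
  by move=> x; rewrite ge_min lexx orbT.
- exact: measurable_minr.
by apply: filterS fg => x h; rewrite min_l.
Qed.

Lemma tau_le a b : le_Loo a b -> cRe (tau a) <= cRe (tau b).
Proof.
move=> ab; rewrite !cRe_tau; apply: Rint_ae_le; last exact: le_Loo_Re.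
- exact/cint_Re/oo_cint.
- exact/cint_Re/oo_cint.
Qed.

Lemma star_Im a : star a = a -> {ae mu, forall x, cIm (a x) = 0}.
Proof.
move=> sa; apply: filterS (star_ae a) => x; rewrite sa.
by case: (a x) => p q [] /= /eqP; rewrite -addr_eq0 -mulr2n mulrn_eq0 => /eqP.
Qed.

Lemma ae_forall (P : nat -> X -> Prop) : (forall n, {ae mu, forall x, P n x}) ->
  {ae mu, forall x, forall n, P n x}.
Proof.
move=> h; have : mu.-negligible (\bigcup_n (~` [set x | P n x])).
  by apply: negligible_bigcup => n; exact: h.
move=> [N [mN N0 sN]]; exists N; split=> // x /= nP; apply: sN.
by move: nP => /existsNP[n nP]; exists n.
Qed.

(** The trace of a supremum is approximated by the traces of the members: along
    an increasing sequence whose traces exhaust the supremum of the traces, the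
    pointwise limit is an upper bound of the whole family. *)
Lemma tau_approx D b : D !=set0 -> (forall a, D a -> star a = a) ->
  (forall a1 a2, D a1 -> D a2 ->
     exists a3, [/\ D a3, le_Loo a1 a3 & le_Loo a2 a3]) ->
  is_lub (@le_Loo _ _ _ mu) D b ->
  forall e : R, 0 < e -> exists2 a, D a & cRe (tau b) - e < cRe (tau a).
Proof.
move=> [a0 Da0] sD dirD [ubD lubD].
pose m a : R := cRe (tau a).
have step n a : D a -> exists a', [/\ D a', le_Loo a a' &
    forall c, D c -> le_Loo a' c -> m c <= m a' + 2^-1 ^+ n].
  move=> Da; pose E := [set r | exists c, [/\ D c, le_Loo a c & r = m c]].
  have hE : has_sup E.
    split; first by exists (m a), a; split=> //; exact: nearW.
    by exists (m b) => _ [c [Dc _ ->]]; apply: tau_le; exact: ubD.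
  have e0 : 0 < (2^-1 : R) ^+ n by rewrite exprn_gt0.
  have [_ [a' [Da' aa' ->]] ha'] := sup_adherent e0 hE.
  exists a'; split=> // c Dc a'c.
  have : m c <= sup E.
    apply: ub_le_sup; first by case: hE.
    by exists c; split=> //; exact: le_Loo_trans aa' a'c.
  by move: ha'; lra.
have /choice[next hnext] : forall na : nat * Loo mu, exists a', D na.2 ->
    [/\ D a', le_Loo na.2 a' &
      forall c, D c -> le_Loo a' c -> m c <= m a' + 2^-1 ^+ na.1].
  move=> [n a]; have [Da|nDa] := pselect (D a); last by exists a.
  by have [a' h] := step n a Da; exists a'.
pose t := fix t n := if n is k.+1 then next (k, t k) else a0.
have Dt n : D (t n) by elim: n => [//|n ih]; have [] := hnext (n, t n) ih.
have tincr n : le_Loo (t n) (t n.+1) by have [] := hnext (n, t n) (Dt n).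
have tmax n c : D c -> le_Loo (t n.+1) c -> m c <= m (t n.+1) + 2^-1 ^+ n.
  by have [_ _] := hnext (n, t n) (Dt n); exact.
pose M := Num.max (normoo a0) (normoo b).
have good : {ae mu, forall x, (forall n, cRe (t n x) <= cRe (t n.+1 x)) /\
    ((forall n, cRe (t n x) <= cRe (b x)) /\ (normc (a0 x) <= M /\ normc (b x) <= M))}.
  apply: filterI; first by apply: ae_forall => n; exact: le_Loo_Re.
  apply: filterI; first by apply: ae_forall => n; apply: le_Loo_Re; exact: ubD.
  apply: filterI.
    by apply: filterS (ooP a0) => x h; rewrite le_max h.
  by apply: filterS (ooP b) => x h; rewrite le_max h orbT.
have [N [mN N0 sN]] := good.
pose A := ~` N; have mA : measurable A by exact: measurableC.
have goodA x : A x -> (forall n, cRe (t n x) <= cRe (t n.+1 x)) /\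
    ((forall n, cRe (t n x) <= cRe (b x)) /\ (normc (a0 x) <= M /\ normc (b x) <= M)).
  by move=> Ax; apply: contrapT => h; apply: Ax; exact: sN.
have aeA : {ae mu, forall x, A x}.
  by exists N; split=> // x /=; rewrite /A /= => /contrapT.
pose F n x : R := \1_A x * cRe (t n x).
have mRe a : measurable_fun setT (fun x => cRe (a x)) by case: (oo_meas a).
have mF n : measurable_fun setT (F n).
  by apply: measurable_funM => //; exact: measurable_indic.
have Fincr n x : F n x <= F n.+1 x.
  rewrite /F indicE; have [xA|xA] := boolP (x \in A); last by rewrite !mul0r.
  by rewrite !mul1r; have [h _] := goodA x (set_mem xA).
have Fnd x : nondecreasing_seq (fun n => F n x).
  by apply/nondecreasing_seqP => n; exact: Fincr.
have M0 : 0 <= M by rewrite le_max normoo_ge0.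
have FM n x : `|F n x| <= M.
  rewrite /F indicE; have [xA|xA] := boolP (x \in A); last by rewrite mul0r normr0.
  rewrite mul1r; have [h1 [h2 [h3 h4]]] := goodA x (set_mem xA).
  rewrite ler_norml; apply/andP; split.
    apply: (@le_trans _ _ (cRe (a0 x))).
      have := le_trans (absRe_le (a0 x)) h3.
      by rewrite ler_norml => /andP[].
    by elim: n => [//|n ih]; apply: le_trans ih (h1 n).
  apply: le_trans (h2 n) _; apply: le_trans h4.
  by apply: le_trans (absRe_le (b x)); exact: ler_norm.
have cF x : cvgn (fun n => F n x).
  apply: nondecreasing_is_cvgn => //; exists M => _ [n _ <-].
  exact: le_trans (ler_norm _) (FM n x).
pose g x : R := limn (fun n => F n x).
have mg : measurable_fun setT g.
  by apply: (@measurable_fun_cvg _ _ _ setT F g) => // x _; exact: cF.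
have Fg n x : F n x <= g x by apply: nondecreasing_cvgn_le.
have gM x : `|g x| <= M.
  rewrite ler_norml; apply/andP; split.
    by apply: le_trans (Fg 0%N x); have := FM 0%N x; rewrite ler_norml => /andP[].
  apply: limr_le; first exact: cF.
  by apply: nearW => n; exact: le_trans (ler_norm _) (FM n x).
have ig : intble mu g by exact: intble_bounded mg gM.
have iF n : intble mu (F n) by exact: intble_bounded (mF n) (FM n).
have intF n : \int[mu]_x F n x = m (t n).
  rewrite /m cRe_tau; apply: Rint_ae => //.
  by apply: filterS aeA => x Ax; rewrite /F indicE mem_set// mul1r.
have cvI : (fun n => m (t n)) @ \oo --> \int[mu]_x g x.
  have -> : (fun n => m (t n)) = (fun n => \int[mu]_x F n x).
    by apply/funext => n; rewrite intF.
  apply: (@Rint_dominated _ _ _ _ F g (fun=> M)) => //.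
  exact: intble_cst.
have iRe a : intble mu (fun x => cRe (a x)) by exact/cint_Re/oo_cint.
have upper a : D a -> {ae mu, forall x, cRe (a x) <= g x}.
  move=> Da; pose h x := Num.max (cRe (a x) - g x) 0.
  have mh : measurable_fun setT h.
    by apply: measurable_maxr => //; apply: measurable_funB.
  have h0 x : 0 <= h x by rewrite le_max lexx orbT.
  have ih : intble mu h.
    have i1 := intbleD (oo_cint a).2 (intble_cst mu M).
    apply: intble_le i1 => // x; rewrite ger0_norm// ge_max.
    rewrite addr_ge0 ?normc_ge0// andbT.
    have := gM x; rewrite ler_norml => /andP[hg _].
    by have := le_trans (ler_norm _) (absRe_le (a x)); lra.
  have hle n : \int[mu]_x h x <= 2^-1 ^+ n.
    have [c [Dc ac tc]] := dirD a (t n.+1) Da (Dt n.+1).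
    apply: (@le_trans _ _ (\int[mu]_x (cRe (c x) - F n.+1 x))).
      apply: Rint_ae_le => //; first exact: intbleB.
      apply: filterS3 aeA (le_Loo_Re ac) (le_Loo_Re tc) => x Ax acx tcx.
      rewrite ge_max; apply/andP; split; first exact: lerB.
      by rewrite /F indicE mem_set// mul1r subr_ge0.
    rewrite RintB// intF -/(m c); have := tmax n c Dc tc.
    by rewrite /m cRe_tau; lra.
  have hz : \int[mu]_x h x <= 0.
    rewrite leNgt; apply/negP => hpos; have [n hn] := exp_half_small hpos.
    by have := hle n; rewrite leNgt hn.
  apply: filterS (Rint_eq0 ih h0 hz) => x hx.
  by have : cRe (a x) - g x <= h x by [rewrite le_max lexx]; rewrite hx subr_le0.
pose u x : R[i] := (g x)%:C%C.
have um : cmeasurable u by exact: cmeas_real.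
have uM : {ae mu, forall x, normc (u x) <= M}.
  by apply: nearW => x; rewrite normc_real.
have hu := toLooE um uM.
have bG : le_Loo b (toLoo mu u).
  apply: lubD => a Da; apply: filterS3 hu (upper a Da) (star_Im (sD a Da)) => x -> h1 h2.
  by rewrite lecE h2 /= eqxx.
have mb : m b <= \int[mu]_x g x.
  apply: le_trans (tau_le bG) _; rewrite cRe_tau le_eqVlt; apply/orP; left; apply/eqP.
  by apply: Rint_ae => //; apply: filterS hu => x ->.
move=> e e0; have he : m b - e < \int[mu]_x g x by move: mb; lra.
have [n _ /(_ n (leqnn n)) hn] := cvgr_gt _ cvI _ he.
by exists (t n).
Qed.

Lemma tau_normal : normal (@tau _ _ _ mu).
Proof.
move=> D b D0 sD dirD lubD; have [ubD _] := lubD; have [a0 Da0] := D0.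
have Im0 a : {ae mu, forall x, cIm (a x) = 0} -> cIm (tau a) = 0.
  move=> h; rewrite -[LHS]/(\int[mu]_x cIm (a x)) -[RHS](Rint_cst mu).
  by apply: Rint_ae => //; case: (oo_meas a).
have ImD a : D a -> cIm (tau a) = 0 by move=> Da; apply/Im0/star_Im/sD.
have Imb : cIm (tau b) = 0.
  apply: Im0; apply: filterS2 (le_Loo_Im (ubD _ Da0)) (star_Im (sD _ Da0)).
  by move=> x -> ->.
split=> [_ [a Da <-]|c hc].
  by rewrite lecE Imb ImD// eqxx /=; exact: tau_le (ubD a Da).
have : tau a0 <= c by apply: hc; exists a0.
rewrite !lecE Imb ImD// => /andP[ic _]; apply/andP; split=> //.
apply/ler_addgt0Pr => e e0.
have [a Da ha] := tau_approx D0 sD dirD lubD e0.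
have : tau a <= c by apply: hc; exists a.
by rewrite lecE => /andP[_]; move: ha; lra.
Qed.

End TauNormal.

(** * Transferring integrals and functions along a factor map *)

Section Transfer.
Context (R : realType) d (X : measurableType d) (mu : probability X R).
Context d' (Y : measurableType d') (lam : probability Y R).
(** With [A] the whole space and [k = 1] this covers factor maps as well as the
    transformations of an action; in general [lam] is the normalisation of the
    restriction of the factor measure to an invariant set with preimage [A]. *)
Variables (pi : X -> Y) (A : set X) (k : R).
Hypotheses (mpi : measurable_fun setT pi) (mA : measurable A) (k0 : 0 < k).
Hypothesis link : forall S : set Y, measurable S ->
  fine (lam S) = k * fine (mu (pi @^-1` S `&` A)).

Let mpre (S : set Y) : measurable S -> measurable (pi @^-1` S).
Proof. by move=> mS; rewrite -[pi @^-1` S]setTI; exact: mpi. Qed.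

Lemma transfer_ge0 (g : Y -> R) : measurable_fun setT g -> (forall y, 0 <= g y) ->
  (\int[lam]_y (g y)%:E = k%:E * \int[mu]_x (\1_A x * g (pi x))%:E)%E.
Proof.
move=> mg g0.
pose kk : {nonneg R} := NngNum (ltW k0).
pose m1 := mscale kk (mrestr mu mA).
have m1E (S : set Y) : measurable S -> lam S = pushforward m1 pi S.
  move=> mS; have mI : measurable (pi @^-1` S `&` A) by apply: measurableI => //; exact: mpre.
  rewrite /pushforward /m1 /mscale /mrestr /=.
  rewrite -[LHS]fineK ?fin_num_measure// link// EFinM.
  by rewrite fineK// fin_num_measure.
have mE : measurable_fun setT (EFin \o g) by exact/measurable_EFinP.
have mEp : measurable_fun setT (EFin \o (g \o pi)).
  by apply/measurable_EFinP; exact: measurableT_comp.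
transitivity (\int[pushforward m1 pi]_y (g y)%:E)%E.
  by apply: eq_measure_integral => S mS _; exact: m1E.
rewrite ge0_integral_pushforward//; last by move=> y _; rewrite lee_fin.
rewrite preimage_setT ge0_integral_mscale//; last by move=> x _; rewrite lee_fin /=.
congr (_ * _)%E.
transitivity (\int[mrestr mu mA]_(x in A) (g (pi x))%:E)%E.
  have N0 : mrestr mu mA (~` A) = 0%E by rewrite /mrestr setICl measure0.
  rewrite (ge0_negligible_integral (measurableC mA) measurableT mEp _ N0)//.
    by rewrite setTD setCK.
  by move=> x _; rewrite lee_fin /=.
transitivity (\int[mu]_(x in A) (g (pi x))%:E)%E.
  apply: eq_measure_integral => S mS SA; exact: (congr1 mu (setIidl SA)).
rewrite integral_mkcond; apply: eq_integral => x _.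
rewrite patchE indicE; case: (_ \in _); first by rewrite mul1r.
by rewrite mul0r.
Qed.

Let pull (g : Y -> R) x : R := \1_A x * g (pi x).

Let mpull g : measurable_fun setT g -> measurable_fun setT (pull g).
Proof.
move=> mg; apply: measurable_funM; first exact: measurable_indic.
exact: measurableT_comp.
Qed.

Let abspull g x : `|pull g x| = pull (fun y => `|g y|) x.
Proof.
rewrite /pull normrM indicE; case: (_ \in _); first by rewrite normr1.
by rewrite normr0 !mul0r.
Qed.

Lemma transfer_intble (g : Y -> R) : intble lam g -> intble mu (pull g).
Proof.
move=> ig; have mg := intble_meas ig.
apply/integrableP; split; first exact/measurable_EFinP/mpull.
have mag : measurable_fun setT (fun y => `|g y|) by exact: measurableT_comp.
have e := transfer_ge0 mag (fun y => normr_ge0 _).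
move/integrableP: ig => [_].
rewrite (eq_integral (fun y => (`|g y|)%:E))// e.
have -> : (\int[mu]_x `|(EFin \o pull g) x| =
    \int[mu]_x (\1_A x * `|g (pi x)|)%:E)%E.
  by apply: eq_integral => x _ /=; congr (_%:E); exact: abspull.
move: (\int[mu]_x _)%E => I; case: I => [r _|//|//]; first exact: ltry.
by rewrite gt0_muley ?lte_fin.
Qed.

Lemma transfer_Rint (g : Y -> R) : intble lam g ->
  \int[lam]_y g y = k * \int[mu]_x pull g x.
Proof.
have ge0 (h : Y -> R) : intble lam h -> (forall y, 0 <= h y) ->
    \int[lam]_y h y = k * \int[mu]_x pull h x.
  move=> ih h0; have := transfer_ge0 (intble_meas ih) h0.
  rewrite -(Rint_EFin ih) -(Rint_EFin (transfer_intble ih)) => e.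
  by have := congr1 fine e.
move=> ig; have iabs : intble lam (fun y => `|g y|).
  by have := integrable_abse ig; rewrite /comp.
have i2 : intble lam (fun y => g y + `|g y|) by exact: intbleD.
have h1 := ge0 _ iabs (fun y => normr_ge0 _).
have h2 : \int[lam]_y (g y + `|g y|) = k * \int[mu]_x pull (fun y => g y + `|g y|) x.
  apply: ge0 => // y; have := ler_norm (- g y); rewrite normrN; lra.
rewrite RintD// h1 in h2; apply: (addIr (k * \int[mu]_x pull (fun y => `|g y|) x)).
rewrite h2 -mulrDr -RintD; last 2 first.
- exact: transfer_intble.
- exact: transfer_intble.
by congr (_ * _); apply: eq_Rintegral => x _; rewrite /pull mulrDr.
Qed.

Lemma transfer_ae (P : Y -> Prop) : {ae lam, forall y, P y} ->
  {ae mu, forall x, A x -> P (pi x)}.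
Proof.
move=> [N [mN N0 sN]]; exists (pi @^-1` N `&` A); split.
- by apply: measurableI => //; exact: mpre.
- have h := link mN; rewrite N0 /= in h.
  have /eqP := esym h; rewrite mulf_eq0 (gt_eqF k0) /= => /eqP h0.
  rewrite -[mu _]fineK ?h0// fin_num_measure//.
  by apply: measurableI => //; exact: mpre.
move=> x /= /not_implyP[Ax nP]; split=> //; exact: sN.
Qed.

Lemma transfer_cintegral (g : Y -> R[i]) : cint lam g ->
  cintegral lam g = k%:C%C * cintegral mu (fun x => (\1_A x : R)%:C%C * g (pi x)).
Proof.
move=> hg; apply/eqP; rewrite eq_complex; apply/andP; split; apply/eqP.
- rewrite cReZ /= (transfer_Rint (cint_Re hg)); congr (_ * _).
  by apply: eq_Rintegral => x _; rewrite cReZ.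
- have cImZ (a : R) z : cIm (a%:C%C * z) = a * cIm z.
    by case: z => p q /=; rewrite mul0r addr0.
  rewrite cImZ /= (transfer_Rint (cint_Im hg)); congr (_ * _).
  by apply: eq_Rintegral => x _; rewrite cImZ.
Qed.

Lemma cmeas_pull (g : Y -> R[i]) : cmeasurable g -> cmeasurable (fun x => g (pi x)).
Proof.
by move=> [gr gi]; split; [exact: (measurableT_comp gr)|exact: (measurableT_comp gi)].
Qed.

(** The factor [Num.sqrt k] makes this an isometry. When [A] is the whole space, it is
    the inclusion of the L2 space of the factor and its adjoint is the conditional
    expectation. *)
Definition pullL2 (f : L2 lam) : L2 mu :=
  toL2 mu (fun x => (Num.sqrt k * \1_A x)%:C%C * f (pi x)).

Lemma pullL2_L2 (f : L2 lam) :
  L2fun mu (fun x => (Num.sqrt k * \1_A x)%:C%C * f (pi x)).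
Proof.
have mf : cmeasurable (fun x => (Num.sqrt k * \1_A x)%:C%C * f (pi x)).
  apply: cmeasM; last by apply: cmeas_pull.
  by apply: cmeas_real; apply: measurable_funM => //; exact: measurable_indic.
split=> //; have i1 := intbleZ k (transfer_intble (L2P f).2).
apply: intble_le i1 => [|x].
  by apply: measurable_funX; exact: meas_normc.
rewrite ger0_norm ?sqr_ge0// normcM exprMn normc_real real_normK ?num_real//.
rewrite exprMn sqr_sqrtr ?(ltW k0)// /pull indicE -mulrA.
by case: (_ \in _); rewrite ?expr1n// expr0n.
Qed.

Lemma pullL2_ae f : {ae mu, forall x, pullL2 f x = (Num.sqrt k * \1_A x)%:C%C * f (pi x)}.
Proof. exact: toL2E (pullL2_L2 f). Qed.

Lemma pullL2_toL2 (u : Y -> R[i]) : L2fun lam u ->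
  {ae mu, forall x, pullL2 (toL2 lam u) x = (Num.sqrt k * \1_A x)%:C%C * u (pi x)}.
Proof.
move=> hu; apply: filterS2 (pullL2_ae (toL2 lam u)) (transfer_ae (toL2E hu)) => x -> h.
rewrite indicE; have [xA|xA] := boolP (x \in A); first by rewrite h//; exact: set_mem.
by rewrite mulr0 !mul0r.
Qed.

Lemma pullL2_linear : linear pullL2.
Proof.
move=> z f g; rewrite /pullL2 -toL2Z; last exact: pullL2_L2.
rewrite -toL2D; [|exact/L2funZ/pullL2_L2|exact: pullL2_L2].
apply: toL2_eq; [exact: pullL2_L2|by apply: L2funD; [apply: L2funZ|]; exact: pullL2_L2|].
have h : {ae lam, forall y, cLp_fun (z *: f + g) y = z * (f : L2 lam) y + (g : L2 lam) y}.
  apply: filterS2 (cLpD (z *: f) g) (cLp_scaleE z f) => y -> e.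
  by rewrite -[cLp_fun (z *: f) y]/(cLp_scale z f y) e.
apply: filterS (transfer_ae h) => x hx; rewrite indicE.
have [xA|xA] := boolP (x \in A); last by rewrite !mulr0 !mul0r mulr0 addr0.
by rewrite hx; [ring|exact: set_mem].
Qed.

Lemma inner_pullL2 f g : inner (pullL2 f) (pullL2 g) = inner f g.
Proof.
rewrite inner_toL2; [|exact: pullL2_L2..].
rewrite [RHS](transfer_cintegral (inner_cint f g)) -cintegralZ; last first.
  split.
    apply: cmeasM; first exact: cmeas_indic.
    by apply: (@cmeas_pull (fun y => f y * (g y)^*%C)); exact: cmeas_inner.
  rewrite (_ : (fun x => _) = pull (fun y => normc (f y * (g y)^*%C))).
    exact: transfer_intble (inner_cint f g).2.
  apply/funext => x; rewrite /pull normcM normc_real indicE.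
  by case: (_ \in _); rewrite ?normr1 ?normr0.
apply: eq_cintegral => x; rewrite conjcM conjcR.
have -> : k%:C%C = (Num.sqrt k)%:C%C * (Num.sqrt k)%:C%C :> R[i].
  by rewrite -realcM -expr2 sqr_sqrtr// ltW.
have ii : (\1_A x : R)%:C%C * (\1_A x : R)%:C%C = (\1_A x : R)%:C%C.
  by rewrite -realcM indicE; case: (_ \in _); rewrite ?mulr1 ?mulr0.
rewrite !realcM; move: ii; set i := (\1_A x : R)%:C%C => ii.
set s := (Num.sqrt k)%:C%C; set z := f (pi x); set w := (g (pi x))^*%C.
transitivity (s * s * (i * i) * (z * w)); first by ring.
by rewrite ii; ring.
Qed.

Lemma norm2_pullL2 f : norm2 (pullL2 f) = norm2 f.
Proof.
apply/eqP; rewrite -(@eqrXn2 _ 2) ?norm2_ge0//; apply/eqP/complexI.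
by rewrite -!inner_norm2 inner_pullL2.
Qed.

Lemma pullL2_by : bounded_by pullL2 1.
Proof. by split; [exact: pullL2_linear|move=> f; rewrite mul1r norm2_pullL2]. Qed.

Definition pulloo (a : Loo lam) : Loo mu :=
  toLoo mu (fun x => (\1_A x : R)%:C%C * a (pi x)).

Lemma cmeas_pulloo (a : Loo lam) : cmeasurable (fun x => (\1_A x : R)%:C%C * a (pi x)).
Proof.
by apply: cmeasM; [exact: cmeas_indic|apply: cmeas_pull; exact: oo_meas].
Qed.

Lemma pulloo_le (a : Loo lam) :
  {ae mu, forall x, normc ((\1_A x : R)%:C%C * a (pi x)) <= normoo a}.
Proof.
apply: filterS (transfer_ae (ooP a)) => x h; rewrite normcM normc_real indicE.
have [xA|xA] := boolP (x \in A); last by rewrite normr0 mul0r normoo_ge0.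
by rewrite normr1 mul1r h//; exact: set_mem.
Qed.

Lemma pulloo_ae (a : Loo lam) :
  {ae mu, forall x, pulloo a x = (\1_A x : R)%:C%C * a (pi x)}.
Proof. exact: toLooE (cmeas_pulloo a) (pulloo_le a). Qed.

Lemma normoo_pulloo a : normoo (pulloo a) <= normoo a.
Proof. exact: normoo_le (cmeas_pulloo a) (pulloo_le a) (pulloo_ae a). Qed.

Lemma star_pulloo a : star (pulloo a) = pulloo (star a).
Proof.
apply/cLp_eqP; apply: filterS2 (filterI (star_ae (pulloo a)) (pulloo_ae a))
  (filterI (pulloo_ae (star a)) (transfer_ae (star_ae a))) => x [-> ->] [-> h].
rewrite conjcM conjcR indicE; have [xA|xA] := boolP (x \in A); last by rewrite !mul0r.
by rewrite h//; exact: set_mem.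
Qed.

Lemma pullL2_lmul a f : pullL2 (lmul a f) = lmul (pulloo a) (pullL2 f).
Proof.
apply/cLp_eqP; apply: filterS2
  (filterI (pullL2_ae (lmul a f)) (transfer_ae (lmul_ae a f)))
  (filterI (lmul_ae (pulloo a) (pullL2 f)) (filterI (pulloo_ae a) (pullL2_ae f))).
move=> x [-> h] [-> [-> ->]]; rewrite indicE.
have [xA|xA] := boolP (x \in A); last by rewrite mulr0 !mul0r.
by rewrite h ?mulr1 ?mul1r; [rewrite mulrCA|exact: set_mem].
Qed.

Lemma pullL2_oo_bounded : oo_bounded pullL2 (Num.sqrt k).
Proof.
move=> a a1; exists (pulloo a); first exact: le_trans (normoo_pulloo a) a1.
apply/cLp_eqP; have h1 := cLp_scaleE (Num.sqrt k)%:C%C (hat (pulloo a)).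
apply: filterS2 (filterI (pullL2_ae (hat a)) (transfer_ae (hat_ae a)))
  (filterI h1 (filterI (hat_ae (pulloo a)) (pulloo_ae a))).
move=> x [-> h] [e1 [e2 e3]].
rewrite -[RHS]/(cLp_scale _ _ x) e1 e2 e3 indicE.
have [xA|xA] := boolP (x \in A); last by rewrite mulr0 !mul0r mulr0.
by rewrite mulr1 mul1r h//; exact: set_mem.
Qed.

End Transfer.

(** * Duality tests for bounded and for positive functions *)

Section Duality.
Context (R : realType) d (X : measurableType d) (mu : probability X R).
Implicit Types (f g h : L2 mu) (S : set X).

Definition indL2 S : L2 mu := toL2 mu (fun x => (\1_S x : R)%:C%C).

Lemma L2fun_ind S : measurable S -> L2fun mu (fun x => (\1_S x : R)%:C%C).
Proof.
move=> mS; apply: (@L2fun_bounded _ _ _ _ _ 1); first exact: cmeas_indic.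
by move=> x; rewrite normc_real indicE; case: (_ \in _); rewrite ?normr0 ?normr1.
Qed.

Lemma inner_indL2 g S : measurable S ->
  inner g (indL2 S) = cintegral mu (fun x => (\1_S x : R)%:C%C * g x).
Proof.
move=> mS; apply: cintegral_ae.
- exact: cmeas_inner.
- by apply: cmeasM => //; exact: cmeas_indic.
by apply: filterS (toL2E (L2fun_ind mS)) => x ->; rewrite conjcR mulrC.
Qed.

Lemma meas_gt (u v : X -> R) : measurable_fun setT u -> measurable_fun setT v ->
  measurable [set x | u x < v x].
Proof.
move=> hu hv; have h := measurable_funB hv hu.
rewrite (_ : [set x | _] = (fun x => v x - u x) @^-1` `]0, +oo[).
  by rewrite -[X in measurable X]setTI; exact: h.
by apply/seteqP; split => x /=; rewrite in_itv /= andbT subr_gt0.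
Qed.

(** Test against the phase of [g] on the set where the bound fails. *)
Lemma bounded_of_dual g (M : R) : 0 <= M ->
  (forall h, normc (inner g h) <= M * norm1 h) -> {ae mu, forall x, normc (g x) <= M}.
Proof.
move=> M0 hg; pose C := [set x | M < normc (g x)].
have mn : measurable_fun setT (fun x => normc (g x)) by exact: meas_normc.
have mC : measurable C by apply: meas_gt.
pose u x := (\1_C x : R)%:C%C * phase (g x).
have um : cmeasurable u.
  by apply: cmeasM; [exact: cmeas_indic|exact: cmeas_phase].
have u1 x : normc (u x) <= \1_C x.
  rewrite /u normcM normc_real indicE; case: (_ \in _).
    by rewrite normr1 mul1r normc_phase_le1.
  by rewrite normr0 mul0r.
have hu : L2fun mu u.
  apply: (@L2fun_bounded _ _ _ _ _ 1) => // x; apply: le_trans (u1 x) _.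
  by rewrite indicE; case: (_ \in _).
have ig := (L2_cint g).2.
have i1 : intble mu (\1_C : X -> R).
  apply: (@intble_bounded _ _ _ _ _ 1); first exact: measurable_indic.
  by move=> x; rewrite indicE; case: (_ \in _); rewrite ?normr0 ?normr1.
have e1 : inner g (toL2 mu u) = (\int[mu]_x (\1_C x * normc (g x)))%:C%C.
  rewrite -cintegral_real; apply: cintegral_ae.
  - exact: cmeas_inner.
  - apply: cmeas_real; apply: measurable_funM => //; exact: measurable_indic.
  apply: filterS (toL2E hu) => x ->; rewrite /u conjcM conjcR mulrCA mul_phaseJ.
  by rewrite -realcM.
have I0 : 0 <= \int[mu]_x (\1_C x * normc (g x)).
  by apply: Rint_ge0 => x; rewrite mulr_ge0 ?normc_ge0// indicE.
have e2 : norm1 (toL2 mu u) <= \int[mu]_x \1_C x.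
  rewrite (norm1_ae um (toL2E hu)); apply: Rint_le => //; by case: (cint_L2 hu).
have := hg (toL2 mu u); rewrite e1 normc_real ger0_norm// => h.
pose F x := \1_C x * (normc (g x) - M).
have iF : intble mu F.
  by apply: intble_indic => //; apply: intbleB => //; exact: intble_cst.
have F0 x : 0 <= F x.
  rewrite /F indicE; have [xC|_] := boolP (x \in C); last by rewrite mul0r.
  by rewrite mul1r subr_ge0 ltW//; exact: (set_mem xC).
have hF : \int[mu]_x F x <= 0.
  rewrite /F; under eq_Rintegral do rewrite mulrBr (mulrC _ M).
  rewrite RintB; [|exact: intble_indic|exact: intbleZ].
  by rewrite RintZ// subr_le0; apply: le_trans h _; rewrite ler_wpM2l.
apply: filterS (Rint_eq0 iF F0 hF) => x; rewrite /F indicE.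
have [xC|xC _] := boolP (x \in C).
  by rewrite mul1r => /eqP; rewrite subr_eq0 => /eqP ->.
by rewrite leNgt; apply/negP => hx; move: xC; rewrite mem_set.
Qed.

(** Test against the indicator of the set where the inequality fails. *)
Lemma Re_ge0_of_dual g :
  (forall S, measurable S -> 0 <= cRe (inner g (indL2 S))) ->
  {ae mu, forall x, 0 <= cRe (g x)}.
Proof.
move=> hg; have mr : measurable_fun setT (fun x => cRe (g x)) by case: (L2_meas g).
pose S := [set x | cRe (g x) < 0].
have mS : measurable S by apply: meas_gt => //; exact: measurable_cst.
have := hg S mS; rewrite inner_indL2// /cintegral /=.
under eq_Rintegral do rewrite cReZ; move=> h.
have ig := cint_Re (L2_cint g).
pose F x := - (\1_S x * cRe (g x)).
have iF : intble mu F.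
  rewrite /F; under eq_fun do rewrite -mulN1r.
  by apply: intbleZ; exact: intble_indic.
have F0 x : 0 <= F x.
  rewrite /F indicE; have [xS|_] := boolP (x \in S); last by rewrite mul0r oppr0.
  by rewrite mul1r oppr_ge0 ltW//; exact: (set_mem xS).
have hF : \int[mu]_x F x <= 0.
  rewrite /F; under eq_Rintegral do rewrite -mulN1r.
  by rewrite RintZ ?mulN1r ?oppr_le0//; exact: intble_indic.
apply: filterS (Rint_eq0 iF F0 hF) => x; rewrite /F indicE.
have [xS|xS _] := boolP (x \in S).
  by rewrite mul1r => /eqP; rewrite oppr_eq0 => /eqP ->.
by rewrite leNgt; apply/negP => hx; move: xS; rewrite mem_set.
Qed.

Lemma Im_eq0_of_dual g :
  (forall S, measurable S -> cIm (inner g (indL2 S)) = 0) ->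
  {ae mu, forall x, cIm (g x) = 0}.
Proof.
move=> hg.
have h z : (z = 'i%C \/ z = - 'i%C :> R[i]) -> {ae mu, forall x, 0 <= cRe (z * g x)}.
  move=> hz; have hc : {ae mu, forall x, 0 <= cRe (cLp_fun (z *: g) x)}.
    apply: Re_ge0_of_dual => S mS; rewrite innerZl; move: (hg S mS).
    by case: (inner g (indL2 S)) => p q /= ->; case: hz => -> /=;
      rewrite ?oppr0 ?mulr0 ?mul0r ?subr0.
  by apply: filterS2 hc (cLp_scaleE z g) => x + <-.
apply: filterS2 (h 'i%C (or_introl erefl)) (h (- 'i%C) (or_intror erefl)) => x.
case: (g x) => p q /=; rewrite ?oppr0 ?mul0r ?mul1r ?sub0r ?mulN1r ?opprK => h1 h2.
by apply/eqP; rewrite eq_le h2 -oppr_ge0 h1.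
Qed.

Lemma dense_ext (U1 U2 : L2 mu -> L2 mu) (c1 c2 : R) : 0 <= c1 -> 0 <= c2 ->
  bounded_by U1 c1 -> bounded_by U2 c2 ->
  (forall (u : X -> R[i]) (N : R), cmeasurable u -> (forall x, normc (u x) <= N) ->
     U1 (toL2 mu u) = U2 (toL2 mu u)) -> U1 = U2.
Proof.
move=> c10 c20 [lin1 b1] [lin2 b2] hU; apply/funext => f.
apply/eqP; rewrite -subr_eq0; apply/eqP/norm2_eq0/eqP; rewrite eq_le norm2_ge0 andbT.
apply/ler_addgt0Pr => e e0; rewrite add0r.
have c0 : 0 < c1 + c2 + 1 by rewrite ltr_wpDl// addr_ge0.
have [u [um [N uN] _ hu]] := dense_bounded f (divr_gt0 e0 c0).
set g := f - toL2 mu u in hu.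
have -> : U1 f - U2 f = U1 g - U2 g.
  by rewrite /g (linB _ _ lin1) (linB _ _ lin2) (hU u N)// opprB subrKA.
apply: le_trans (norm2B _ _) _; apply: le_trans (lerD (b1 _) (b2 _)) _.
rewrite -mulrDl; apply: (@le_trans _ _ ((c1 + c2) * (e / (c1 + c2 + 1)))).
  by rewrite ler_wpM2l ?addr_ge0// ltW.
by rewrite mulrA ler_pdivrMr// mulrC ler_pM2l// lerDl.
Qed.

End Duality.

(** * Boundary states and factor maps *)

(** The states whose absence is the second half of proper proximality. *)
Definition boundary_state (R : realType) (Gamma : groupType)
    d (X : measurableType d) (mu : probability X R) (act : Gamma -> X -> X)
    (phi : (L2 mu -> L2 mu) -> R[i]) :=
  [/\ state_on (SM (mu:=mu)) phi,
      central_on (SM (mu:=mu)) phi,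
      invariant_on act (SM (mu:=mu)) phi,
      forall T, Koo1 T -> phi T = 0 &
      normal (fun a : Loo mu => phi (lmul a))].

Section Koopman.
Context (R : realType) (Gamma : groupType).
Context d (X : measurableType d) (mu : probability X R) (act : Gamma -> X -> X).
Hypothesis pmp : pmp_action mu act.
Implicit Types (f g : L2 mu) (t : Gamma).

Let mact t : measurable_fun setT (act t). Proof. by case: pmp. Qed.

Lemma act_link t (S : set X) : measurable S ->
  fine (mu S) = 1 * fine (mu (act t @^-1` S `&` setT)).
Proof. by move=> mS; case: pmp => _ h _ _; rewrite mul1r setIT h. Qed.

(** Koopman operators are a case of the isometries induced by factor maps. *)
Lemma koopmanE t : koopman act t = pullL2 mu (act t^-1%g) setT 1 :> (L2 mu -> L2 mu).
Proof.
apply/funext => f; rewrite /koopman /pullL2; congr toLp; apply/funext => x.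
by rewrite sqrtr1 indicT mulr1 mul1r.
Qed.

Lemma act_ae t (P : X -> Prop) : {ae mu, forall x, P x} ->
  {ae mu, forall x, P (act t x)}.
Proof.
move=> h; apply: filterS (transfer_ae (mact t) measurableT ltr01 (act_link t) h).
by move=> x; exact.
Qed.

Lemma koopman_ae t f : {ae mu, forall x, koopman act t f x = f (act t^-1%g x)}.
Proof.
rewrite koopmanE.
apply: filterS (pullL2_ae (mact t^-1%g) measurableT ltr01 (act_link _) f) => x ->.
by rewrite sqrtr1 indicT mulr1 mul1r.
Qed.

Lemma actK t x : act t^-1%g (act t x) = x.
Proof. by case: pmp => _ _ h1 hM; rewrite -hM mulVg. Qed.

Lemma koopmanK t f : koopman act t (koopman act t^-1%g f) = f.
Proof.
apply/cLp_eqP; apply: filterS2 (koopman_ae t (koopman act t^-1%g f))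
  (act_ae t^-1%g (koopman_ae t^-1%g f)) => x -> ->.
by congr (cLp_fun f _); rewrite actK.
Qed.

Lemma koopman_adj t f g :
  inner (koopman act t f) g = inner f (koopman act t^-1%g g).
Proof.
rewrite -{1}(koopmanK t g) !(koopmanE t).
exact: (inner_pullL2 (mact _) measurableT ltr01 (act_link _)).
Qed.

End Koopman.

Section Pull.
Context (R : realType) (Gamma : groupType).
Context d (X : measurableType d) (mu : probability X R) (actX : Gamma -> X -> X).
Context d' (Y : measurableType d') (lam : probability Y R) (actY : Gamma -> Y -> Y).
Variables (pi : X -> Y) (A : set X) (k : R).
Hypotheses (mpi : measurable_fun setT pi) (mA : measurable A) (k0 : 0 < k).
Hypothesis link : forall S : set Y, measurable S ->
  fine (lam S) = k * fine (mu (pi @^-1` S `&` A)).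
Hypotheses (pX : pmp_action mu actX) (pY : pmp_action lam actY).
Hypothesis equi : forall t, {ae mu, forall x, pi (actX t x) = actY t (pi x)}.
Hypothesis invA : forall t, {ae mu, forall x, \1_A (actX t x) = \1_A x :> R}.

Local Notation V := (pullL2 mu pi A k : L2 lam -> L2 mu).
Local Notation pull := (pulloo mu pi A : Loo lam -> Loo mu).

Lemma pull_koopman t f : V (koopman actY t f) = koopman actX t (V f).
Proof.
apply/cLp_eqP; have hV := pullL2_ae mpi mA k0 link.
apply: filterS3 (filterI (hV (koopman actY t f))
    (transfer_ae mpi mA k0 link (koopman_ae pY t f)))
  (filterI (koopman_ae pX t (V f)) (act_ae pX t^-1%g (hV f)))
  (filterI (equi t^-1%g) (invA t^-1%g)) => x [-> h] [-> ->] [-> ->].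
rewrite !indicE; have [xA|xA] := boolP (x \in A); last by rewrite mulr0 !mul0r.
by rewrite h//; exact: set_mem.
Qed.

Variable S : L2 mu -> L2 lam.
Hypotheses (bS : bounded_by S 1).
Hypothesis adj : forall f g, inner (V f) g = inner f (S g).

Let bV : bounded_by V 1. Proof. exact: (pullL2_by mpi mA k0 link). Qed.

Lemma adj_inner g h : inner (S g) h = inner g (V h).
Proof. by rewrite innerC -adj -innerC. Qed.

Lemma SV f : S (V f) = f.
Proof. by apply: inner_eq => h; rewrite adj_inner (inner_pullL2 mpi mA k0 link). Qed.

Lemma S_lmul a g : S (lmul (pull a) g) = lmul a (S g).
Proof.
apply: inner_eq => h; rewrite adj_inner !inner_lmul (star_pulloo mpi mA k0 link).
by rewrite -(pullL2_lmul mpi mA k0 link) -adj_inner.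
Qed.

Lemma S_koopman t g : S (koopman actX t g) = koopman actY t (S g).
Proof.
apply: inner_eq => h.
by rewrite adj_inner (koopman_adj pX) (koopman_adj pY) -pull_koopman -adj_inner.
Qed.

(** The conditional expectation is a contraction for the L1 norm because it is
    dual to the contraction of L^oo induced by the factor map. *)
Lemma S_l1_bounded : l1_bounded S (Num.sqrt k).
Proof.
move=> g; pose u y := phase (S g y).
have um : cmeasurable u by exact: cmeas_phase.
have u1 y : normc (u y) <= 1 by exact: normc_phase_le1.
have hu := L2fun_bounded lam um u1.
have e1 : inner (S g) (toL2 lam u) = (norm1 (S g))%:C%C.
  rewrite -cintegral_real; apply: cintegral_ae.
  - exact: cmeas_inner.
  - by apply: cmeas_real; exact: meas_normc.
  by apply: filterS (toL2E hu) => y ->; rewrite mul_phaseJ.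
have l0 : 0 <= norm1 (S g) by apply: Rint_ge0 => y; exact: normc_ge0.
have -> : norm1 (S g) = normc (inner g (V (toL2 lam u))).
  by rewrite -adj_inner e1 normc_real ger0_norm.
apply: le_trans (normc_cintegral_le (inner_cint _ _)) _.
have ig := (L2_cint g).2.
rewrite /norm1 -RintZ//; apply: Rint_ae_le.
- by case: (inner_cint g (V (toL2 lam u))).
- exact: intbleZ.
apply: filterS (pullL2_toL2 mpi mA k0 link hu) => x ->.
rewrite normcM normc_conj mulrC ler_wpM2r ?normc_ge0//.
rewrite normcM normc_real normrM (ger0_norm (sqrtr_ge0 _)) -mulrA.
rewrite ler_piMr ?sqrtr_ge0// indicE; case: (_ \in _).
  by rewrite normr1 mul1r.
by rewrite normr0 mul0r.
Qed.

Lemma compress_Koo1 T : Koo1 T -> Koo1 (S \o T \o V).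
Proof.
exact: (Koo1_comp ler01 ler01 (sqrtr_ge0 k) (sqrtr_ge0 k) bV bS
  (pullL2_oo_bounded mpi mA k0 link) S_l1_bounded).
Qed.

Lemma compress_bounded T : bounded_operators T -> bounded_operators (S \o T \o V).
Proof.
move=> /boundedP[c c0 hT]; apply/boundedP.
exists (1 * c * 1); first by rewrite !mulr_ge0.
by apply: (bounded_by_comp _ bV (bounded_by_comp _ hT bS)); rewrite ?mulr_ge0.
Qed.

Lemma compress_SM T : SM T -> SM (S \o T \o V).
Proof.
move=> /SMP[bT h]; apply/SMP; split; first exact: compress_bounded.
move=> a; have := compress_Koo1 (h (pull a)); congr Koo1; apply/funext => f.
rewrite -[LHS]/(S (T (lmul (pull a) (V f)) - lmul (pull a) (T (V f)))).
rewrite (linB _ _ bS.1) S_lmul -(pullL2_lmul mpi mA k0 link).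
by [].
Qed.

Definition one : L2 lam := toL2 lam (fun=> 1).

(** The conditional expectation from the algebra of [mu] onto that of [lam], first with
    values in L2, where it can be defined by the adjoint [S]. *)
Definition expectL2 (a : Loo mu) : L2 lam := S (lmul a (V one)).

Definition expect (a : Loo mu) : Loo lam := toLoo lam (expectL2 a).

Lemma one_L2 : L2fun lam (fun=> 1).
Proof.
apply: (@L2fun_bounded _ _ _ _ _ 1); first exact: cmeas_cst.
by move=> _; rewrite normc1.
Qed.

Lemma V_one_ae : {ae mu, forall x, V one x = (Num.sqrt k * \1_A x)%:C%C}.
Proof.
by apply: filterS (pullL2_toL2 mpi mA k0 link one_L2) => x ->; rewrite mulr1.
Qed.

Lemma expectL2_le a : {ae lam, forall y, normc (expectL2 a y) <= normoo a}.
Proof.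
apply: bounded_of_dual; first exact: normoo_ge0.
move=> h; rewrite adj_inner.
apply: le_trans (normc_cintegral_le (inner_cint _ _)) _.
have ih := (L2_cint h).2.
have ip := transfer_intble mpi mA k0 link ih.
rewrite /norm1 (transfer_Rint mpi mA k0 link ih) -!RintZ//; last exact: intbleZ.
apply: Rint_ae_le.
- by case: (inner_cint (lmul a (V one)) (V h)).
- exact/intbleZ/intbleZ.
apply: filterS2 (filterI (lmul_ae a (V one)) V_one_ae)
  (filterI (ooP a) (pullL2_ae mpi mA k0 link h)) => x [-> ->] [ax ->].
rewrite conjcM conjcR !normcM normc_conj !normc_real !normrM !(ger0_norm (sqrtr_ge0 _)).
have -> : `|\1_A x : R| = \1_A x by rewrite ger0_norm// indicE.
rewrite -!mulrA; apply: ler_pM => //; first exact: normc_ge0.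
  by rewrite !mulr_ge0 ?sqrtr_ge0 ?normc_ge0// indicE.
rewrite -{3}(sqr_sqrtr (ltW k0)) expr2 indicE.
by case: (_ \in _); rewrite ?mul1r ?mul0r ?mulr0// !mulrA.
Qed.

Lemma expect_ae a : {ae lam, forall y, expect a y = expectL2 a y}.
Proof. by apply: toLooE (expectL2_le a); exact: L2_meas. Qed.

(** Both sides commute with the multiplications from the algebra of [lam] and agree at
    the constant function, hence on bounded functions, which are dense. *)
Lemma compress_lmul a : S \o lmul a \o V = lmul (expect a).
Proof.
have b1 : bounded_by (S \o lmul a \o V) (1 * normoo a * 1).
  apply: (bounded_by_comp _ bV (bounded_by_comp _ (lmul_by a) bS)) => //.
  by rewrite mul1r normoo_ge0.
apply: (dense_ext _ _ b1 (lmul_by (expect a))).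
- by rewrite mulr1 mul1r normoo_ge0.
- exact: normoo_ge0.
move=> u N um uN; have hu := L2fun_bounded lam um uN.
have uN' : {ae lam, forall y, normc (u y) <= N} by exact: nearW.
have hb := toLooE um uN'; set b := toLoo lam u in hb.
have uE : toL2 lam u = lmul b one.
  apply/cLp_eqP; apply: filterS3 (filterI (toL2E hu) hb) (lmul_ae b one) (toL2E one_L2).
  by move=> y [-> e1] -> ->; rewrite e1 mulr1.
rewrite -[LHS]/(S (lmul a (V (toL2 lam u)))) uE (pullL2_lmul mpi mA k0 link).
rewrite lmulC S_lmul -/(expectL2 a); apply/cLp_eqP.
apply: filterS3 (filterI (lmul_ae b (expectL2 a)) (lmul_ae b one))
  (filterI (lmul_ae (expect a) (lmul b one)) (expect_ae a)) (toL2E one_L2).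
by move=> y [-> e1] [-> ->] e2; rewrite e1 e2 mulr1 mulrC.
Qed.

Lemma inner_expect a (B : set Y) : measurable B ->
  inner (expectL2 a) (indL2 lam B) =
  cintegral mu (fun x => (k * \1_A x * \1_B (pi x))%:C%C * a x).
Proof.
move=> mB; rewrite adj_inner; apply: cintegral_ae.
- exact: cmeas_inner.
- apply: cmeasM; last exact: oo_meas.
  apply: cmeas_real; apply: measurable_funM.
    by apply: measurable_funM => //; exact: measurable_indic.
  by apply: measurableT_comp => //; exact: measurable_indic.
apply: filterS2 (filterI (lmul_ae a (V one)) V_one_ae)
  (pullL2_toL2 mpi mA k0 link (L2fun_ind lam mB)) => x [-> ->] ->.
rewrite conjcM !conjcR -mulrA -!realcM [RHS]mulrC; congr (_ * _%:C%C).
have ks : Num.sqrt k * Num.sqrt k = k by rewrite -expr2 sqr_sqrtr// ltW.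
rewrite -[in RHS]ks !indicE.
by case: (_ \in A); rewrite ?mulr1 ?mulr0 ?mul0r ?mulrA.
Qed.

Let wgt (B : set Y) x : R := k * \1_A x * \1_B (pi x).

Let mwgt (B : set Y) : measurable B -> measurable_fun setT (wgt B).
Proof.
move=> mB; apply: measurable_funM.
  by apply: measurable_funM => //; exact: measurable_indic.
by apply: measurableT_comp => //; exact: measurable_indic.
Qed.

Let wgt_ge0 B x : 0 <= wgt B x.
Proof. by rewrite /wgt !mulr_ge0 ?(ltW k0)// indicE. Qed.

Let wgt_le B x : wgt B x <= k.
Proof.
rewrite /wgt !indicE; case: (_ \in A); case: (_ \in B);
  by rewrite ?mulr1 ?mulr0 ?mul0r ?(ltW k0).
Qed.

Let iwgt B (h : X -> R) : measurable B -> intble mu h ->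
  intble mu (fun x => wgt B x * h x).
Proof.
move=> mB ih; have i2 : intble mu (fun x => k * `|h x|).
  by apply: intbleZ; have := integrable_abse ih; rewrite /comp.
apply: intble_le i2 => [|x].
  by apply: measurable_funM; [exact: mwgt|exact: intble_meas ih].
by rewrite normrM ger0_norm// ler_wpM2r.
Qed.

Lemma inner_expect_Re a (B : set Y) : measurable B ->
  cRe (inner (expectL2 a) (indL2 lam B)) = \int[mu]_x (wgt B x * cRe (a x)).
Proof.
move=> mB; rewrite inner_expect//.
by apply: eq_Rintegral => x _; rewrite cReZ.
Qed.

Lemma inner_expect_Im a (B : set Y) : measurable B ->
  cIm (inner (expectL2 a) (indL2 lam B)) = \int[mu]_x (wgt B x * cIm (a x)).
Proof.
move=> mB; rewrite inner_expect//.
by apply: eq_Rintegral => x _; case: (a x) => p q /=; rewrite mul0r addr0.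
Qed.

Let iRe (a : Loo mu) : intble mu (fun x => cRe (a x)).
Proof. exact/cint_Re/oo_cint. Qed.

Let iIm (a : Loo mu) : intble mu (fun x => cIm (a x)).
Proof. exact/cint_Im/oo_cint. Qed.

Lemma expect_Im0 (a : Loo mu) : {ae mu, forall x, cIm (a x) = 0} ->
  {ae lam, forall y, cIm (expectL2 a y) = 0}.
Proof.
move=> ha; apply: Im_eq0_of_dual => B mB; rewrite inner_expect_Im//.
rewrite -[RHS](Rint_cst mu); apply: Rint_ae.
- by apply: intble_meas; apply: iwgt.
- exact: measurable_cst.
by apply: filterS ha => x ->; rewrite mulr0.
Qed.

Lemma expect_star (a : Loo mu) : star a = a -> star (expect a) = expect a.
Proof.
move=> sa; apply/cLp_eqP.
apply: filterS3 (star_ae (expect a)) (expect_ae a) (expect_Im0 (star_Im sa)) => y -> ->.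
by case: (expectL2 a y) => p q /= ->; rewrite oppr0.
Qed.

Let le_of_dual (g h : L2 lam) :
  (forall B, measurable B -> 0 <= cRe (inner (g - h) (indL2 lam B))) ->
  {ae lam, forall y, cRe (h y) <= cRe (g y)}.
Proof.
move=> gh; apply: filterS2 (Re_ge0_of_dual gh) (cLpB g h) => y + e.
by rewrite e cReB subr_ge0.
Qed.

Lemma expect_le (a b : Loo mu) : le_Loo a b -> {ae mu, forall x, cIm (a x) = 0} ->
  le_Loo (expect a) (expect b).
Proof.
move=> ab a0; have b0 : {ae mu, forall x, cIm (b x) = 0}.
  by apply: filterS2 (le_Loo_Im ab) a0 => x -> ->.
have hle : {ae lam, forall y, cRe (expectL2 a y) <= cRe (expectL2 b y)}.
  apply: le_of_dual => B mB; rewrite innerBl cReB !inner_expect_Re// subr_ge0.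
  apply: Rint_ae_le; [exact: iwgt|exact: iwgt|].
  by apply: filterS (le_Loo_Re ab) => x h; rewrite ler_wpM2l.
apply: filterS2 (filterI (expect_ae a) (expect_ae b))
  (filterI hle (filterI (expect_Im0 a0) (expect_Im0 b0))) => y [-> ->] [h [e1 e2]].
by rewrite lecE e1 e2 eqxx.
Qed.

(** Conditional expectation preserves suprema of directed families since the
    trace is normal: testing against an indicator, the defect is bounded by the
    defect of the traces. *)
Lemma expect_normal (D : set (Loo mu)) b : D !=set0 ->
  (forall a, D a -> star a = a) ->
  (forall a1 a2, D a1 -> D a2 ->
     exists a3, [/\ D a3, le_Loo a1 a3 & le_Loo a2 a3]) ->
  is_lub (@le_Loo _ _ _ mu) D b ->
  is_lub (@le_Loo _ _ _ lam) (expect @` D) (expect b).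
Proof.
move=> D0 sD dirD lubD; have [ubD _] := lubD; have [a0 Da0] := D0.
have ImD a : D a -> {ae mu, forall x, cIm (a x) = 0} by move=> Da; apply/star_Im/sD.
have Imb : {ae mu, forall x, cIm (b x) = 0}.
  by apply: filterS2 (le_Loo_Im (ubD _ Da0)) (ImD _ Da0) => x -> ->.
split=> [_ [a Da <-]|c hc]; first by apply: expect_le; [exact: ubD|exact: ImD].
have hc' a : D a -> le_Loo (expect a) c by move=> Da; apply: hc; exists a.
have Imc : {ae lam, forall y, cIm (c y) = 0}.
  apply: filterS3 (le_Loo_Im (hc' _ Da0)) (expect_ae a0) (expect_Im0 (ImD _ Da0)).
  by move=> y -> ->.
have hle : {ae lam, forall y, cRe (expectL2 b y) <= cRe (hat c y)}.
  apply: le_of_dual => B mB; rewrite innerBl cReB inner_expect_Re// subr_ge0.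
  apply/ler_addgt0Pr => e e0.
  have [a Da ha] := tau_approx D0 sD dirD lubD (divr_gt0 e0 k0).
  have h1 : \int[mu]_x (wgt B x * cRe (b x)) - \int[mu]_x (wgt B x * cRe (a x)) <= e.
    rewrite -RintB; [|exact: iwgt|exact: iwgt].
    apply: (@le_trans _ _ (\int[mu]_x (k * (cRe (b x) - cRe (a x))))).
      apply: Rint_ae_le.
      - by apply: intbleB; exact: iwgt.
      - by apply: intbleZ; exact: intbleB.
      apply: filterS (le_Loo_Re (ubD a Da)) => x h.
      by rewrite -mulrBr ler_wpM2r// subr_ge0.
    rewrite RintZ; last exact: intbleB.
    rewrite RintB// -!cRe_tau mulrC -ler_pdivlMr//.
    by move: ha; move: (cRe _) (cRe _) => ? ?; lra.
  have h2 : \int[mu]_x (wgt B x * cRe (a x)) <= cRe (inner (hat c) (indL2 lam B)).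
    rewrite -inner_expect_Re// !inner_indL2// /cintegral /=.
    have mi : measurable_fun setT (\1_B : Y -> R) by exact: measurable_indic.
    have i1 (g : L2 lam) : intble lam (fun y => cRe ((\1_B y : R)%:C%C * g y)).
      apply: cint_Re; split; first by apply: cmeasM => //; exact: cmeas_indic.
      apply: intble_le (L2_cint g).2.
        by apply: meas_normc; apply: cmeasM => //; exact: cmeas_indic.
      move=> y; rewrite ger0_norm ?normc_ge0// normcM normc_real ler_piMl ?normc_ge0//.
      by rewrite indicE; case: (_ \in _); rewrite ?normr0 ?normr1.
    apply: Rint_ae_le => //.
    apply: filterS3 (le_Loo_Re (hc' a Da)) (expect_ae a) (hat_ae c) => y + <- ->.
    by move=> h; rewrite !cReZ ler_wpM2l// indicE.
  by move: h1 h2; move: (cRe _) => ?; lra.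
apply: filterS2 (filterI (expect_ae b) (hat_ae c))
  (filterI hle (filterI (expect_Im0 Imb) Imc)) => y [-> e1] [h [e2 e3]].
by rewrite lecE e2 e3 eqxx /= -e1.
Qed.

(** Compressing by the isometry pulls a boundary state back along the factor
    map. Centrality for the larger algebra is automatic: as that algebra is
    abelian, its commutators with [T] in [SM] belong to [Koo1]. *)
Lemma boundary_state_pull phi : boundary_state actY phi ->
  boundary_state actX (fun T : L2 mu -> L2 mu => phi (S \o T \o V)).
Proof.
move=> [[lphi pphi phi1] _ iphi Kphi nphi].
split; [split| | | |].
- move=> z T1 T2 h1 h2; rewrite -lphi; [|exact: compress_SM..].
  congr phi; apply/funext => f.
  rewrite -[LHS]/(S (z *: T1 (V f) + T2 (V f))) bS.1.
  by [].
- move=> T hT pT; apply: pphi; first exact: compress_SM.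
  by move=> f; rewrite -[(_ \o _) f]/(S (T (V f))) adj_inner; exact: pT.
- by rewrite -phi1; congr phi; apply/funext => f; exact: SV.
- move=> a T hT.
  have h1 := compress_SM (SM_lmull a hT); have h2 := compress_SM (SM_lmulr a hT).
  have [_ /(_ a) hK] := (SMP T).1 hT.
  have := Kphi _ (compress_Koo1 hK).
  have -> : S \o ((T \o lmul a) - (lmul a \o T)) \o V =
      (-1) *: (S \o (lmul a \o T) \o V) + (S \o (T \o lmul a) \o V).
    apply/funext => f.
    rewrite -[LHS]/(S (T (lmul a (V f)) - lmul a (T (V f)))) (linB _ _ bS.1).
    rewrite -[RHS]/(-1 *: S (lmul a (T (V f))) + S (T (lmul a (V f)))).
    by rewrite scaleN1r addrC.
  by rewrite lphi// mulN1r addrC => /eqP; rewrite subr_eq0 => /eqP.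
- move=> t T hT; rewrite -[RHS](iphi t); last exact: compress_SM.
  congr phi; apply/funext => f /=.
  by rewrite S_koopman pull_koopman.
- by move=> T hT; apply: Kphi; exact: compress_Koo1.
move=> D b D0 sD dirD lubD.
have hE a : phi (S \o lmul a \o V) = phi (lmul (expect a)) by rewrite compress_lmul.
have -> : (fun a : Loo mu => phi (S \o lmul a \o V)) @` D =
    (fun a : Loo lam => phi (lmul a)) @` (expect @` D).
  apply/seteqP; split=> [_ [a Da <-]|_ [_ [a Da <-] <-]].
    by exists (expect a); [exists a|rewrite hE].
  by exists a => //; rewrite hE.
rewrite hE; apply: nphi; last exact: expect_normal.
- by have [a Da] := D0; exists (expect a), a.
- by move=> _ [a Da <-]; apply: expect_star; exact: sD.
move=> _ _ [a1 D1 <-] [a2 D2 <-]; have [a3 [D3 h1 h2]] := dirD a1 a2 D1 D2.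
exists (expect a3); split; [by exists a3|..].
  by apply: expect_le => //; exact/star_Im/sD.
by apply: expect_le => //; exact/star_Im/sD.
Qed.

End Pull.

(** * Weakly compact pieces of the factor *)

(** The state that witnesses weak compactness is defined on all bounded operators and
    restricts to the trace; its restriction to [SM] is a boundary state. *)
Lemma weakly_compact_boundary (R : realType) (Gamma : groupType)
    d (X : measurableType d) (mu : probability X R) (act : Gamma -> X -> X) :
  diffuse mu -> weakly_compact mu act ->
  exists phi, boundary_state (mu:=mu) act phi.
Proof.
move=> diff [phi [st tr ce iv]]; exists phi.
have sub (T : L2 mu -> L2 mu) : SM T -> bounded_operators T by case.
split.
- case: st => h1 h2 h3; split.
  + by move=> z T1 T2 hT1 hT2; apply: (h1 z T1 T2 (sub _ hT1) (sub _ hT2)).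
  + by move=> T hT pT; apply: (h2 T (sub _ hT) pT).
  + exact: h3.
- by move=> a T hT; apply: (ce a T (sub _ hT)).
- by move=> t T hT; apply: (iv t T (sub _ hT)).
- by move=> T hT; apply: (state_Koo1_0 diff st tr ce hT).
have -> : (fun a : Loo mu => phi (lmul a)) = (@tau _ _ _ mu) by apply/funext.
exact: tau_normal.
Qed.

Section Conditional.
Context (R : realType) (Gamma : groupType).
Context d (Y : measurableType d) (nu : probability Y R) (act : Gamma -> Y -> Y).
Variables (B : set Y) (mB : measurable B).
Hypothesis B0 : indicator nu B <> 0.

Local Notation lam := (conditional nu mB).

Lemma fine_nuB_gt0 : 0 < fine (nu B).
Proof.
rewrite lt_neqAle fine_mu_ge0 andbT eq_sym; apply/eqP => h; apply: B0.
apply/cLp_eqP.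
have nB : {ae nu, forall y, ~ B y}.
  exists B; split=> //; first by rewrite -[nu B]fineK ?h// fin_num_measure.
  by move=> y /= /contrapT.
apply: filterS3 (indicator_ae nu mB) (cLp0 nu (@le1_oo R)) nB => y -> e nBy.
by rewrite indicE memNset// -[RHS]/(cLp_fun (0 : Loo nu) y) e.
Qed.

Lemma conditionalE (S : set Y) : measurable S ->
  fine (lam S) = (fine (nu B))^-1 * fine (nu (S `&` B)).
Proof.
move=> mS; have b0 := fine_nuB_gt0.
have e : nu B = (fine (nu B))%:E by rewrite fineK// fin_num_measure.
rewrite /conditional /= /mnormalize /= /mrestr setTI e eqe (gt_eqF b0) /=.
by rewrite fineM// ?fin_num_measure//; [rewrite mulrC|exact: measurableI].
Qed.

Lemma conditional_diffuse : diffuse nu -> diffuse lam.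
Proof.
move=> diff A mA A0; have b0 := fine_nuB_gt0.
have mAB : measurable (A `&` B) by exact: measurableI.
have AB0 : 0 < fine (nu (A `&` B)).
  move: A0; rewrite fine_mu_gt0// conditionalE//.
  by rewrite pmulr_rgt0// invr_gt0.
have [|C [mC CAB C0 CltAB]] := diff _ mAB; first by rewrite fine_mu_gt0.
have CB : C `&` B = C by apply/setIidl => y /CAB[].
exists C; split=> //; first by move=> y /CAB[].
  by rewrite fine_mu_gt0// conditionalE// CB mulr_gt0 ?invr_gt0// -fine_mu_gt0.
rewrite -[ltLHS]fineK ?fin_num_measure// -[ltRHS]fineK ?fin_num_measure//.
rewrite lte_fin !conditionalE// CB ltr_pM2l ?invr_gt0//.
by rewrite -lte_fin !fineK// fin_num_measure.
Qed.

Hypothesis pmp : pmp_action nu act.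
Hypothesis invB : forall t, alpha act t (indicator nu B) = indicator nu B.

Lemma invariant_indic t : {ae nu, forall y, \1_B (act t y) = \1_B y :> R}.
Proof.
have h s : {ae nu, forall y, \1_B (act s^-1%g y) = \1_B y :> R}.
  have e1 := act_ae pmp s^-1%g (indicator_ae nu mB).
  have m1 : cmeasurable (fun y => indicator nu B (act s^-1%g y)).
    by apply: cmeas_pull; [case: pmp|exact: oo_meas].
  have e2 : {ae nu, forall y, alpha act s (indicator nu B) y
      = indicator nu B (act s^-1%g y)}.
    apply: (toLooE (c := 1)) => //; apply: filterS e1 => y ->.
    by rewrite normc_real indicE; case: (_ \in _); rewrite ?normr0 ?normr1.
  rewrite invB in e2.
  by apply: filterS3 e1 e2 (indicator_ae nu mB) => y -> -> /complexI.
by have := h t^-1%g; rewrite invgK.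
Qed.

(** The invariance of the class of the indicator means invariance of [B] up to a null
    set, which is enough for the measures. *)
Lemma conditional_pmp : pmp_action lam act.
Proof.
have [h1 h2 h3 h4] := pmp; split=> // t S mS.
have mtS : measurable (act t @^-1` S).
  by rewrite -[X in measurable X]setTI; exact: h1.
have mtB : measurable (act t @^-1` B).
  by rewrite -[X in measurable X]setTI; exact: h1.
have e : nu (act t @^-1` S `&` B) = nu (S `&` B).
  rewrite -(h2 t (S `&` B)); last exact: measurableI.
  rewrite preimage_setI -[LHS]fineK ?fin_num_measure//; last exact: measurableI.
  rewrite -[RHS]fineK ?fin_num_measure//; last exact: measurableI.
  rewrite -!Rint_indic; [|exact: measurableI..].
  congr EFin; apply: Rint_ae.
  - by apply: measurable_indic; exact: measurableI.
  - by apply: measurable_indic; exact: measurableI.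
  by apply: filterS (invariant_indic t) => y h; rewrite !indicI /= -h.
rewrite -[LHS]fineK ?fin_num_measure// -[RHS]fineK ?fin_num_measure//.
by rewrite !conditionalE// e.
Qed.

End Conditional.

Theorem theorem8p10 (R : realType) (Gamma : groupType)
    (d : measure_display) (X : measurableType d) (mu : probability X R)
    (actX : Gamma -> X -> X)
    (d' : measure_display) (Y : measurableType d') (nu : probability Y R)
    (actY : Gamma -> Y -> Y) (pi : X -> Y) :
  pmp_action mu actX ->
  pmp_action nu actY ->
  factor_map mu actX nu actY pi ->
  diffuse nu ->
  properly_proximal mu actX ->
  properly_proximal nu actY.
Proof.
move=> pX pY [mpi fpi equi] diff [_ noX].
have mpre (S : set Y) : measurable S -> measurable (pi @^-1` S).
  by move=> mS; rewrite -[pi @^-1` S]setTI; exact: mpi.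
have pull (lam : probability Y R) (A : set X) (k : R) : measurable A -> 0 < k ->
    (forall S, measurable S -> fine (lam S) = k * fine (mu (pi @^-1` S `&` A))) ->
    pmp_action lam actY ->
    (forall t, {ae mu, forall x, \1_A (actX t x) = \1_A x :> R}) ->
    ~ exists phi, boundary_state (mu:=lam) actY phi.
  move=> mA k0 link pL invA [phi bphi].
  have [S [bS adj]] := adjoint_exists ler01 (pullL2_by mpi mA k0 link).
  apply: noX; exists (fun T => phi (S \o T \o pullL2 mu pi A k)).
  exact: (boundary_state_pull mpi mA k0 link pX pL equi invA bS adj bphi).
split.
- move=> [B [mB [B0 invB wcB]]].
  have b0 := fine_nuB_gt0 mB B0.
  have pL := conditional_pmp mB B0 pY invB.
  apply: (pull (conditional nu mB) (pi @^-1` B) (fine (nu B))^-1) => //.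
  + exact: mpre.
  + by rewrite invr_gt0.
  + move=> S mS; rewrite conditionalE// -preimage_setI fpi//.
    exact: measurableI.
  + move=> t; have link1 (S : set Y) : measurable S ->
        fine (nu S) = 1 * fine (mu (pi @^-1` S `&` setT)).
      by move=> mS; rewrite mul1r setIT fpi.
    have h := transfer_ae mpi measurableT ltr01 link1 (invariant_indic mB pY invB t).
    apply: filterS2 h (equi t) => x /(_ I) hx ex.
    have pre1 z : \1_(pi @^-1` B) z = \1_B (pi z) :> R by [].
    by rewrite !pre1 ex hx.
  + apply: weakly_compact_boundary wcB; exact: conditional_diffuse.
- apply: (pull nu setT 1) => //.
  + by move=> S mS; rewrite mul1r setIT fpi.
  + by move=> t; apply: nearW => x; rewrite !indicT.
Qed.
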